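(* Let $\mathfrak b$ be an NC rational function in $d$ variables with $0\in\mathrm{Dom}\,\mathfrak b$. Then $\mathfrak b\in[\mathbb H^\infty_d]_1$ if and only if $\mathfrak b$ is realized as the transfer function of the minimal and finite-dimensional Fornasini--Marchesini colligation $$U_{T,x}:=\begin{pmatrix}T_0^* & (1-\mathfrak b(0))\,T^*x\\ (1-\mathfrak b(0))\,\langle P_{\mathcal H_0}x,\cdot\rangle_{\mathcal H_0} & \mathfrak b(0)\end{pmatrix},\qquad \mathfrak b(0)=\frac{\|x\|^2+it-1}{\|x\|^2+it+1},\quad t\in\mathbb R,$$ where $T$ is a finite-dimensional row contraction on $\mathcal H$, $x\in\mathcal H$ is cyclic for both $T^*$ and the minimal row isometric dilation $V$ of $T$, $$T_0^*:=T^*\big(I-(1-\mathfrak b(0))\,\langle x,\cdot\rangle x\big)\big|_{\mathcal H_0}\qquad\text{and}\qquad \mathcal H_0:=\bigvee_{\omega\ne\emptyset}T^{*\omega}x.$$ Moreover, $\mathfrak b$ is inner if and only if $T$ is also a row co-isometry.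
   Context: Fix $d\in\mathbb N$. $\mathbb F^d$ is the free monoid of words in $1,\dots,d$ with unit $\emptyset$; for $\omega=i_1\cdots i_m$ and a $d$-tuple $A$ of operators, $A^\omega:=A_{i_1}\cdots A_{i_m}$; $A^{*\omega}$ is the same product formed from the adjoints, $A^{*\omega}:=A_{i_1}^*\cdots A_{i_m}^*$ (reversing the order of letters does not affect any of the spans below, which run over all words). $\bigvee$ denotes closed linear span; $\langle x,\cdot\rangle$ is linear in the second variable; $P_{\mathcal H_0}$ is the orthogonal projection onto $\mathcal H_0$. $\mathbb H^2_d$ is the Hilbert space of power series in non-commuting variables $\mathfrak z_1,\dots,\mathfrak z_d$ with square-summable coefficients. $\mathbb C^d_n=\mathbb C^{n\times n}\otimes\mathbb C^{1\times d}$ is the set of row $d$-tuples of $n\times n$ matrices, $\mathbb B^d_n=\{Z\in\mathbb C^d_n:\sum_jZ_jZ_j^*<I_n\}$, $\mathbb B^d_{\mathbb N}=\bigsqcup_n\mathbb B^d_n$. $\mathbb H^\infty_d$ is the algebra of NC functions uniformly bounded on $\mathbb B^d_{\mathbb N}$, identified isometrically with the left multipliers of $\mathbb H^2_d$; $[\mathbb H^\infty_d]_1$ is its closed unit ball; a multiplier is inner if the multiplication operator is isometric. An NC rational function is an equivalence class of valid expressions formed from the variables, scalars, $+,\cdot,{}^{-1}$, two being equivalent if they agree on the intersection of their domains (in matrix tuples of all sizes); its domain $\mathrm{Dom}$ is the union of the domains of its representatives. A (finite-dimensional) Fornasini--Marchesini (FM) colligation is $U=\begin{pmatrix}A&B\\C&D\end{pmatrix}:\mathcal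 M\oplus\mathbb C\to(\mathcal M\otimes\mathbb C^d)\oplus\mathbb C$, $\dim\mathcal M<\infty$, with components $A_j\in\mathcal L(\mathcal M)$, $B_j\in\mathcal M$ ($1\le j\le d$), $C:\mathcal M\to\mathbb C$, $D\in\mathbb C$; its transfer function is $\mathfrak r(Z)=D I_n+(I_n\otimes C)\big(I_n\otimes I-\sum_jZ_j\otimes A_j\big)^{-1}\big(\sum_jZ_j\otimes B_j\big)$, $Z\in\mathbb C^d_n$. It is minimal if $\dim\mathcal M$ is as small as possible among FM realizations of the same function (equivalently $\mathcal M=\bigvee_{\omega,j}A^\omega B_j$ and $\mathcal M=\bigvee_\omega A^{*\omega}C^*$). In $U_{T,x}$ the state space is $\mathcal H_0$, $A_j=T_j^*(I-(1-\mathfrak b(0))\langle x,\cdot\rangle x)|_{\mathcal H_0}$ and $B_j=(1-\mathfrak b(0))T_j^*x$. A row contraction on $\mathcal H$ is a $d$-tuple $T=(T_1,\dots,T_d):\mathcal H\otimes\mathbb C^d\to\mathcal H$ with $\sum_jT_jT_j^*\le I$; it is finite-dimensional if $\dim\mathcal H<\infty$, and a row co-isometry if $\sum_jT_jT_j^*=I$; $T^*$ denotes the column of adjoints. Its minimal row isometric dilation is the (unique up to unitary equivalence) row isometry $V$ (i.e. $V_j^*V_k=\delta_{jk}I$) on $\mathcal K\supseteq\mathcal H$ with $\mathcal H$ co-invariant for $V$, $V_j^*|_{\mathcal H}=T_j^*$, $\mathcal K=\bigvee_\omega V^\omega\mathcal H$. $x$ is cyclic for $T^*$ if $\bigvee_\omega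 T^{*\omega}x=\mathcal H$ and cyclic for $V$ if $\bigvee_\omega V^\omega x=\mathcal K$.
   Formalization: The function b is additionally assumed not to be the constant 1, where the printed equivalence fails: 1 lies in the closed unit ball of H^∞_d, but (‖x‖²+it−1)/(‖x‖²+it+1) never equals 1. *)

(* Defs.v *)
From HB Require Import structures.
From mathcomp Require Import all_boot all_order all_algebra.
From mathcomp Require Import all_classical all_reals all_analysis.
From mathcomp Require Import complex mxtens.

Set Implicit Arguments.
Unset Strict Implicit.
Unset Printing Implicit Defensive.

Import Order.TTheory GRing.Theory Num.Theory.
Import numFieldNormedType.Exports.

Local Open Scope classical_set_scope.
Local Open Scope ring_scope.
Local Open Scope complex_scope.
Local Open Scope sesquilinear_scope.

(** Finite-dimensional Hilbert spaces are taken in the form [C^N], i.e. column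
    vectors with the standard inner product. *)

Definition cdot (R : realType) (N : nat) (x y : 'cV[R[i]]_N) : R[i] :=
  (x^t* *m y) 0 0.

Definition cnorm (R : realType) (N : nat) (x : 'cV[R[i]]_N) : R :=
  Num.sqrt (complex.Re (cdot x x)).

(** In the order of [R[i]], [0 <= z] also says that [z] is real; hence these are
    the Loewner order and its strict (positive definite) version. *)
Definition loewner_le (R : realType) (n : nat) (P Q : 'M[R[i]]_n) : Prop :=
  forall v : 'cV[R[i]]_n, 0 <= cdot v ((Q - P) *m v).

Definition loewner_lt (R : realType) (n : nat) (P Q : 'M[R[i]]_n) : Prop :=
  forall v : 'cV[R[i]]_n, v != 0 -> 0 < cdot v ((Q - P) *m v).

Definition opnorm (R : realType) (n : nat) (W : 'M[R[i]]_n) : \bar R :=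
  ereal_sup [set (cnorm (W *m v))%:E | v in [set v : 'cV[R[i]]_n | cnorm v <= 1]].

Definition linspan (K : fieldType) (V : lmodType K) (S : set V) : set V :=
  [set v | exists (n : nat) (a : 'I_n -> K) (u : 'I_n -> V),
     (forall k, S (u k)) /\ v = \sum_(k < n) a k *: u k].

(** The same span, as a [{vspace V}], for finite-dimensional [V] (where it is
    automatically closed). *)
Definition vspan (K : fieldType) (V : vectType K) (S : set V) : {vspace V} :=
  xget 0%VS [set U : {vspace V} | [set` U] = linspan S].

Definition orth_proj (R : realType) (N : nat) (U : {vspace 'cV[R[i]]_N})
    (x : 'cV[R[i]]_N) : 'cV[R[i]]_N :=
  xget 0 [set p | p \in U /\ forall u, u \in U -> cdot u (x - p) = 0].

Definition word (d : nat) := seq 'I_d.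

(** [A^w v = A_(i1) (... (A_(im) v))] for [w = i1 ... im] *)
Definition word_act (d : nat) (V : Type) (A : 'I_d -> V -> V) (w : word d)
    (v : V) : V :=
  foldr A v w.

Definition mxtuple (R : realType) (d n : nat) := 'I_d -> 'M[R[i]]_n.

Definition mxword (R : realType) (d n : nat) (Z : mxtuple R d n) (w : word d) :
    'M[R[i]]_n :=
  foldr (fun j W => Z j *m W) 1%:M w.

(** The row ball at level [n]; levels start at 1. *)
Definition row_ball (R : realType) (d n : nat) (Z : mxtuple R d n) : Prop :=
  (0 < n)%N /\ loewner_lt (\sum_j Z j *m (Z j)^t*) 1%:M.

Inductive nc_expr (R : realType) (d : nat) : Type :=
| NCVar of 'I_d
| NCConst of R[i]
| NCAdd of nc_expr R d & nc_expr R d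
| NCMul of nc_expr R d & nc_expr R d
| NCInv of nc_expr R d.

(** [None] outside of the domain of the expression. *)
Fixpoint nc_expr_eval (R : realType) (d n : nat) (r : nc_expr R d)
    (Z : mxtuple R d n) : option 'M[R[i]]_n :=
  match r with
  | NCVar j => Some (Z j)
  | NCConst c => Some c%:M
  | NCAdd r1 r2 =>
      if nc_expr_eval r1 Z is Some W1 then
        if nc_expr_eval r2 Z is Some W2 then Some (W1 + W2) else None
      else None
  | NCMul r1 r2 =>
      if nc_expr_eval r1 Z is Some W1 then
        if nc_expr_eval r2 Z is Some W2 then Some (W1 *m W2) else None
      else None
  | NCInv r1 =>
      if nc_expr_eval r1 Z is Some W1 then
        if W1 \in unitmx then Some (invmx W1) else None
      else None
  end.

Definition nc_expr_valid (R : realType) (d : nat) (r : nc_expr R d) : Prop :=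
  exists (n : nat) (Z : mxtuple R d n), (0 < n)%N /\ nc_expr_eval r Z <> None.

Definition nc_expr_equiv (R : realType) (d : nat) (r s : nc_expr R d) : Prop :=
  forall (n : nat) (Z : mxtuple R d n) (W W' : 'M[R[i]]_n), (0 < n)%N ->
    nc_expr_eval r Z = Some W -> nc_expr_eval s Z = Some W' -> W = W'.

Record nc_ratfun (R : realType) (d : nat) := NCRatFun {
  nc_reps : set (nc_expr R d);
  nc_repsP : exists2 r, nc_expr_valid r &
    nc_reps = [set s | nc_expr_valid s /\ nc_expr_equiv r s] }.

Definition nc_val (R : realType) (d : nat) (b : nc_ratfun R d) (n : nat)
    (Z : mxtuple R d n) : set 'M[R[i]]_n :=
  [set W | exists2 r, nc_reps b r & nc_expr_eval r Z = Some W].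

Definition nc_dom (R : realType) (d : nat) (b : nc_ratfun R d) (n : nat)
    (Z : mxtuple R d n) : Prop :=
  (0 < n)%N /\ exists W, nc_val b Z W.

(** Any two values coincide, as the representatives are equivalent; [0] is the
    junk value outside of the domain. *)
Definition nc_eval (R : realType) (d : nat) (b : nc_ratfun R d) (n : nat)
    (Z : mxtuple R d n) : 'M[R[i]]_n :=
  xget 0 (nc_val b Z).

Definition origin (R : realType) (d : nat) : mxtuple R d 1 := fun=> 0.
Arguments origin : clear implicits.

Definition nc_at0 (R : realType) (d : nat) (b : nc_ratfun R d) : R[i] :=
  nc_eval b (origin R d) 0 0.

Definition dsum_tuple (R : realType) (d n m : nat) (Z : mxtuple R d n)
    (W : mxtuple R d m) : mxtuple R d (n + m) :=
  fun j => block_mx (Z j) 0 0 (W j).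

Definition graded_fun (R : realType) (d : nat) :=
  forall n : nat, mxtuple R d n -> 'M[R[i]]_n.

(** Only the values of [f] on the row ball matter below. *)
Definition nc_fun_on_ball (R : realType) (d : nat) (f : graded_fun R d) : Prop :=
  (forall (n m : nat) (Z : mxtuple R d n) (W : mxtuple R d m),
      row_ball Z -> row_ball W ->
      f (n + m)%N (dsum_tuple Z W) = block_mx (f n Z) 0 0 (f m W)) /\
  (forall (n : nat) (Z : mxtuple R d n) (S : 'M[R[i]]_n),
      S \in unitmx -> row_ball Z ->
      row_ball (fun j => invmx S *m Z j *m S) ->
      f n (fun j => invmx S *m Z j *m S) = invmx S *m f n Z *m S).

Definition hinf_norm (R : realType) (d : nat) (f : graded_fun R d) : \bar R :=
  ereal_sup [set e | exists (n : nat) (Z : mxtuple R d n),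
                       row_ball Z /\ e = opnorm (f n Z)].

Definition in_hinf (R : realType) (d : nat) (f : graded_fun R d) : Prop :=
  nc_fun_on_ball f /\ (hinf_norm f < +oo)%E.

(** Elements of H^2_d are formal power series, given by their coefficients. *)
Definition nc_series (R : realType) (d : nat) := word d -> R[i].

Definition h2_sqnorm (R : realType) (d : nat) (c : nc_series R d) : \bar R :=
  (\esum_(w in [set: word d]) ((complex.Re `|c w|) ^+ 2)%:E)%E.

Definition in_h2 (R : realType) (d : nat) (c : nc_series R d) : Prop :=
  (h2_sqnorm c < +oo)%E.

(** Sum of the series at [Z], grouped by homogeneous degree. *)
Definition h2_eval (R : realType) (d : nat) (c : nc_series R d) (n : nat)
    (Z : mxtuple R d n) : 'M[(R[i])^o]_n :=
  lim ((fun m : nat => \sum_(0 <= k < m) \sum_(w : k.-tuple 'I_d)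
         (c w *: mxword Z w : 'M[(R[i])^o]_n)) @ \oo).

(** The left multiplication [h |-> f h] maps H^2_d into itself isometrically. *)
Definition isometric_multiplier (R : realType) (d : nat) (f : graded_fun R d) :
    Prop :=
  forall c : nc_series R d, in_h2 c ->
    exists g : nc_series R d, [/\ in_h2 g, h2_sqnorm g = h2_sqnorm c &
      forall (n : nat) (Z : mxtuple R d n), row_ball Z ->
        h2_eval g Z = f n Z *m h2_eval c Z].

Definition ratfun_in_hinf (R : realType) (d : nat) (b : nc_ratfun R d) : Prop :=
  (forall (n : nat) (Z : mxtuple R d n), row_ball Z -> nc_dom b Z) /\
  in_hinf (@nc_eval R d b).

Definition ratfun_in_hinf_ball (R : realType) (d : nat) (b : nc_ratfun R d) :
    Prop :=
  ratfun_in_hinf b /\ (hinf_norm (@nc_eval R d b) <= 1)%E.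

Definition inner (R : realType) (d : nat) (b : nc_ratfun R d) : Prop :=
  ratfun_in_hinf b /\ isometric_multiplier (@nc_eval R d b).

Record fm_colligation (R : realType) (d : nat) (M : vectType R[i]) :=
  FMColligation {
    fmA : 'I_d -> 'End(M);
    fmB : 'I_d -> M;
    fmC : 'Hom(M, (R[i])^o);
    fmD : R[i] }.

(** Coordinates in the basis [vbasis {:M}], matrices acting on columns; the
    transfer function does not depend on the choice of the basis. *)
Definition fmA_mx (R : realType) (d : nat) (M : vectType R[i])
    (U : fm_colligation d M) (j : 'I_d) : 'M[R[i]]_(\dim {:M}) :=
  \matrix_(k, l) coord (vbasis {:M}) k (fmA U j (vbasis {:M})`_l).

Definition fmB_mx (R : realType) (d : nat) (M : vectType R[i])
    (U : fm_colligation d M) (j : 'I_d) : 'cV[R[i]]_(\dim {:M}) :=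
  \col_k coord (vbasis {:M}) k (fmB U j).

Definition fmC_mx (R : realType) (d : nat) (M : vectType R[i])
    (U : fm_colligation d M) : 'rV[R[i]]_(\dim {:M}) :=
  \row_l fmC U (vbasis {:M})`_l.

Definition fm_pencil (R : realType) (d : nat) (M : vectType R[i])
    (U : fm_colligation d M) (n : nat) (Z : mxtuple R d n) :
    'M[R[i]]_(n * \dim {:M}) :=
  1%:M - \sum_j (Z j *t fmA_mx U j).

Definition fm_dom (R : realType) (d : nat) (M : vectType R[i])
    (U : fm_colligation d M) (n : nat) (Z : mxtuple R d n) : Prop :=
  (0 < n)%N /\ fm_pencil U Z \in unitmx.

Definition fm_transfer (R : realType) (d : nat) (M : vectType R[i])
    (U : fm_colligation d M) (n : nat) (Z : mxtuple R d n) : 'M[R[i]]_n :=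
  (fmD U)%:M +
  castmx (muln1 n, muln1 n)
    (((1%:M : 'M[R[i]]_n) *t fmC_mx U) *m invmx (fm_pencil U Z)
       *m (\sum_j (Z j *t fmB_mx U j))).

Definition fm_equiv (R : realType) (d : nat) (M M' : vectType R[i])
    (U : fm_colligation d M) (U' : fm_colligation d M') : Prop :=
  forall (n : nat) (Z : mxtuple R d n),
    fm_dom U Z -> fm_dom U' Z -> fm_transfer U Z = fm_transfer U' Z.

Definition fm_minimal (R : realType) (d : nat) (M : vectType R[i])
    (U : fm_colligation d M) : Prop :=
  forall (M' : vectType R[i]) (U' : fm_colligation d M'),
    fm_equiv U U' -> (\dim {:M} <= \dim {:M'})%N.

(** Equality as NC rational functions, i.e. on the intersection of the domains
    (which contains [0] at every level whenever [0] is in the domain of [b]). *)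
Definition fm_realizes (R : realType) (d : nat) (M : vectType R[i])
    (U : fm_colligation d M) (b : nc_ratfun R d) : Prop :=
  forall (n : nat) (Z : mxtuple R d n),
    nc_dom b Z -> fm_dom U Z -> nc_eval b Z = fm_transfer U Z.

Definition row_contraction (R : realType) (d N : nat) (T : mxtuple R d N) : Prop :=
  loewner_le (\sum_j T j *m (T j)^t*) 1%:M.

Definition row_coisometry (R : realType) (d N : nat) (T : mxtuple R d N) : Prop :=
  \sum_j T j *m (T j)^t* = 1%:M.

Definition mxadj_word (R : realType) (d N : nat) (T : mxtuple R d N) (w : word d)
    (x : 'cV[R[i]]_N) : 'cV[R[i]]_N :=
  word_act (fun j v => (T j)^t* *m v) w x.

Definition cyclic_adj (R : realType) (d N : nat) (T : mxtuple R d N)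
    (x : 'cV[R[i]]_N) : Prop :=
  linspan [set mxadj_word T w x | w in [set: word d]] = setT.

Record hilbert (R : realType) := Hilbert {
  hilbert_sort :> completeNormedModType R[i];
  hdot : hilbert_sort -> hilbert_sort -> R[i];
  hdot_linear : forall x a y z, hdot x (a *: y + z) = a * hdot x y + hdot x z;
  hdot_conj : forall x y, hdot y x = (hdot x y)^*;
  hdot_norm : forall x, hdot x x = `|x| ^+ 2 }.

Definition closed_span (R : realType) (K : hilbert R) (S : set K) : set K :=
  closure (linspan S).

Definition is_adjoint (R : realType) (K : hilbert R) (S S' : K -> K) : Prop :=
  forall u v : K, hdot (S' u) v = hdot u (S v).

(** [V_j^* V_k = delta_jk I] *)
Definition row_isometry (R : realType) (d : nat) (K : hilbert R)
    (V : 'I_d -> {linear K -> K}) : Prop :=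
  forall (j k : 'I_d) (u v : K), hdot (V j u) (V k v) = (j == k)%:R * hdot u v.

Definition op_word (R : realType) (d : nat) (K : hilbert R)
    (V : 'I_d -> {linear K -> K}) (w : word d) : K -> K :=
  word_act (fun j v => V j v) w.

(** [C^N] is viewed inside [K] through the isometry [iota]. The equality
    [V_j^* (iota h) = iota (T_j^* h)] includes the co-invariance of [C^N]. *)
Definition min_row_isometric_dilation (R : realType) (d N : nat)
    (T : mxtuple R d N) (K : hilbert R) (iota : {linear 'cV[R[i]]_N -> K})
    (V : 'I_d -> {linear K -> K}) : Prop :=
  [/\ row_isometry V,
      forall h h' : 'cV[R[i]]_N, hdot (iota h) (iota h') = cdot h h',
      forall j : 'I_d, exists2 Vs : K -> K, is_adjoint (V j) Vs &
        forall h : 'cV[R[i]]_N, Vs (iota h) = iota ((T j)^t* *m h) &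
      closed_span [set y | exists w h, y = op_word V w (iota h)] = setT].

(** By uniqueness of the minimal row isometric dilation up to unitary
    equivalence, it does not matter which one is used. *)
Definition cyclic_min_dilation (R : realType) (d N : nat) (T : mxtuple R d N)
    (x : 'cV[R[i]]_N) : Prop :=
  exists (K : hilbert R) (iota : {linear 'cV[R[i]]_N -> K})
         (V : 'I_d -> {linear K -> K}),
    min_row_isometric_dilation T iota V /\
    closed_span [set op_word V w (iota x) | w in [set: word d]] = setT.

Definition H0 (R : realType) (d N : nat) (T : mxtuple R d N)
    (x : 'cV[R[i]]_N) : {vspace 'cV[R[i]]_N} :=
  vspan [set mxadj_word T w x | w in [set w : word d | w <> [::]]].

(** When [x] is cyclic for [T^*], [T_j^*] maps [C^N] into [H0], and [vsproj]
    merely changes the codomain. *)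
Definition colligation_of (R : realType) (d N : nat) (T : mxtuple R d N)
    (x : 'cV[R[i]]_N) (b0 : R[i]) : fm_colligation d (subvs_of (H0 T x)) :=
  FMColligation
    (fun j => linfun (fun v : subvs_of (H0 T x) =>
       vsproj (H0 T x)
         ((T j)^t* *m (vsval v - (1 - b0) *: (cdot x (vsval v) *: x)))))
    (fun j => vsproj (H0 T x) ((1 - b0) *: ((T j)^t* *m x)))
    (linfun (fun v : subvs_of (H0 T x) =>
       (1 - b0) * cdot (orth_proj (H0 T x) x) (vsval v) : (R[i])^o))
    b0.

(** [b(0)] in terms of [x] and [t]; this is never [1]. *)
Definition clark_value (R : realType) (N : nat) (x : 'cV[R[i]]_N) (t : R) : R[i] :=
  ((cnorm x ^+ 2 +i* t) - 1) / ((cnorm x ^+ 2 +i* t) + 1).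

Definition clark_realization (R : realType) (d : nat) (b : nc_ratfun R d)
    (N : nat) (T : mxtuple R d N) (x : 'cV[R[i]]_N) (t : R) : Prop :=
  [/\ row_contraction T,
      cyclic_adj T x,
      cyclic_min_dilation T x,
      nc_at0 b = clark_value x t &
      fm_minimal (colligation_of T x (nc_at0 b)) /\
      fm_realizes (colligation_of T x (nc_at0 b)) b].

(* Main.v *)
(** A rational function regular at [0] has a finite-dimensional state space
    realization, and by Cayley-Hamilton the transfer function of a system depends
    only on its moments [C A^w B_j].

    On the full space [C^N], the colligation [U_{T,x}] is a unitary followed by the
    row contraction [T^*]. Hence it is contractive, its pencil is invertible with
    positive real part on the row ball, and its values there are contractions.
    Gaussian elimination without pivoting, which positivity of the real part
    permits, turns it into a representative of [b] defined on the whole row ball.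

    Conversely, evaluating a contractive [b] at truncated shifts shows that the
    Toeplitz kernel on words with symbol [Re (1 + b)/(1 - b)] is positive
    semidefinite. Its GNS space carries a row isometry [V] with cyclic vector [x].
    The numbers [<V^u x, V*^w x>] form a Hankel matrix factoring through the state
    space of [(1 - b)^-1], so the vectors [V*^w x] span a finite-dimensional
    space, to which [V^*] restricts as [T^*]. Then [(T^*, x)] has the moments of
    [(1 - b)^-1], and [U_{T,x}] has those of [b]; controllability comes from the
    choice of [H_0], observability from cyclicity of [x] for [V].

    For an input [u] in [H^2], the energy of [u] exceeds that of [b u] by the
    contributions of the defect [I - sum_j T_j T_j^*] along the trajectory plus the
    limit of the energy of the state, which is [0] since [x] is cyclic for [V]. The
    input [1] is enough to see that the defect vanishes when [b] is inner. *)
Require Import Defs.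
From HB Require Import structures.
From mathcomp Require Import all_boot all_order all_algebra.
From mathcomp Require Import all_classical all_reals all_analysis.
From mathcomp Require Import complex mxtens.
From mathcomp Require Import ring lra zify.
Set Implicit Arguments.
Unset Strict Implicit.
Unset Printing Implicit Defensive.
Import Order.TTheory GRing.Theory Num.Theory.
Import numFieldNormedType.Exports.
Local Open Scope classical_set_scope.
Local Open Scope ring_scope.
Local Open Scope complex_scope.
Local Open Scope sesquilinear_scope.

(** * Rational functions along lines *)

(** Two expressions are compared only where both are defined, and at a given matrix size neither
    need share a point with the representative that defines the class. Identities are therefore
    moved to an amplified level or to a ray through [0], where all data are rational in one variable
    and agreement at generic points suffices. The shape of [b(0)] is dictated by [G = (1 - b)^-1].
    Since [(1 + b) / (1 - b) = 2 G - 1], the kernel at the empty word is [2 Re G(0) - 1], which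
    becomes [|x|^2], while the imaginary part of [2 G(0) - 1] is left free and becomes [t]. Solving
    for [b(0)] gives the fraction of the statement, which is never [1]. Hence the constant [1],
    although it lies in the ball, has to be excluded. Any other [b] in the ball has [b(0) != 1]: an
    entry [1] in the first column of a lower triangular Toeplitz contraction leaves no room for
    further coefficients. *)

Section RationalLines.
Variables (R : realType).
Local Notation C := R[i].

Lemma poly_eq0_horner (p : {poly C}) : (forall t, p.[t] = 0) -> p = 0.
Proof.
move=> p0; apply/eqP/negPn/negP => pN0.
have := @max_poly_roots _ p [seq k%:R | k <- iota 0 (size p)] pN0.
rewrite size_map size_iota ltnn => H; suff : false by []; apply: H.
- by apply/allP => x _; apply/rootP.
- by rewrite map_inj_uniq ?iota_uniq // => m k /eqP; rewrite eqr_nat => /eqP.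
Qed.

Lemma poly_eq0_generic (p q : {poly C}) : q != 0 ->
  (forall t, q.[t] != 0 -> p.[t] = 0) -> p = 0.
Proof.
move=> q0 pq; have /eqP : p * q = 0.
  apply: poly_eq0_horner => t; rewrite hornerM.
  by have [->|/pq ->] := eqVneq q.[t] 0; rewrite ?mulr0 ?mul0r.
by rewrite mulf_eq0 (negPf q0) orbF => /eqP.
Qed.

Definition evmx n m (t : C) (M : 'M[{poly C}]_(n, m)) : 'M[C]_(n, m) :=
  map_mx (horner_eval t) M.

(** The domain is recorded exactly, as the set where [p] does not vanish. The case [p = 0] stands
    for a function defined nowhere on the line. *)
Definition ratline n (f : C -> option 'M[C]_n) : Prop :=
  exists (p : {poly C}) (N : 'M[{poly C}]_n), forall t,
    f t = if p.[t] != 0 then Some ((p.[t])^-1 *: evmx t N) else None.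

Lemma ratline_def n (f : C -> option 'M[C]_n) t0 W : ratline f ->
  f t0 = Some W ->
  exists2 q : {poly C}, q != 0 & forall t, q.[t] != 0 -> exists W, f t = Some W.
Proof.
move=> [p [N fE]] ft0; exists p => [|t pt].
  by apply/eqP => p0; move: ft0; rewrite fE p0 horner0 eqxx.
by rewrite fE pt; eexists.
Qed.

(** Off the zeros of [q * p * p'] the values agree, which gives the polynomial identity
    [p' N = p N'] entrywise. That identity then decides every point where both functions are
    defined, the zeros of [q] included. *)
Lemma ratline_agree n (f g : C -> option 'M[C]_n) (q : {poly C}) :
  ratline f -> ratline g -> q != 0 ->
  (forall t W W', q.[t] != 0 -> f t = Some W -> g t = Some W' -> W = W') ->
  forall t W W', f t = Some W -> g t = Some W' -> W = W'.
Proof.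
move=> [p [N fE]] [p' [N' gE]] q0 fg t W W' ftW gtW'.
have pN0 : p != 0 by apply/eqP => p0; move: ftW; rewrite fE p0 horner0 eqxx.
have p'N0 : p' != 0 by apply/eqP => p0; move: gtW'; rewrite gE p0 horner0 eqxx.
have NN' i j : p' * N i j = p * N' i j.
  apply/subr0_eq/(@poly_eq0_generic _ (q * p * p')).
    by rewrite !mulf_neq0.
  move=> u; rewrite !hornerM !mulf_eq0 !negb_or => /andP[/andP[qu pu] p'u].
  have := fg u _ _ qu; rewrite fE gE pu p'u => /(_ _ _ erefl erefl).
  move=> /matrixP/(_ i j); rewrite !mxE /horner_eval => E.
  rewrite hornerD hornerN !hornerM; apply/eqP; rewrite subr_eq0; apply/eqP.
  by rewrite -[in LHS](mulVKf pu (N i j).[u]) E; field.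
move: ftW gtW'; rewrite fE gE; case: ifP => // pt [<-]; case: ifP => // p't [<-].
apply/matrixP => i j; rewrite !mxE /horner_eval.
have := congr1 (fun s => s.[t]) (NN' i j); rewrite !hornerM => E.
apply: (mulfI pt); apply: (mulfI p't).
rewrite mulVKf // E; field; exact: p't.
Qed.

Lemma tens1mx1 n m : (1%:M : 'M[C]_n) *t (1%:M : 'M[C]_m) = 1%:M.
Proof.
apply/matrixP => i j; case: (mxtens_indexP i) => a a'; case: (mxtens_indexP j) => b b'.
rewrite tensmxE !mxE (can_eq (@mxtens_indexK _ _)) xpair_eqE.
by case: (a == b); case: (a' == b'); rewrite ?mul1r ?mul0r ?mulr0.
Qed.

Section Exprs.
Variable d : nat.
Implicit Types (s r : nc_expr R d).

Lemma ratline_expr s n (Z : 'I_d -> 'M[{poly C}]_n) :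
  ratline (fun t => nc_expr_eval s (fun j => evmx t (Z j))).
Proof.
elim: s => [j|c|r1 [p1 [N1 E1]] r2 [p2 [N2 E2]]|r1 [p1 [N1 E1]] r2 [p2 [N2 E2]]|r1 [p1 [N1 E1]]].
- exists 1, (Z j) => t /=; by rewrite hornerC oner_eq0 invr1 scale1r.
- exists 1, (c%:P%:M) => t /=; rewrite hornerC oner_eq0 invr1 scale1r.
  by rewrite /evmx map_scalar_mx /= /horner_eval hornerC.
- exists (p1 * p2), (p2 *: N1 + p1 *: N2) => t /=; rewrite E1 E2 hornerM.
  have [->|p1t] := eqVneq p1.[t] 0; first by rewrite mul0r eqxx.
  have [->|p2t] := eqVneq p2.[t] 0; first by rewrite mulr0 eqxx.
  rewrite mulf_neq0 //=; congr Some; apply/matrixP => i j; rewrite !mxE /horner_eval.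
  by rewrite hornerD !hornerM; field; rewrite p1t p2t.
- exists (p1 * p2), (N1 *m N2) => t /=; rewrite E1 E2 hornerM.
  have [->|p1t] := eqVneq p1.[t] 0; first by rewrite mul0r eqxx.
  have [->|p2t] := eqVneq p2.[t] 0; first by rewrite mulr0 eqxx.
  rewrite mulf_neq0 //=; congr Some; rewrite /evmx map_mxM -scalemxAl -scalemxAr scalerA.
  by rewrite invfM.
(* The inverse of [N1 / p1] is [p1 * adj N1 / det N1]; one more factor [p1] above and below keeps
   the zeros of [p1] outside the domain. *)
- exists (p1 * \det N1), (p1 ^+ 2 *: \adj N1) => t /=; rewrite E1 hornerM.
  have [->|p1t] := eqVneq p1.[t] 0; first by rewrite mul0r eqxx.
  have detE : (\det N1).[t] = \det (evmx t N1) by rewrite /evmx det_map_mx.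
  rewrite mulf_eq0 (negPf p1t) /= detE unitmxE detZ unitfE mulf_eq0.
  rewrite expf_eq0 invr_eq0 (negPf p1t) andbF /=.
  have [->|dt] := eqVneq (\det (evmx t N1)) 0; first by rewrite ?eqxx.
  have uN : evmx t N1 \in unitmx by rewrite unitmxE unitfE.
  rewrite /=; congr Some.
  have -> : invmx ((p1.[t])^-1 *: evmx t N1) = p1.[t] *: invmx (evmx t N1).
    have uZ : (p1.[t])^-1 *: evmx t N1 \in unitmx.
      by rewrite unitmxZ; [exact: uN|rewrite unitfE invr_eq0].
    by rewrite (invmxZ uZ) invrK.
  rewrite /invmx uN scalerA -detE /evmx.
  have -> : map_mx (horner_eval t) (p1 ^+ 2 *: \adj N1) =
     (p1.[t])^+2 *: \adj (evmx t N1).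
    by rewrite map_mxZ map_mx_adj /= /horner_eval horner_exp.
  rewrite scalerA; congr (_ *: _); field; by rewrite p1t detE dt.
Qed.

Definition segment n (Z0 Z1 : mxtuple R d n) (t : C) : mxtuple R d n :=
  fun j => Z0 j + t *: (Z1 j - Z0 j).

Lemma segment0 n (Z0 Z1 : mxtuple R d n) : segment Z0 Z1 0 = Z0.
Proof. by apply/funext => j; rewrite /segment scale0r addr0. Qed.

Lemma segment1 n (Z0 Z1 : mxtuple R d n) : segment Z0 Z1 1 = Z1.
Proof. by apply/funext => j; rewrite /segment scale1r addrC subrK. Qed.

Lemma ratline_segment s n (Z0 Z1 : mxtuple R d n) :
  ratline (fun t => nc_expr_eval s (segment Z0 Z1 t)).
Proof.
have [p [N E]] := ratline_expr s
  (fun j => map_mx polyC (Z0 j) + 'X *: map_mx polyC (Z1 j - Z0 j)).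
exists p, N => t; rewrite -E; congr nc_expr_eval; apply/funext => j.
by apply/matrixP => k l; rewrite !mxE /horner_eval !(hornerE, mulrC t).
Qed.

Lemma nc_expr_eval_tensl s n m (Z : mxtuple R d n) W :
  nc_expr_eval s Z = Some W ->
  nc_expr_eval s (fun j => (1%:M : 'M[C]_m) *t Z j) = Some (1%:M *t W).
Proof.
elim: s W => [j|c|r1 IH1 r2 IH2|r1 IH1 r2 IH2|r1 IH1] W /=.
- by case=> <-.
- case=> <-; congr Some; apply/matrixP => i j.
  case: (mxtens_indexP i) => a a'; case: (mxtens_indexP j) => b b'.
  rewrite tensmxE !mxE (can_eq (@mxtens_indexK _ _)) xpair_eqE /=.
  by rewrite mulr_natl mulrb; case: eqP; case: eqP.
- case: (nc_expr_eval r1 Z) IH1 => // W1 /(_ _ erefl) ->.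
  case: (nc_expr_eval r2 Z) IH2 => // W2 /(_ _ erefl) -> [<-].
  congr Some; apply/matrixP => i j; by rewrite !mxE mulrDr.
- case: (nc_expr_eval r1 Z) IH1 => // W1 /(_ _ erefl) ->.
  case: (nc_expr_eval r2 Z) IH2 => // W2 /(_ _ erefl) -> [<-].
  by rewrite tensmx_mul mul1mx.
- case: (nc_expr_eval r1 Z) IH1 => // W1 /(_ _ erefl) ->.
  case: ifP => // u1 [<-].
  have E : (1%:M *t W1) *m (1%:M *t invmx W1) = 1%:M :> 'M[C]_(m * n).
    by rewrite tensmx_mul mul1mx mulmxV // tens1mx1.
  have [u _] := mulmx1_unit E; rewrite u; congr Some.
  by rewrite -[LHS]mulmx1 -E mulKmx.
Qed.

Lemma nc_expr_eval_tensr s n m (Z : mxtuple R d n) W :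
  nc_expr_eval s Z = Some W ->
  nc_expr_eval s (fun j => Z j *t (1%:M : 'M[C]_m)) = Some (W *t 1%:M).
Proof.
elim: s W => [j|c|r1 IH1 r2 IH2|r1 IH1 r2 IH2|r1 IH1] W /=.
- by case=> <-.
- case=> <-; congr Some; apply/matrixP => i j.
  case: (mxtens_indexP i) => a a'; case: (mxtens_indexP j) => b b'.
  rewrite tensmxE !mxE (can_eq (@mxtens_indexK _ _)) xpair_eqE /=.
  by rewrite mulr_natr mulrb; case: eqP; case: eqP.
- case: (nc_expr_eval r1 Z) IH1 => // W1 /(_ _ erefl) ->.
  case: (nc_expr_eval r2 Z) IH2 => // W2 /(_ _ erefl) -> [<-].
  congr Some; apply/matrixP => i j; by rewrite !mxE mulrDl.
- case: (nc_expr_eval r1 Z) IH1 => // W1 /(_ _ erefl) ->.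
  case: (nc_expr_eval r2 Z) IH2 => // W2 /(_ _ erefl) -> [<-].
  by rewrite tensmx_mul mul1mx.
- case: (nc_expr_eval r1 Z) IH1 => // W1 /(_ _ erefl) ->.
  case: ifP => // u1 [<-].
  have E : (W1 *t 1%:M) *m (invmx W1 *t 1%:M) = 1%:M :> 'M[C]_(n * m).
    by rewrite tensmx_mul mul1mx mulmxV // tens1mx1.
  have [u _] := mulmx1_unit E; rewrite u; congr Some.
  by rewrite -[LHS]mulmx1 -E mulKmx.
Qed.

Lemma tens1mx_inj n m (W W' : 'M[C]_n) : (0 < m)%N ->
  (1%:M : 'M[C]_m) *t W = 1%:M *t W' -> W = W'.
Proof.
case: m => // m _ /matrixP E; apply/matrixP => i j.
have := E (mxtens_index (ord0, i)) (mxtens_index (ord0, j)).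
by rewrite !tensmxE !mxE /= !mul1r.
Qed.

(** Transitivity is not immediate: the middle expression [r] may be undefined at [Z], even on the
    whole level [n]. Amplification puts a point where [r] is defined and a copy of [Z] on the common
    level [n0 * n]. On the line joining them [r] is defined up to finitely many points, and there it
    compares [s1] with [s2]. *)
Lemma nc_reps_equiv (b : nc_ratfun R d) s1 s2 :
  nc_reps b s1 -> nc_reps b s2 -> nc_expr_equiv s1 s2.
Proof.
have [r [n0 [Z0 [n0_gt0 rZ0]]] ->] := nc_repsP b.
move=> [_ r1] [_ r2] n Z W W' n_gt0 W1 W2.
case E0: (nc_expr_eval r Z0) rZ0 => [W0|] // _.
apply: (@tens1mx_inj n n0) => //.
pose Y0 : mxtuple R d (n0 * n) := fun j => Z0 j *t 1%:M.
pose Y1 : mxtuple R d (n0 * n) := fun j => 1%:M *t Z j.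
have rY0 := nc_expr_eval_tensr n E0.
have s1Y := nc_expr_eval_tensl n0 W1.
have s2Y := nc_expr_eval_tensl n0 W2.
have rl : nc_expr_eval r (segment Y0 Y1 0) = Some (W0 *t 1%:M) by rewrite segment0.
have [q q0 qP] := ratline_def (ratline_segment r Y0 Y1) rl.
apply: (ratline_agree (ratline_segment s1 Y0 Y1) (ratline_segment s2 Y0 Y1) q0
   _ (t := 1)); rewrite ?segment1 //.
move=> t V V' qt s1V s2V'; have [V0 rV0] := qP _ qt.
have nn : (0 < n0 * n)%N by rewrite muln_gt0 n0_gt0.
by rewrite -(r1 _ _ _ _ nn rV0 s1V) (r2 _ _ _ _ nn rV0 s2V').
Qed.

Lemma nc_val_eval (b : nc_ratfun R d) n (Z : mxtuple R d n) W : (0 < n)%N ->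
  nc_val b Z W -> nc_eval b Z = W.
Proof.
move=> n0 bW; rewrite /nc_eval; apply: xget_unique => // W' [s' s'b s'W'].
case: bW => s sb sW; exact: (nc_reps_equiv s'b sb n0 s'W' sW).
Qed.

(** The same amplified segment, now with [s] as the middle term between the defining representative
    and [e]. *)
Lemma nc_reps_of_equiv (b : nc_ratfun R d) s e : nc_reps b s ->
  nc_expr_valid e -> nc_expr_equiv s e -> nc_reps b e.
Proof.
have [r vr ->] := nc_repsP b.
move=> [[n0 [Z0 [n0_gt0 sZ0]]] rs] ve se; split=> //.
move=> n Z W W' n_gt0 rW eW'.
case E0: (nc_expr_eval s Z0) sZ0 => [W0|] // _.
apply: (@tens1mx_inj n n0) => //.
pose Y0 : mxtuple R d (n0 * n) := fun j => Z0 j *t 1%:M.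
pose Y1 : mxtuple R d (n0 * n) := fun j => 1%:M *t Z j.
have sY0 := nc_expr_eval_tensr n E0.
have rY := nc_expr_eval_tensl n0 rW.
have eY := nc_expr_eval_tensl n0 eW'.
have sl : nc_expr_eval s (segment Y0 Y1 0) = Some (W0 *t 1%:M) by rewrite segment0.
have [q q0 qP] := ratline_def (ratline_segment s Y0 Y1) sl.
apply: (ratline_agree (ratline_segment r Y0 Y1) (ratline_segment e Y0 Y1) q0
   _ (t := 1)); rewrite ?segment1 //.
move=> t V V' qt rV eV'; have [V0 sV0] := qP _ qt.
have nn : (0 < n0 * n)%N by rewrite muln_gt0 n0_gt0.
by rewrite (rs _ _ _ _ nn rV sV0) (se _ _ _ _ nn sV0 eV').
Qed.

Lemma nc_expr_eval_dsum s n m (Z : mxtuple R d n) (Y : mxtuple R d m) W V :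
  nc_expr_eval s Z = Some W -> nc_expr_eval s Y = Some V ->
  nc_expr_eval s (dsum_tuple Z Y) = Some (block_mx W 0 0 V).
Proof.
elim: s W V => [j|c|r1 IH1 r2 IH2|r1 IH1 r2 IH2|r1 IH1] W V /=.
- by move=> [<-] [<-].
- by move=> [<-] [<-]; rewrite scalar_mx_block.
- case: (nc_expr_eval r1 Z) IH1 => // W1 IH1.
  case: (nc_expr_eval r2 Z) IH2 => // W2 IH2 [<-].
  case: (nc_expr_eval r1 Y) IH1 => // V1 /(_ _ _ erefl erefl) ->.
  case: (nc_expr_eval r2 Y) IH2 => // V2 /(_ _ _ erefl erefl) -> [<-].
  by rewrite add_block_mx !addr0.
- case: (nc_expr_eval r1 Z) IH1 => // W1 IH1.
  case: (nc_expr_eval r2 Z) IH2 => // W2 IH2 [<-].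
  case: (nc_expr_eval r1 Y) IH1 => // V1 /(_ _ _ erefl erefl) ->.
  case: (nc_expr_eval r2 Y) IH2 => // V2 /(_ _ _ erefl erefl) -> [<-].
  by rewrite mulmx_block !mulmx0 !mul0mx !addr0 !add0r.
- case: (nc_expr_eval r1 Z) IH1 => // W1 IH1; case: ifP => // uW [<-].
  case: (nc_expr_eval r1 Y) IH1 => // V1 /(_ _ _ erefl erefl) ->; case: ifP => // uV [<-].
  have E : block_mx W1 0 0 V1 *m block_mx (invmx W1) 0 0 (invmx V1) = 1%:M.
    by rewrite mulmx_block !mulmx0 !mul0mx !addr0 !add0r !mulmxV // -scalar_mx_block.
  have [u _] := mulmx1_unit E; rewrite u; congr Some.
  by rewrite -[LHS]mulmx1 -E mulKmx.
Qed.

Lemma nc_expr_eval_sim s n (Z : mxtuple R d n) (S : 'M[C]_n) W : S \in unitmx ->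
  nc_expr_eval s Z = Some W ->
  nc_expr_eval s (fun j => invmx S *m Z j *m S) = Some (invmx S *m W *m S).
Proof.
move=> uS; elim: s W => [j|c|r1 IH1 r2 IH2|r1 IH1 r2 IH2|r1 IH1] W /=.
- by case=> <-.
- by case=> <-; rewrite -mulmxA mul_scalar_mx -scalemxAr mulVmx // scalemx1.
- case: (nc_expr_eval r1 Z) IH1 => // W1 /(_ _ erefl) ->.
  case: (nc_expr_eval r2 Z) IH2 => // W2 /(_ _ erefl) -> [<-].
  by rewrite mulmxDr mulmxDl.
- case: (nc_expr_eval r1 Z) IH1 => // W1 /(_ _ erefl) ->.
  case: (nc_expr_eval r2 Z) IH2 => // W2 /(_ _ erefl) -> [<-].
  by rewrite !mulmxA mulmxK.
- case: (nc_expr_eval r1 Z) IH1 => // W1 /(_ _ erefl) ->.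
  case: ifP => // u1 [<-].
  have E : (invmx S *m W1 *m S) *m (invmx S *m invmx W1 *m S) = 1%:M.
    by rewrite !mulmxA mulmxK // mulmxK // mulVmx.
  have [u _] := mulmx1_unit E; rewrite u; congr Some.
  by rewrite -[LHS]mulmx1 -E mulKmx.
Qed.

End Exprs.
End RationalLines.

(** * State space realizations *)

Section Realizations.
Variables (R : realType) (d : nat).
Local Notation C := R[i].

Section Solutions.
Variables (I : finType) (A : 'I_d -> I -> I -> C) (B : 'I_d -> I -> C)
  (c : I -> C) (D : C).

(** One matrix unknown per state coordinate, so that realizations can be combined without tensor
    products. *)
Definition rsol n (Z : mxtuple R d n) (v : I -> 'M[C]_n) : Prop :=
  forall l, v l = \sum_j Z j *m (\sum_m A j l m *: v m + (B j l)%:M).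

Definition rout n (v : I -> 'M[C]_n) : 'M[C]_n := D%:M + \sum_l c l *: v l.

End Solutions.

(** Only the existence of a solution is asked; the pencil may be singular on the domain of [s]. This
    is what an induction on expressions preserves. Uniqueness comes back at points where the pencil
    is invertible. *)
Definition expr_realized (s : nc_expr R d) (I : finType) A B c D : Prop :=
  forall n (Z : mxtuple R d n) W, nc_expr_eval s Z = Some W ->
    exists2 v, @rsol I A B n Z v & W = @rout I c D n v.

(** States are indexed by arbitrary finite types so that sums and products live on disjoint unions,
    as parallel and series connections. An inverse is a feedback, possible because regularity at [0]
    forces [D != 0]. *)
Lemma expr_realization_fin (s : nc_expr R d) :
  nc_expr_eval s (origin R d) <> None ->
  exists (I : finType) (A : 'I_d -> I -> I -> C) (B : 'I_d -> I -> C)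
    (c : I -> C) (D : C), expr_realized s A B c D.
Proof.
have nS (T : Type) (x : T) : Some x <> None by [].
elim: s => [j|a|r1 IH1 r2 IH2|r1 IH1 r2 IH2|r1 IH1] /=.
- move=> _; exists unit, (fun _ _ _ => 0), (fun k _ => (k == j)%:R), (fun _ => 1), 0.
  move=> n Z W [<-]; exists (fun=> Z j).
    move=> l; transitivity (\sum_k Z k *m ((k == j)%:R)%:M : 'M[C]_n).
      rewrite (bigD1 j) //= eqxx mulmx1 big1 ?addr0 // => k /negPf ->.
      by rewrite raddf0 mulmx0.
    apply: eq_bigr => k _; congr (_ *m _).
    by rewrite big1 ?add0r // => m _; rewrite scale0r.
  by rewrite /rout (bigD1 tt) //= big1 ?addr0 ?scale1r => [|[]//]; rewrite raddf0 add0r.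
- move=> _; exists void, (fun _ _ _ => 0), (fun _ _ => 0), (fun _ => 0), a.
  move=> n Z W [<-]; exists (fun=> 0); first by case.
  by rewrite /rout big1 ?addr0 // => -[].
- case E1: (nc_expr_eval r1 _) IH1 => [W1|//] /(_ (@nS _ _)) [I1 [A1 [B1 [c1 [D1 H1]]]]].
  case E2: (nc_expr_eval r2 _) IH2 => [W2|//] /(_ (@nS _ _)) [I2 [A2 [B2 [c2 [D2 H2]]]]] _.
  exists (I1 + I2)%type,
    (fun j x y => match x, y with inl x, inl y => A1 j x y
                  | inr x, inr y => A2 j x y | _, _ => 0 end),
    (fun j x => match x with inl x => B1 j x | inr x => B2 j x end),
    (fun x => match x with inl x => c1 x | inr x => c2 x end), (D1 + D2).
  move=> n Z W /=.
  case F1: (nc_expr_eval r1 Z) => [V1|//]; case F2: (nc_expr_eval r2 Z) => [V2|//] [<-].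
  have [v1 s1 ->] := H1 _ _ _ F1; have [v2 s2 ->] := H2 _ _ _ F2.
  exists (fun x => match x with inl x => v1 x | inr x => v2 x end).
    case=> l; rewrite ?s1 ?s2; apply: eq_bigr => j _; rewrite big_sumType /=;
      congr (_ *m (_ + _)).
      by rewrite [X in _ = _ + X]big1 ?addr0 // => m _; rewrite scale0r.
    by rewrite [X in _ = X + _]big1 ?add0r // => m _; rewrite scale0r.
  by rewrite /rout big_sumType /= raddfD /= addrACA.
- case E1: (nc_expr_eval r1 _) IH1 => [W1|//] /(_ (@nS _ _)) [I1 [A1 [B1 [c1 [D1 H1]]]]].
  case E2: (nc_expr_eval r2 _) IH2 => [W2|//] /(_ (@nS _ _)) [I2 [A2 [B2 [c2 [D2 H2]]]]] _.
  exists (I1 + I2)%type,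
    (fun j x y => match x, y with inl x, inl y => A1 j x y
                  | inr x, inr y => A2 j x y | inl x, inr y => B1 j x * c2 y
                  | _, _ => 0 end),
    (fun j x => match x with inl x => B1 j x * D2 | inr x => B2 j x end),
    (fun x => match x with inl x => c1 x | inr x => D1 * c2 x end), (D1 * D2).
  move=> n Z W /=.
  case F1: (nc_expr_eval r1 Z) => [V1|//]; case F2: (nc_expr_eval r2 Z) => [V2|//] [<-].
  have [v1 s1 ->] := H1 _ _ _ F1; have [v2 s2 ->] := H2 _ _ _ F2.
  set U1 := rout c1 _ _; set U2 := rout c2 _ _.
  (* The first factor is driven by the output [U2] of the second. *)
  exists (fun x => match x with inl x => v1 x *m U2 | inr x => v2 x end).
    case=> l; rewrite ?[in LHS]s1 ?[in LHS]s2 ?mulmx_suml; apply: eq_bigr => j _;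
        rewrite big_sumType /=.
      rewrite -mulmxA; congr (_ *m _); rewrite mulmxDl mulmx_suml -addrA; congr (_ + _).
        by apply: eq_bigr => m _; rewrite scalemxAl.
      rewrite mul_scalar_mx /U2 /rout scalerDr addrC scaler_sumr scale_scalar_mx.
      by congr (_ + _); apply: eq_bigr => m _; rewrite scalerA.
    by congr (_ *m (_ + _)); rewrite [X in _ = X + _]big1 ?add0r // => m _; rewrite scale0r.
  rewrite {1}/rout big_sumType /= {1}/U1 {1}/rout mulmxDl mul_scalar_mx {1}/U2 /rout scalerDr.
  rewrite scale_scalar_mx -addrA; congr (_ + _); rewrite addrC; congr (_ + _).
    by rewrite mulmx_suml; apply: eq_bigr => m _; rewrite scalemxAl.
  by rewrite scaler_sumr; apply: eq_bigr => m _; rewrite scalerA.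
- case E1: (nc_expr_eval r1 _) IH1 => [W1|//] /(_ (@nS _ _)) [I [A [B [c [D H]]]]].
  case: ifP => // uW1 _.
  have D0 : D != 0.
    have [v vs EW] := H _ _ _ E1.
    have v0 l : v l = 0 by rewrite vs big1 // => j _; rewrite mul0mx.
    move: uW1; rewrite EW /rout big1 ?addr0 => [|l _]; last by rewrite v0 scaler0.
    by rewrite unitmxE det_scalar expr1 unitfE.
  exists I, (fun j x y => A j x y - B j x * D^-1 * c y), (fun j x => B j x * D^-1),
    (fun x => - D^-1 * c x), D^-1.
  move=> n Z W /=.
  case F1: (nc_expr_eval r1 Z) => [V1|//]; case: ifP => // uV [<-].
  have [v vs EV] := H _ _ _ F1.
  have DC : D *: invmx V1 + \sum_l c l *: (v l *m invmx V1) = 1%:M.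
    rewrite -(mulmxV uV) {3}EV /rout mulmxDl mul_scalar_mx mulmx_suml.
    by congr (_ + _); apply: eq_bigr => l _; rewrite scalemxAl.
  have iV : invmx V1 = D^-1%:M - D^-1 *: (\sum_l c l *: (v l *m invmx V1)).
    apply: (scalerI D0); rewrite scalerBr scalerA mulfV // scale1r scale_scalar_mx mulfV //.
    by rewrite -DC addrK.
  exists (fun l => v l *m invmx V1).
    move=> l; rewrite {1}vs mulmx_suml; apply: eq_bigr => j _.
    rewrite -mulmxA; congr (_ *m _); rewrite mulmxDl mulmx_suml mul_scalar_mx {2}iV.
    rewrite scalerBr scalerA scale_scalar_mx addrCA addrC; congr (_ + _).
    rewrite scaler_sumr -sumrB; apply: eq_bigr => m _.
    by rewrite -scalemxAl scalerA -scalerBl.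
  rewrite /rout {1}iV; congr (_ + _); rewrite scaler_sumr -sumrN; apply: eq_bigr => l _.
  by rewrite scalerA mulNr scaleNr.
Qed.

Lemma expr_realization (s : nc_expr R d) :
  nc_expr_eval s (origin R d) <> None ->
  exists (k : nat) (A : 'I_d -> 'I_k -> 'I_k -> C) (B : 'I_d -> 'I_k -> C)
    (c : 'I_k -> C) (D : C), expr_realized s A B c D.
Proof.
move=> /expr_realization_fin [I [A [B [c [D H]]]]].
exists #|I|, (fun j x y => A j (enum_val x) (enum_val y)),
  (fun j x => B j (enum_val x)), (fun x => c (enum_val x)), D.
move=> n Z W /H [v vs ->]; exists (fun l => v (enum_val l)).
  move=> l; rewrite {1}vs; apply: eq_bigr => j _; congr (_ *m (_ + _)).
  by rewrite (reindex (@enum_val I I)) //=; apply: onW_bij; apply: enum_val_bij.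
rewrite /rout; congr (_ + _).
by rewrite (reindex (@enum_val I I)) //=; apply: onW_bij; apply: enum_val_bij.
Qed.

End Realizations.

(* By Cayley-Hamilton, [(1 - X)^-1] is a polynomial in [X]; a common polynomial
   serves two matrices, so that their resolvents can be compared via moments. *)
Lemma resolvent_poly (F : fieldType) m m' (X : 'M[F]_m) (X' : 'M[F]_m') :
  1%:M - X \in unitmx -> 1%:M - X' \in unitmx ->
  exists s : {poly F},
    (forall q (G : 'M[F]_(m, q)), invmx (1%:M - X) *m G =
       \sum_(i < size s) s`_i *: iter i (mulmx X) G) /\
    (forall q (G : 'M[F]_(m', q)), invmx (1%:M - X') *m G =
       \sum_(i < size s) s`_i *: iter i (mulmx X') G).
Proof.
move=> u u'; pose p := char_poly X * char_poly X'.
have cE h (Y : 'M[F]_h) : (char_poly Y).[1] = \det (1%:M - Y).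
  rewrite /char_poly -horner_evalE -det_map_mx /=; congr (\det _).
  by apply/matrixP => i j; rewrite !mxE /horner_eval !hornerE hornerMn hornerX.
have p1 : p.[1] != 0.
  by rewrite hornerM !cE mulf_neq0 // -unitfE -unitmxE.
have [s sE] : exists s, p - (p.[1])%:P = s * ('X - 1%:P).
  by apply/factor_theorem; rewrite /root !hornerE subrr.
exists ((p.[1])^-1 *: s).
have key h (Y : 'M[F]_h) : 1%:M - Y \in unitmx ->
    char_poly Y %| p -> forall q (G : 'M[F]_(h, q)), invmx (1%:M - Y) *m G =
    \sum_(i < size ((p.[1])^-1 *: s)) ((p.[1])^-1 *: s)`_i *: iter i (mulmx Y) G.
  case: h Y => [|h] Y uY cp q G; first by rewrite [LHS]flatmx0 [RHS]flatmx0.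
  have pY : horner_mx Y p = 0.
    by case/dvdpP: cp => r ->; rewrite rmorphM /= Cayley_Hamilton mulr0.
  have sY : horner_mx Y s * (1 - Y) = (p.[1])%:M.
    have sE' : p = s * ('X - 1%:P) + (p.[1])%:P by rewrite -sE subrK.
    have := congr1 (horner_mx Y) sE'; rewrite pY rmorphD rmorphM rmorphB /=.
    rewrite !horner_mx_C horner_mx_X => /esym/eqP; rewrite addr_eq0 => /eqP E.
    by rewrite -opprB mulrN E opprK.
  have -> : invmx (1%:M - Y) = horner_mx Y ((p.[1])^-1 *: s).
    apply: (can_inj (mulmxK uY)); rewrite mulVmx // linearZ /= -scalemxAl.
    by rewrite -[horner_mx Y s *m _]/(horner_mx Y s * (1 - Y)) sY scale_scalar_mx mulVf.
  set r := _ *: s; rewrite -{1}[r]coefK poly_def linear_sum mulmx_suml.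
  apply: eq_bigr => i _; rewrite linearZ /= rmorphXn /= horner_mx_X -scalemxAl.
  congr (_ *: _); elim: (nat_of_ord i) => [|e IH]; first by rewrite expr0 mul1mx.
  by rewrite exprS -mulmxA IH.
by split; apply: key => //; [exact: dvdp_mulr | exact: dvdp_mull].
Qed.

(** * Matrix systems: moments, transfer functions and rays through the origin *)

Section Systems.
Variables (R : realType) (d : nat).
Local Notation C := R[i].

Record sys k := Sys {
  sA : mxtuple R d k; sB : 'I_d -> 'cV[C]_k; sC : 'rV[C]_k; sD : C }.

Definition sol k (S : sys k) n (Z : mxtuple R d n) (v : 'I_k -> 'M[C]_n) :=
  rsol (fun j l m => sA S j l m) (fun j l => sB S j l 0) Z v.

Definition out k (S : sys k) n (v : 'I_k -> 'M[C]_n) : 'M[C]_n :=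
  rout (fun l => sC S 0 l) (sD S) v.

Definition pencil_part k (A : mxtuple R d k) n (Z : mxtuple R d n) : 'M[C]_(n * k) :=
  \sum_j Z j *t A j.

Definition pencil k (S : sys k) n (Z : mxtuple R d n) : 'M[C]_(n * k) :=
  1%:M - pencil_part (sA S) Z.

Definition forcing k (S : sys k) n (Z : mxtuple R d n) : 'M[C]_(n * k, n * 1) :=
  \sum_j Z j *t sB S j.

Definition tfm k (S : sys k) n (Z : mxtuple R d n) : 'M[C]_n :=
  (sD S)%:M + castmx (muln1 n, muln1 n)
    (((1%:M : 'M[C]_n) *t sC S) *m invmx (pencil S Z) *m forcing S Z).

(** Stacks the unknowns of [sol] into one block column on which the Kronecker pencil acts; the
    second tensor index of its columns is trivial. *)
Definition vcol k n (v : 'I_k -> 'M[C]_n) : 'M[C]_(n * k, n * 1) :=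
  \matrix_(p, q) v (mxtens_unindex p).2 (mxtens_unindex p).1 (mxtens_unindex q).1.

Lemma sum_mxtens m n (F : 'I_(m * n) -> C) :
  \sum_p F p = \sum_i \sum_j F (mxtens_index (i, j)).
Proof.
rewrite pair_bigA /= (reindex (@mxtens_index m n)) /=.
  by apply: eq_bigr => -[i j] _.
by exists (@mxtens_unindex m n) => x _; rewrite (mxtens_indexK, mxtens_unindexK).
Qed.

Lemma vcolE k n (v : 'I_k -> 'M[C]_n) i l j z :
  vcol v (mxtens_index (i, l)) (mxtens_index (j, z)) = v l i j.
Proof. by rewrite mxE !mxtens_indexK. Qed.

Lemma pencil_part_vcol k (A : mxtuple R d k) n (Z : mxtuple R d n) v :
  pencil_part A Z *m vcol v =
  vcol (fun l => \sum_j Z j *m (\sum_m A j l m *: v m)).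
Proof.
apply/matrixP => p q; case: (mxtens_indexP p) => i l; case: (mxtens_indexP q) => j z.
rewrite vcolE mxE sum_mxtens summxE.
under eq_bigr => a _ do (under eq_bigr => m _ do
  (rewrite vcolE /pencil_part summxE mulr_suml; under eq_bigr => h _ do rewrite tensmxE)).
transitivity (\sum_a \sum_h \sum_m Z h i a * A h l m * v m a j).
  by apply: eq_bigr => a _; rewrite exchange_big.
rewrite exchange_big; apply: eq_bigr => h _ /=; rewrite mxE; apply: eq_bigr => a _.
rewrite summxE mulr_sumr; apply: eq_bigr => m _; by rewrite mxE mulrA.
Qed.

Lemma forcingE k (S : sys k) n (Z : mxtuple R d n) :
  forcing S Z = vcol (fun l => \sum_j Z j *m (sB S j l 0)%:M).
Proof.
apply/matrixP => p q; case: (mxtens_indexP p) => i l; case: (mxtens_indexP q) => j z.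
rewrite vcolE !summxE; apply: eq_bigr => h _.
by rewrite tensmxE (ord1 z) mul_mx_scalar mxE mulrC.
Qed.

Lemma vcolD k n (v w : 'I_k -> 'M[C]_n) :
  vcol v + vcol w = vcol (fun l => v l + w l).
Proof. by apply/matrixP => p q; rewrite !mxE. Qed.

Lemma vcol_inj k n (v w : 'I_k -> 'M[C]_n) : vcol v = vcol w -> v =1 w.
Proof.
move=> /matrixP E l; apply/matrixP => i j.
by have := E (mxtens_index (i, l)) (mxtens_index (j, ord0)); rewrite !vcolE.
Qed.

Lemma eq_vcol k n (v w : 'I_k -> 'M[C]_n) : v =1 w -> vcol v = vcol w.
Proof. by move=> vw; congr vcol; apply/funext. Qed.

Lemma solP k (S : sys k) n (Z : mxtuple R d n) v :
  sol S Z v <-> pencil S Z *m vcol v = forcing S Z.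
Proof.
rewrite /pencil mulmxBl mul1mx pencil_part_vcol forcingE.
have E : (fun l => \sum_j Z j *m (\sum_m sA S j l m *: v m)
     + \sum_j Z j *m (sB S j l 0)%:M) =
   fun l => \sum_j Z j *m (\sum_m sA S j l m *: v m + (sB S j l 0)%:M).
  by apply/funext => l; rewrite -big_split; apply: eq_bigr => j _; rewrite mulmxDr.
split=> [vs|/eqP].
  by apply/eqP; rewrite subr_eq addrC vcolD E; apply/eqP/eq_vcol.
by rewrite subr_eq addrC vcolD E => /eqP/vcol_inj.
Qed.

Lemma outE k (S : sys k) n v : out S v = (sD S)%:M +
  castmx (muln1 n, muln1 n) (((1%:M : 'M[C]_n) *t sC S) *m vcol v).
Proof.
rewrite /out /rout; congr (_ + _); apply/matrixP => i j; rewrite castmxE summxE.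
have cE (a : 'I_n) : cast_ord (esym (muln1 n)) a = mxtens_index (a, ord0).
  by apply: val_inj => /=; rewrite muln1 addn0.
rewrite !cE mxE sum_mxtens (bigD1 i) //= [X in _ + X]big1 => [|a /negPf ai].
  rewrite addr0; apply: eq_bigr => l _.
  by rewrite vcolE tensmxE !mxE eqxx mul1r.
by rewrite big1 // => l _; rewrite tensmxE mxE eq_sym ai !mul0r.
Qed.

Lemma tfm_out k (S : sys k) n (Z : mxtuple R d n) v :
  pencil S Z \in unitmx -> sol S Z v -> tfm S Z = out S v.
Proof.
by move=> u /solP E; rewrite outE /tfm -E mulmxA mulmxKV.
Qed.

Lemma sol_exists k (S : sys k) n (Z : mxtuple R d n) :
  pencil S Z \in unitmx -> exists v, sol S Z v.
Proof.
move=> u; pose M := invmx (pencil S Z) *m forcing S Z.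
exists (fun l => \matrix_(i, j) M (mxtens_index (i, l)) (mxtens_index (j, ord0))).
apply/solP; have <- : M = vcol (fun l => \matrix_(i, j)
    M (mxtens_index (i, l)) (mxtens_index (j, ord0))).
  apply/matrixP => p q; case: (mxtens_indexP p) => i l; case: (mxtens_indexP q) => j z.
  by rewrite [RHS]vcolE [RHS]mxE (ord1 z).
by rewrite /M mulKVmx.
Qed.

Definition moment_eq k k' (S : sys k) (S' : sys k') : Prop :=
  forall w j, sC S *m mxword (sA S) w *m sB S j = sC S' *m mxword (sA S') w *m sB S' j.

Lemma tens_mulmx_sum k n (y : 'rV[C]_k) (Z : mxtuple R d n) m (F : 'I_d -> 'M[C]_(k, m)) :
  (1%:M : 'M[C]_n) *t y *m (\sum_j Z j *t F j) = \sum_j Z j *t (y *m F j).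
Proof. by rewrite mulmx_sumr; apply: eq_bigr => j _; rewrite tensmx_mul mul1mx. Qed.

(** Peeling off one pencil factor moves [Z j *t 1] to the far left and replaces the row [y] by
    [y *m sA S j], so the rows must vary in the induction. *)
Lemma tens_iter_moments k k' (S : sys k) (S' : sys k') n (Z : mxtuple R d n) i
    (y : 'rV[C]_k) (y' : 'rV[C]_k') :
  (forall w j, y *m mxword (sA S) w *m sB S j = y' *m mxword (sA S') w *m sB S' j) ->
  (1%:M : 'M[C]_n) *t y *m iter i (mulmx (pencil_part (sA S) Z)) (forcing S Z) =
  (1%:M : 'M[C]_n) *t y' *m iter i (mulmx (pencil_part (sA S') Z)) (forcing S' Z).
Proof.
elim: i y y' => [|i IH] y y' E.
  rewrite /= /forcing !tens_mulmx_sum; apply: eq_bigr => j _; congr (_ *t _).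
  by have := E [::] j; rewrite /= !mulmx1.
rewrite /= !mulmxA /pencil_part !tens_mulmx_sum.
have sE h (F : 'I_d -> 'rV[C]_h) : \sum_j Z j *t F j =
    \sum_j (Z j *t (1%:M : 'M[C]_1)) *m (1%:M *t F j).
  by apply: eq_bigr => j _; rewrite tensmx_mul mulmx1 mul1mx.
rewrite !sE !mulmx_suml; apply: eq_bigr => j _; rewrite -!mulmxA; congr (_ *m _).
apply: IH => w h; have := E (j :: w) h.
by rewrite /= !mulmxA.
Qed.

Lemma tfm_moments k k' (S : sys k) (S' : sys k') n (Z : mxtuple R d n) :
  moment_eq S S' -> sD S = sD S' -> pencil S Z \in unitmx ->
  pencil S' Z \in unitmx -> tfm S Z = tfm S' Z.
Proof.
move=> mE DE u u'; have [s [sE s'E]] := resolvent_poly u u'.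
rewrite /tfm DE -!mulmxA sE s'E; congr (_ + castmx _ _).
rewrite !mulmx_sumr; apply: eq_bigr => i _; rewrite -!scalemxAr; congr (_ *: _).
exact: tens_iter_moments.
Qed.

(** Cramer's rule: along a ray the entries of the pencil are affine in [t], and its determinant is
    the denominator. *)
Lemma ratline_tfm k (S : sys k) n (Z : mxtuple R d n) :
  ratline (fun t => if pencil S (fun j => t *: Z j) \in unitmx
                    then Some (tfm S (fun j => t *: Z j)) else None).
Proof.
pose X := pencil_part (sA S) Z.
pose P : 'M[{poly C}]_(n * k) := 1%:M - 'X *: map_mx polyC X.
exists (\det P), ((\det P * (sD S)%:P)%:M + castmx (muln1 n, muln1 n)
  (map_mx polyC ((1%:M : 'M[C]_n) *t sC S) *m \adj P *m
     ('X *: map_mx polyC (forcing S Z)))) => t.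
have tX : pencil_part (sA S) (fun j => t *: Z j) = t *: X.
  rewrite /X /pencil_part scaler_sumr; apply: eq_bigr => j _.
  by apply/matrixP => a b; rewrite !mxE mulrA.
have tG : forcing S (fun j => t *: Z j) = t *: forcing S Z.
  rewrite /forcing scaler_sumr; apply: eq_bigr => j _.
  by apply/matrixP => a b; rewrite !mxE mulrA.
have Pt : evmx t P = pencil S (fun j => t *: Z j).
  rewrite /pencil tX; apply/matrixP => a b.
  by rewrite !mxE /horner_eval !hornerE hornerMn !hornerE.
have dt : (\det P).[t] = \det (pencil S (fun j => t *: Z j)).
  by rewrite -Pt /evmx det_map_mx.
rewrite unitmxE unitfE -dt; case: ifP => // d0; congr Some.
have up : pencil S (fun j => t *: Z j) \in unitmx by rewrite unitmxE unitfE -dt.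
have evC a b (M : 'M[C]_(a, b)) : evmx t (map_mx polyC M) = M.
  by apply/matrixP => x y; rewrite !mxE /horner_eval hornerC.
rewrite /evmx map_mxD map_scalar_mx map_castmx !map_mxM map_mxZ map_mx_adj -!/(evmx t _) !evC Pt.
rewrite /= /horner_eval hornerX hornerM hornerC scalerDr scale_scalar_mx mulKf //.
rewrite /tfm tG /invmx up -dt; congr (_ + _).
apply/matrixP => a b; rewrite [RHS]mxE !castmxE.
by rewrite -!scalemxAr -!scalemxAl !mxE; ring.
Qed.

Lemma pencil_generic k (S : sys k) n (Z : mxtuple R d n) :
  exists2 q : {poly C}, q != 0 &
    forall t, q.[t] != 0 -> pencil S (fun j => t *: Z j) \in unitmx.
Proof.
have u0 : pencil S (fun j => 0 *: Z j) \in unitmx.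
  rewrite /pencil /pencil_part big1 ?subr0; last by move=> j _; rewrite scale0r tens0mx.
  exact: unitmx1.
have H0 : (fun t => if pencil S (fun j => t *: Z j) \in unitmx
                    then Some (tfm S (fun j => t *: Z j)) else None) 0 =
          Some (tfm S (fun j => 0 *: Z j)) by rewrite u0.
have [q q0 qP] := ratline_def (ratline_tfm S Z) H0.
exists q; first exact: q0.
by move=> t /qP [W]; case: ifP.
Qed.

Lemma segment_origin n (Z : mxtuple R d n) t :
  segment (fun=> 0) Z t = (fun j => t *: Z j).
Proof. by apply/funext => j; rewrite /segment subr0 add0r. Qed.

Lemma ratline_ray (s : nc_expr R d) n (Z : mxtuple R d n) :
  ratline (fun t => nc_expr_eval s (fun j => t *: Z j)).
Proof.
have := ratline_segment s (fun=> 0) Z.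
by under eq_fun do rewrite segment_origin.
Qed.

Definition realized (b : nc_ratfun R d) k (S : sys k) : Prop :=
  forall n (Z : mxtuple R d n) W, (0 < n)%N -> nc_val b Z W ->
    pencil S Z \in unitmx -> W = tfm S Z.

(** Both sides are rational along the ray through [Z], so agreement at generic [t] extends to
    [t = 1]. Auxiliary systems and expressions then only have to be defined at generic points of the
    ray. *)
Lemma realized_generic (b : nc_ratfun R d) k (S : sys k) :
  (forall n (Z : mxtuple R d n) r W, (0 < n)%N -> nc_reps b r ->
     nc_expr_eval r Z = Some W ->
     exists2 q : {poly C}, q != 0 & forall t W', q.[t] != 0 ->
       nc_expr_eval r (fun j => t *: Z j) = Some W' ->
       pencil S (fun j => t *: Z j) \in unitmx -> W' = tfm S (fun j => t *: Z j)) ->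
  realized b S.
Proof.
move=> H n Z W n0 [r br rW] u; have [q q0 qP] := H _ _ _ _ n0 br rW.
have Z1 : (fun j => 1 *: Z j) = Z by apply/funext => j; rewrite scale1r.
apply: (ratline_agree (ratline_ray r Z) (ratline_tfm S Z) q0 _ (t := 1)).
- by move=> t V V' /qP; move=> H' /H'; case: ifP => // u' /(_ isT) -> [].
- by rewrite Z1.
- by rewrite Z1 u.
Qed.

Lemma realized_moments (b : nc_ratfun R d) k k' (S : sys k) (S' : sys k') :
  realized b S -> moment_eq S S' -> sD S = sD S' -> realized b S'.
Proof.
move=> bS mE DE; apply: realized_generic => n Z r W n0 br rW.
have [q q0 qP] := pencil_generic S Z; exists q => // t W' /qP u rW' u'.
have -> : W' = tfm S (fun j => t *: Z j) by apply: bS => //; exists r.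
exact: tfm_moments.
Qed.

Lemma nc_expr_eval0 (s : nc_expr R d) W n : nc_expr_eval s (origin R d) = Some W ->
  nc_expr_eval s (fun=> 0 : 'M[C]_n) = Some (W 0 0)%:M.
Proof.
elim: s W => [j|c|r1 IH1 r2 IH2|r1 IH1 r2 IH2|r1 IH1] W /=.
- by case=> <-; rewrite mxE raddf0.
- by case=> <-; rewrite mxE.
- case: (nc_expr_eval r1 _) IH1 => // W1 /(_ _ erefl) ->.
  case: (nc_expr_eval r2 _) IH2 => // W2 /(_ _ erefl) -> [<-].
  by rewrite mxE raddfD.
- case: (nc_expr_eval r1 _) IH1 => // W1 /(_ _ erefl) ->.
  case: (nc_expr_eval r2 _) IH2 => // W2 /(_ _ erefl) -> [<-].
  by rewrite !mxE big_ord1 scalar_mxM.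
- case: (nc_expr_eval r1 _) IH1 => // W1 /(_ _ erefl) ->.
  rewrite [W1]mx11_scalar unitmxE det_scalar1 unitfE; case: ifP => // u [<-].
  rewrite unitmxE det_scalar unitfE expf_eq0 mxE eqxx mulr1n (negPf u) andbF /=.
  by rewrite !invmx_scalar mxE eqxx.
Qed.

(** The expression [s] supplies the system, but every representative of [b] has to be matched. Being
    defined at [0], [s] is defined at all but finitely many points of each ray and mediates
    there. *)
Lemma expr_origin_realized (b : nc_ratfun R d) (s : nc_expr R d) W0 :
  nc_reps b s -> nc_expr_eval s (origin R d) = Some W0 ->
  exists k (S : sys k), realized b S /\ sD S = W0 0 0.
Proof.
move=> bs s0; have [|k [A [B [c [D H]]]]] := @expr_realization _ _ s; first by rewrite s0.
pose S := Sys (fun j => \matrix_(l, m) A j l m) (fun j => \col_l B j l) (\row_l c l) D.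
have SA : (fun j l m => sA S j l m) = A.
  by apply/funext => j; apply/funext => l; apply/funext => m; rewrite mxE.
have SB : (fun j l => sB S j l 0) = B.
  by apply/funext => j; apply/funext => l; rewrite mxE.
have SC : (fun l => sC S 0 l) = c by apply/funext => l; rewrite mxE.
exists k, S; split; last first.
  have [v vs ->] := H _ _ _ s0; rewrite mxE mxE eqxx summxE big1 ?addr0 // => l _.
  rewrite vs big1 ?scaler0 ?mxE // => j _; by rewrite mul0mx.
apply: realized_generic => n Z r W n0 br rW.
have s0' : nc_expr_eval s (fun j => 0 *: Z j) = Some (W0 0 0)%:M.
  rewrite -(nc_expr_eval0 n s0); congr nc_expr_eval.
  by apply/funext => j; rewrite scale0r.
have [q q0 qP] := ratline_def (ratline_ray s Z) s0'.
exists q => // t W' /qP [V sV] rW' u.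
have -> : W' = V by apply: (nc_reps_equiv br bs n0 rW' sV).
have [v vs ->] := H _ _ _ sV.
by rewrite (tfm_out u (v := v)) /sol /out ?SA ?SB ?SC.
Qed.

End Systems.

(** * Contractive systems and elimination *)

Section InnerProduct.
Variable R : realType.
Local Notation C := R[i].

Lemma cdotE N (x y : 'cV[C]_N) : cdot x y = \sum_i Num.conj (x i 0) * y i 0.
Proof. by rewrite /cdot mxE; apply: eq_bigr => i _; rewrite !mxE. Qed.

Lemma cdotDr N (x y z : 'cV[C]_N) : cdot x (y + z) = cdot x y + cdot x z.
Proof. by rewrite /cdot mulmxDr mxE. Qed.

Lemma cdotZr N a (x y : 'cV[C]_N) : cdot x (a *: y) = a * cdot x y.
Proof. by rewrite /cdot -scalemxAr mxE. Qed.

Lemma cdot0r N (x : 'cV[C]_N) : cdot x 0 = 0.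
Proof. by rewrite /cdot mulmx0 mxE. Qed.

Lemma cdotNr N (x y : 'cV[C]_N) : cdot x (- y) = - cdot x y.
Proof. by rewrite /cdot mulmxN mxE. Qed.

Lemma cdotBr N (x y z : 'cV[C]_N) : cdot x (y - z) = cdot x y - cdot x z.
Proof. by rewrite cdotDr cdotNr. Qed.

Lemma cdot_sumr N (I : Type) (r : seq I) P (F : I -> 'cV[C]_N) x :
  cdot x (\sum_(i <- r | P i) F i) = \sum_(i <- r | P i) cdot x (F i).
Proof. by rewrite /cdot mulmx_sumr summxE. Qed.

Lemma cdotC N (x y : 'cV[C]_N) : cdot y x = Num.conj (cdot x y).
Proof.
rewrite !cdotE rmorph_sum; apply: eq_bigr => i _.
by rewrite rmorphM /= conjCK mulrC.
Qed.

Lemma cdotDl N (x y z : 'cV[C]_N) : cdot (x + y) z = cdot x z + cdot y z.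
Proof. by rewrite cdotC cdotDr rmorphD /= -!cdotC. Qed.

Lemma cdotZl N a (x y : 'cV[C]_N) : cdot (a *: x) y = Num.conj a * cdot x y.
Proof. by rewrite cdotC cdotZr rmorphM /= -cdotC. Qed.

Lemma cdot0l N (x : 'cV[C]_N) : cdot 0 x = 0.
Proof. by rewrite cdotC cdot0r rmorph0. Qed.

Lemma cdotNl N (x y : 'cV[C]_N) : cdot (- x) y = - cdot x y.
Proof. by rewrite cdotC cdotNr rmorphN /= -cdotC. Qed.

Lemma cdotBl N (x y z : 'cV[C]_N) : cdot (x - y) z = cdot x z - cdot y z.
Proof. by rewrite cdotDl cdotNl. Qed.

Lemma cdot_suml N (I : Type) (r : seq I) P (F : I -> 'cV[C]_N) x :
  cdot (\sum_(i <- r | P i) F i) x = \sum_(i <- r | P i) cdot (F i) x.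
Proof.
rewrite cdotC cdot_sumr rmorph_sum; apply: eq_bigr => i _; exact/esym/cdotC.
Qed.

Lemma cdot_mulr N M (A : 'M[C]_(N, M)) x y : cdot x (A *m y) = cdot (A^t* *m x) y.
Proof. by rewrite /cdot trmx_mul map_mxM trmxCK mulmxA. Qed.

Lemma cdot_mull N M (A : 'M[C]_(M, N)) x y : cdot (A *m x) y = cdot x (A^t* *m y).
Proof. by rewrite cdot_mulr trmxCK. Qed.

Lemma cdot_norm N (x : 'cV[C]_N) : cdot x x = \sum_i `|x i 0| ^+ 2.
Proof. by rewrite cdotE; apply: eq_bigr => i _; rewrite mulrC normCK. Qed.

Lemma cdot_ge0 N (x : 'cV[C]_N) : 0 <= cdot x x.
Proof.
rewrite cdotE; apply: sumr_ge0 => i _; by rewrite mulrC mul_conjC_ge0.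
Qed.

Lemma cdot_eq0 N (x : 'cV[C]_N) : (cdot x x == 0) = (x == 0).
Proof.
apply/idP/eqP => [|->]; last by rewrite cdot0r.
rewrite cdotE psumr_eq0 => [|i _]; last by rewrite mulrC mul_conjC_ge0.
move=> /allP H; apply/matrixP => i j; rewrite (ord1 j) mxE; apply/eqP.
by have := H i (mem_index_enum _); rewrite mulrC -normCK expf_eq0 /= normr_eq0.
Qed.

Lemma cdot_gt0 N (x : 'cV[C]_N) : x != 0 -> 0 < cdot x x.
Proof. by move=> x0; rewrite lt_def cdot_eq0 x0 cdot_ge0. Qed.

Lemma cdot_amgm N (x y : 'cV[C]_N) : cdot x y + cdot y x <= cdot x x + cdot y y.
Proof.
rewrite -subr_ge0; have := cdot_ge0 (x - y).
by rewrite cdotBr !cdotBl; congr (_ <= _); ring.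
Qed.

Lemma unitmx_inj n (M : 'M[C]_n) :
  (forall u : 'cV[C]_n, M *m u = 0 -> u = 0) -> M \in unitmx.
Proof.
move=> H; rewrite -unitmx_tr -row_free_unit -kermx_eq0; apply/eqP/row_matrixP => i.
rewrite row0; apply: trmx_inj; rewrite trmx0; apply: H.
by rewrite -{1}[M]trmxK -trmx_mul -row_mul mulmx_ker row0 trmx0.
Qed.

Section RowContraction.
Variables (d n : nat) (Z : mxtuple R d n).

Lemma cdot_row_adj (y : 'cV[C]_n) :
  \sum_j cdot ((Z j)^t* *m y) ((Z j)^t* *m y) =
  cdot y y - cdot y ((1%:M - \sum_j Z j *m (Z j)^t*) *m y).
Proof.
rewrite mulmxBl mul1mx cdotBr opprB addrC subrK mulmx_suml cdot_sumr.
by apply: eq_bigr => j _; rewrite -mulmxA [RHS]cdot_mulr.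
Qed.

Lemma row_contraction_adj (y : 'cV[C]_n) : row_contraction Z ->
  \sum_j cdot ((Z j)^t* *m y) ((Z j)^t* *m y) <= cdot y y.
Proof. by move=> /(_ y); rewrite cdot_row_adj gerBl. Qed.

Lemma row_ball_adj (y : 'cV[C]_n) : row_ball Z -> y != 0 ->
  \sum_j cdot ((Z j)^t* *m y) ((Z j)^t* *m y) < cdot y y.
Proof. by move=> [_ H] /H; rewrite cdot_row_adj gtrBl. Qed.

Lemma row_ball_contraction : row_ball Z -> row_contraction Z.
Proof.
move=> [_ H] y; have [->|/H/ltW//] := eqVneq y 0.
by rewrite mulmx0 cdot0r.
Qed.

(** For [p = sum_j Z_j q_j], the number [|p|^2] is the inner product of the families [Z_j^* p] and
    [q_j]. The bound [2 Re <a, b> <= |a|^2 + |b|^2] then passes from [Z Z^* <= 1] to [Z^* Z <= 1]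
    without square roots. *)
Lemma row_contraction_le (q : 'I_d -> 'cV[C]_n) : row_contraction Z ->
  cdot (\sum_j Z j *m q j) (\sum_j Z j *m q j) <= \sum_j cdot (q j) (q j).
Proof.
move=> zc; set p := \sum_j _.
have h : cdot p p + cdot p p <= cdot p p + \sum_j cdot (q j) (q j).
  apply: (@le_trans _ _ (\sum_j (cdot ((Z j)^t* *m p) ((Z j)^t* *m p) + cdot (q j) (q j)))).
    have e1 : cdot p p = \sum_j cdot ((Z j)^t* *m p) (q j).
      by rewrite {2}/p cdot_sumr; apply: eq_bigr => j _; rewrite cdot_mulr.
    have e2 : cdot p p = \sum_j cdot (q j) ((Z j)^t* *m p).
      by rewrite {1}/p cdot_suml; apply: eq_bigr => j _; rewrite cdot_mull.
    rewrite {1}e1 e2 -big_split /=; apply: ler_sum => j _; exact: cdot_amgm.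
  by rewrite big_split /= lerD2r; exact: row_contraction_adj.
by rewrite lerD2l in h.
Qed.

End RowContraction.
End InnerProduct.

Section Elimination.
Variables (R : realType) (d : nat).
Local Notation C := R[i].
Local Notation expr := (nc_expr R d).

Definition ncsub (a b : expr) : expr := NCAdd a (NCMul (NCConst d (-1)) b).

(* Expression for [e + c x] where [M x = f], by Gaussian elimination without
   pivoting. *)
Fixpoint ncelim k : ('I_k -> 'I_k -> expr) -> ('I_k -> expr) -> ('I_k -> expr) ->
    expr -> expr :=
  match k with
  | 0 => fun _ _ _ e => e
  | k'.+1 => fun M f c e =>
      let p := NCInv (M ord0 ord0) in let s := @lift k'.+1 ord0 in
      ncelim (fun i l => ncsub (M (s i) (s l)) (NCMul (M (s i) ord0) (NCMul p (M ord0 (s l)))))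
        (fun i => ncsub (f (s i)) (NCMul (M (s i) ord0) (NCMul p (f ord0))))
        (fun l => ncsub (c (s l)) (NCMul (c ord0) (NCMul p (M ord0 (s l)))))
        (NCAdd e (NCMul (c ord0) (NCMul p (f ord0))))
  end.

(** Applied to the enlarged accumulator, it extracts invertibility of the current pivot from
    definedness of the final result. *)
Lemma ncelim_const k M f c e n (Z : mxtuple R d n) W :
  nc_expr_eval (@ncelim k M f c e) Z = Some W ->
  exists E, nc_expr_eval e Z = Some E.
Proof.
elim: k M f c e => [|k IH] M f c e /=; first by move=> ->; exists W.
by move=> /IH [E] /=; case: (nc_expr_eval e Z) => // E' _; exists E'.
Qed.

Lemma ncsub_eval a b n (Z : mxtuple R d n) V W :
  nc_expr_eval a Z = Some V -> nc_expr_eval b Z = Some W ->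
  nc_expr_eval (ncsub a b) Z = Some (V - W).
Proof. by move=> /= -> ->; rewrite mul_scalar_mx scaleN1r. Qed.

(** Proved wherever the eliminated expression is defined, also outside the row ball, since
    equivalence of expressions is tested on all matrix tuples. *)
Lemma ncelim_sol k M f c e n (Z : mxtuple R d n) Mh fh ch eh W (v : 'I_k -> 'M[C]_n) :
  (forall i l, nc_expr_eval (M i l) Z = Some (Mh i l)) ->
  (forall i, nc_expr_eval (f i) Z = Some (fh i)) ->
  (forall l, nc_expr_eval (c l) Z = Some (ch l)) ->
  nc_expr_eval e Z = Some eh ->
  nc_expr_eval (@ncelim k M f c e) Z = Some W ->
  (forall i, \sum_l Mh i l *m v l = fh i) ->
  W = eh + \sum_l ch l *m v l.
Proof.
elim: k M f c e Mh fh ch eh v => [|k IH] M f c e Mh fh ch eh v hM hf hc he /=.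
  by rewrite he big_ord0 addr0 => -[].
move=> hW sys.
have [E] := ncelim_const hW; rewrite /= he hc hM hf; case: ifP => // uP _.
set P := Mh ord0 ord0 in uP.
pose s := @lift k.+1 ord0.
have v0 : v ord0 = invmx P *m (fh ord0 - \sum_l Mh ord0 (s l) *m v (s l)).
  by rewrite -(sys ord0) big_ord_recl addrK mulKmx.
have pe a b V U : nc_expr_eval a Z = Some V -> nc_expr_eval b Z = Some U ->
    nc_expr_eval (NCMul a (NCMul (NCInv (M ord0 ord0)) b)) Z =
      Some (V *m (invmx P *m U)).
  by move=> /= -> ->; rewrite hM uP.
have := IH _ _ _ _ (fun i l => Mh (s i) (s l) - Mh (s i) ord0 *m (invmx P *m Mh ord0 (s l)))
  (fun i => fh (s i) - Mh (s i) ord0 *m (invmx P *m fh ord0))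
  (fun l => ch (s l) - ch ord0 *m (invmx P *m Mh ord0 (s l)))
  (eh + ch ord0 *m (invmx P *m fh ord0)) (fun l => v (s l)) _ _ _ _ hW _.
have sumE (Q : 'M[C]_n) (G : 'I_k -> 'M[C]_n) : \sum_l (G l -
    Q *m (invmx P *m Mh ord0 (s l))) *m v (s l)
   = \sum_l G l *m v (s l) - Q *m (invmx P *m \sum_l Mh ord0 (s l) *m v (s l)).
  rewrite !mulmx_sumr -sumrB; apply: eq_bigr => l _.
  by rewrite mulmxBl !mulmxA.
move=> -> //.
- rewrite sumE big_ord_recl /= v0 !mulmxBr addrA -!addrA; congr (_ + _).
  by congr (_ + _); rewrite addrC.
- by move=> i l; apply: ncsub_eval; [exact: hM|exact: pe].
- by move=> i; apply: ncsub_eval; [exact: hf|exact: pe].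
- by move=> i; apply: ncsub_eval; [exact: hc|exact: pe].
- by rewrite /= he hc hM hf uP.
- move=> i; rewrite sumE -(sys (s i)) big_ord_recl v0 !mulmxBr.
  by rewrite [RHS]addrAC [X in _ = X + _]addrAC subrr add0r addrC.
Qed.

Definition accretive k n (Mh : 'I_k -> 'I_k -> 'M[C]_n) : Prop :=
  forall v : 'I_k -> 'cV[C]_n, (exists l, v l != 0) ->
    0 < \sum_i (cdot (v i) (\sum_l Mh i l *m v l) + cdot (\sum_l Mh i l *m v l) (v i)).

(** A Schur complement of an accretive block matrix is accretive, so every pivot met by the
    elimination is invertible. *)
Lemma ncelim_def k M f c e n (Z : mxtuple R d n) Mh fh ch eh :
  (forall i l, nc_expr_eval (M i l) Z = Some (Mh i l)) ->
  (forall i, nc_expr_eval (f i) Z = Some (fh i)) ->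
  (forall l, nc_expr_eval (c l) Z = Some (ch l)) ->
  nc_expr_eval e Z = Some eh -> accretive Mh ->
  exists W, nc_expr_eval (@ncelim k M f c e) Z = Some W.
Proof.
elim: k M f c e Mh fh ch eh => [|k IH] M f c e Mh fh ch eh hM hf hc he acc /=.
  by exists eh.
set P := Mh ord0 ord0; pose s := @lift k.+1 ord0.
have uP : P \in unitmx.
  apply: unitmx_inj => u Pu; apply/eqP/negPn/negP => u0.
  have := acc (fun i => if i == ord0 then u else 0) _.
  rewrite big_ord_recl /= [X in _ + X]big1 => [|i _]; last by rewrite cdot0l cdot0r addr0.
  have -> : \sum_l Mh ord0 l *m (if l == ord0 then u else 0) = 0.
    by rewrite big_ord_recl /= -/P Pu add0r big1 // => i _; rewrite mulmx0.
  by rewrite cdot0r cdot0l !addr0 ltxx => H; suff : false by []; apply: H; exists ord0.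
have pe a b V U : nc_expr_eval a Z = Some V -> nc_expr_eval b Z = Some U ->
    nc_expr_eval (NCMul a (NCMul (NCInv (M ord0 ord0)) b)) Z =
      Some (V *m (invmx P *m U)).
  by move=> /= -> ->; rewrite hM uP.
apply: (IH _ _ _ _ (fun i l => Mh (s i) (s l) - Mh (s i) ord0 *m (invmx P *m Mh ord0 (s l)))
  (fun i => fh (s i) - Mh (s i) ord0 *m (invmx P *m fh ord0))
  (fun l => ch (s l) - ch ord0 *m (invmx P *m Mh ord0 (s l)))
  (eh + ch ord0 *m (invmx P *m fh ord0))).
- by move=> i l; apply: ncsub_eval; [exact: hM|exact: pe].
- by move=> i; apply: ncsub_eval; [exact: hf|exact: pe].
- by move=> i; apply: ncsub_eval; [exact: hc|exact: pe].
- by rewrite /= he hc hM hf uP.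
move=> v [l0 vl0].
pose T := \sum_l Mh ord0 (s l) *m v l.
(* The leading entry is chosen to annihilate the first block row; the form of [Mh] at [v'] is then
   the form of the Schur complement at [v]. *)
pose v' (i : 'I_k.+1) := if unlift ord0 i is Some l then v l else - (invmx P *m T).
have v's l : v' (s l) = v l by rewrite /v' /s liftK.
have v'0 : v' ord0 = - (invmx P *m T) by rewrite /v' unlift_none.
have := acc v' _; rewrite big_ord_recl.
have -> : \sum_l Mh ord0 l *m v' l = 0.
  rewrite big_ord_recl v'0 mulmxN mulKVmx // addrC; apply/eqP; rewrite subr_eq0.
  by apply/eqP; apply: eq_bigr => l _; rewrite -/(s l) v's.
rewrite cdot0l cdot0r !add0r => H.
suff -> : \sum_i (cdot (v i) (\sum_l (Mh (s i) (s l) -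
    Mh (s i) ord0 *m (invmx P *m Mh ord0 (s l))) *m v l) +
        cdot (\sum_l (Mh (s i) (s l) - Mh (s i) ord0 *m (invmx P *m Mh ord0 (s l))) *m v l) (v i)) =
  \sum_i (cdot (v' (s i)) (\sum_l Mh (s i) l *m v' l) +
      cdot (\sum_l Mh (s i) l *m v' l) (v' (s i))).
  by apply: H; exists (s l0); rewrite v's.
apply: eq_bigr => i _.
suff -> : \sum_l Mh (s i) l *m v' l =
   \sum_l (Mh (s i) (s l) - Mh (s i) ord0 *m (invmx P *m Mh ord0 (s l))) *m v l.
  by rewrite v's.
rewrite big_ord_recl v'0 mulmxN addrC /T !mulmx_sumr -sumrB; apply: eq_bigr => l _.
by rewrite -/(s l) v's mulmxBl !mulmxA.
Qed.

Definition ncsum (F : 'I_d -> expr) : expr :=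
  foldr (fun j e => NCAdd (F j) e) (NCConst d 0) (index_enum 'I_d).

Lemma ncsum_eval F n (Z : mxtuple R d n) W :
  (forall j, nc_expr_eval (F j) Z = Some (W j)) ->
  nc_expr_eval (ncsum F) Z = Some (\sum_j W j).
Proof.
move=> H; rewrite /ncsum; elim: (index_enum _) => [|j s IH] /=.
  by rewrite big_nil raddf0.
by rewrite H IH big_cons.
Qed.

Definition sys_expr k (S : sys R d k) : expr :=
  ncelim (fun i l => NCAdd (NCConst d (i == l)%:R)
            (ncsum (fun j => NCMul (NCVar R j) (NCConst d (- sA S j i l)))))
    (fun i => ncsum (fun j => NCMul (NCVar R j) (NCConst d (sB S j i 0))))
    (fun l => NCConst d (sC S 0 l)) (NCConst d (sD S)).

Definition sys_coef k (S : sys R d k) n (Z : mxtuple R d n) (i l : 'I_k) : 'M[C]_n :=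
  (i == l)%:R%:M + \sum_j Z j *m (- sA S j i l)%:M.

Lemma sys_coef_sum k (S : sys R d k) n (Z : mxtuple R d n) m (v : 'I_k -> 'M[C]_(n, m)) i :
  \sum_l sys_coef S Z i l *m v l = v i - \sum_j Z j *m (\sum_l sA S j i l *: v l).
Proof.
under eq_bigr => l _ do rewrite mulmxDl mul_scalar_mx mulmx_suml.
rewrite big_split /= (bigD1 i) //= eqxx scale1r big1 ?addr0 => [|l /negPf il]; last first.
  by rewrite eq_sym il scale0r.
congr (_ + _); rewrite exchange_big -sumrN; apply: eq_bigr => j _ /=.
rewrite mulmx_sumr -sumrN; apply: eq_bigr => l _.
by rewrite -mulmxA mul_scalar_mx scaleNr mulmxN.
Qed.

Section SysExpr.
Variables (k n : nat) (S : sys R d k) (Z : mxtuple R d n).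

Let evM i l : nc_expr_eval (NCAdd (NCConst d (i == l)%:R)
            (ncsum (fun j => NCMul (NCVar R j) (NCConst d (- sA S j i l))))) Z =
   Some (sys_coef S Z i l).
Proof.
by rewrite /= (@ncsum_eval _ _ Z (fun j => Z j *m (- sA S j i l)%:M)).
Qed.

Let evf i : nc_expr_eval (ncsum (fun j => NCMul (NCVar R j) (NCConst d (sB S j i 0)))) Z =
   Some (\sum_j Z j *m (sB S j i 0)%:M).
Proof. by rewrite (@ncsum_eval _ _ Z (fun j => Z j *m (sB S j i 0)%:M)). Qed.

Lemma sys_expr_out W v : nc_expr_eval (sys_expr S) Z = Some W -> sol S Z v -> W = out S v.
Proof.
move=> hW vs; rewrite (ncelim_sol (v := v) evM evf _ _ hW (ch := fun l =>
    (sC S 0 l)%:M) (eh := (sD S)%:M)) //.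
  by congr (_ + _); apply: eq_bigr => l _; rewrite mul_scalar_mx.
move=> i; rewrite sys_coef_sum {1}vs -sumrB; apply: eq_bigr => j _.
by rewrite -mulmxBr addrC addKr.
Qed.

Lemma sys_expr_def : accretive (sys_coef S Z) ->
  exists W, nc_expr_eval (sys_expr S) Z = Some W.
Proof.
exact: (ncelim_def evM evf (ch := fun l => (sC S 0 l)%:M) (eh := (sD S)%:M)).
Qed.

End SysExpr.
End Elimination.

Section ContractiveSystems.
Variables (R : realType) (d : nat).
Local Notation C := R[i].

Definition sys_contractive k (S : sys R d k) : Prop :=
  forall (x : 'cV[C]_k) (u : C),
    \sum_j cdot (sA S j *m x + u *: sB S j) (sA S j *m x + u *: sB S j)
      + `|(sC S *m x) 0 0 + sD S * u| ^+ 2 <= cdot x x + `|u| ^+ 2.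

Lemma pencil_unit k (S : sys R d k) n (Z : mxtuple R d n) :
  (forall v : 'I_k -> 'cV[C]_n,
     (forall l, v l = \sum_j Z j *m (\sum_m sA S j l m *: v m)) ->
     forall l, v l = 0) ->
  pencil S Z \in unitmx.
Proof.
move=> H; apply: unitmx_inj => u Pu.
pose v l : 'cV[C]_n := \col_i u (mxtens_index (i, l)) 0.
suff v0 l : v l = 0.
  apply/matrixP => p z; case: (mxtens_indexP p) => i l.
  by have /matrixP/(_ i 0) := v0 l; rewrite !mxE (ord1 z).
move: l; apply: H => l; apply/matrixP => i z; rewrite mxE.
move/eqP: Pu; rewrite /pencil mulmxBl mul1mx subr_eq0 => /eqP/matrixP.
move=> /(_ (mxtens_index (i, l)) 0) ->; rewrite mxE sum_mxtens summxE.
under eq_bigr => a _ do (under eq_bigr => m _ do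
  (rewrite /pencil_part summxE mulr_suml; under eq_bigr => h _ do rewrite tensmxE)).
transitivity (\sum_a \sum_h \sum_m Z h i a * sA S h l m * u (mxtens_index (a, m)) 0).
  by apply: eq_bigr => a _; rewrite exchange_big.
rewrite exchange_big; apply: eq_bigr => h _ /=; rewrite mxE; apply: eq_bigr => a _.
rewrite summxE mulr_sumr; apply: eq_bigr => m _; by rewrite !mxE mulrA.
Qed.

Section Contractive.
Variables (k : nat) (S : sys R d k).
Hypothesis Sc : sys_contractive S.

Definition slice n (v : 'I_k -> 'cV[C]_n) (a : 'I_n) : 'cV[C]_k := \col_l v l a 0.

Lemma sum_slice n (v w : 'I_k -> 'cV[C]_n) :
  \sum_l cdot (v l) (w l) = \sum_a cdot (slice v a) (slice w a).
Proof.
transitivity (\sum_l \sum_a Num.conj (v l a 0) * w l a 0).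
  by apply: eq_bigr => l _; rewrite cdotE.
rewrite exchange_big; apply: eq_bigr => a _ /=; rewrite cdotE.
by apply: eq_bigr => l _; rewrite !mxE.
Qed.

(** Contractivity of the colligation is applied to the slice of the data at each coordinate of
    [C^n], and the inequalities are added. *)
Lemma contractive_family n (v : 'I_k -> 'cV[C]_n) (w : 'cV[C]_n) :
  \sum_j \sum_l cdot (\sum_m sA S j l m *: v m + sB S j l 0 *: w)
                     (\sum_m sA S j l m *: v m + sB S j l 0 *: w)
  + cdot (\sum_l sC S 0 l *: v l + sD S *: w) (\sum_l sC S 0 l *: v l + sD S *: w)
  <= \sum_l cdot (v l) (v l) + cdot w w.
Proof.
have -> : \sum_j \sum_l cdot (\sum_m sA S j l m *: v m + sB S j l 0 *: w)
                     (\sum_m sA S j l m *: v m + sB S j l 0 *: w) =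
  \sum_a \sum_j cdot (sA S j *m slice v a + w a 0 *: sB S j) (sA S j *m slice v a +
      w a 0 *: sB S j).
  rewrite [RHS]exchange_big; apply: eq_bigr => j _; rewrite sum_slice; apply: eq_bigr => a _.
  have -> // : slice (fun l => \sum_m sA S j l m *: v m + sB S j l 0 *: w) a =
     sA S j *m slice v a + w a 0 *: sB S j.
  apply/matrixP => l z; rewrite !mxE (ord1 z) summxE mulrC; congr (_ + _).
    by apply: eq_bigr => m _; rewrite !mxE.
rewrite sum_slice; have -> : cdot w w = \sum_a `|w a 0| ^+ 2.
  by rewrite cdotE; apply: eq_bigr => a _; rewrite mulrC normCK.
pose y : 'cV[C]_n := \sum_l sC S 0 l *: v l + sD S *: w; rewrite -/y.
have -> : cdot y y = \sum_a `|(sC S *m slice v a) 0 0 + sD S * w a 0| ^+ 2.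
  rewrite cdotE; apply: eq_bigr => a _; rewrite mulrC -normCK; congr (`|_| ^+ 2).
  rewrite !mxE summxE; congr (_ + _).
  by apply: eq_bigr => m _; rewrite !mxE.
by rewrite -!big_split /=; apply: ler_sum => a _; exact: Sc.
Qed.

(** Twice the real part of the form is [2 |v|^2 - 2 Re sum_j <Z_j^* v, A_j v>]. The cross term is at
    most [|Z^* v|^2 + |A v|^2], where the second summand is at most [|v|^2] by contractivity and the
    first is strictly below [|v|^2] in the row ball. *)
Lemma contractive_accretive n (Z : mxtuple R d n) : row_ball Z ->
  accretive (sys_coef S Z).
Proof.
move=> Zb v [l0 vl0].
pose u j l := \sum_m sA S j l m *: v m.
have uv : \sum_l \sum_j cdot (u j l) (u j l) <= \sum_l cdot (v l) (v l).
  have := contractive_family v 0; rewrite cdot0r addr0.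
  rewrite [\sum_l \sum_j _]exchange_big => /(le_trans _) -> //.
  rewrite -[leLHS]addr0 lerD ?cdot_ge0 //; apply: ler_sum => j _; apply: ler_sum => l _.
  by rewrite scaler0 addr0.
have zv : \sum_l \sum_j cdot ((Z j)^t* *m v l) ((Z j)^t* *m v l) < \sum_l cdot (v l) (v l).
  rewrite (bigD1 l0) //= [ltRHS](bigD1 l0) //=; apply: ltr_leD; first exact: row_ball_adj.
  by apply: ler_sum => l _; apply: row_contraction_adj; exact: row_ball_contraction.
suff -> : \sum_i (cdot (v i) (\sum_l sys_coef S Z i l *m v l) +
    cdot (\sum_l sys_coef S Z i l *m v l) (v i))
  = (\sum_l cdot (v l) (v l) + \sum_l cdot (v l) (v l)) -
    \sum_l \sum_j (cdot ((Z j)^t* *m v l) (u j l) + cdot (u j l) ((Z j)^t* *m v l)).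
  rewrite subr_gt0; apply: le_lt_trans (ltr_leD zv uv).
  rewrite -big_split; apply: ler_sum => l _; rewrite -big_split; apply: ler_sum => j _.
  exact: cdot_amgm.
rewrite -big_split -sumrB; apply: eq_bigr => i _ /=.
rewrite sys_coef_sum cdotBr cdotBl cdot_sumr cdot_suml addrACA -opprD -big_split /=.
congr (_ - _); apply: eq_bigr => j _; by rewrite cdot_mulr cdot_mull.
Qed.

Lemma accretive_pencil n (Z : mxtuple R d n) : accretive (sys_coef S Z) ->
  pencil S Z \in unitmx.
Proof.
move=> acc; apply: pencil_unit => v vE l; apply/eqP/negPn/negP => vl0.
have := acc v (ex_intro _ l vl0); rewrite big1 ?ltxx // => i _.
by rewrite sys_coef_sum -vE subrr cdot0r cdot0l addr0.
Qed.

(** The state is the row [Z] applied to the family [q], so its energy is at most that of [q] and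
    cancels from the energy inequality. *)
Lemma contractive_out n (Z : mxtuple R d n) v (w : 'cV[C]_n) : row_contraction Z ->
  sol S Z v -> cdot (out S v *m w) (out S v *m w) <= cdot w w.
Proof.
move=> Zc vs.
pose q j l := \sum_m sA S j l m *: (v m *m w) + sB S j l 0 *: w.
have pE l : v l *m w = \sum_j Z j *m q j l.
  rewrite {1}vs mulmx_suml; apply: eq_bigr => j _; rewrite -mulmxA /q; congr (_ *m _).
  rewrite mulmxDl mulmx_suml mul_scalar_mx; congr (_ + _).
  by apply: eq_bigr => m _; rewrite scalemxAl.
have := contractive_family (fun l => v l *m w) w.
have -> : \sum_l sC S 0 l *: (v l *m w) + sD S *: w = out S v *m w.
  rewrite /out /rout mulmxDl mul_scalar_mx mulmx_suml addrC; congr (_ + _).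
  by apply: eq_bigr => m _; rewrite scalemxAl.
have pq : \sum_l cdot (v l *m w) (v l *m w) <= \sum_j \sum_l cdot (q j l) (q j l).
  rewrite exchange_big; apply: ler_sum => l _; rewrite pE.
  exact: row_contraction_le.
by move=> /le_trans; move/(_ _ (lerD pq (lexx _))); rewrite lerD2l.
Qed.

End Contractive.

Lemma cdot_cnorm N (x : 'cV[C]_N) : cdot x x = ((cnorm x) ^+ 2)%:C.
Proof.
have := cdot_ge0 x; rewrite /cnorm lecE /= => /andP[/eqP im0 re0].
rewrite sqr_sqrtr // [LHS]complexE im0 /=; by rewrite mulr0 addr0.
Qed.

Lemma cnorm_le1 N (x : 'cV[C]_N) : (cnorm x <= 1) = (cdot x x <= 1).
Proof.
rewrite cdot_cnorm -[1 in RHS](rmorph1 (real_complex R)) lecR.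
by rewrite expr_le1 // /cnorm sqrtr_ge0.
Qed.

Lemma opnorm_le1 n (W : 'M[C]_n) :
  (forall w : 'cV[C]_n, cdot (W *m w) (W *m w) <= cdot w w) -> (opnorm W <= 1%:E)%E.
Proof.
move=> H; apply: ge_ereal_sup => _ [v /= v1 <-]; rewrite lee_fin.
by rewrite cnorm_le1 (le_trans (H v)) // -cnorm_le1.
Qed.

Lemma opnorm_le1_cdot n (W : 'M[C]_n) (w : 'cV[C]_n) : (opnorm W <= 1%:E)%E ->
  cdot (W *m w) (W *m w) <= cdot w w.
Proof.
move=> H; have [->|w0] := eqVneq w 0; first by rewrite mulmx0.
have c0 : 0 < cnorm w.
  rewrite lt_def; apply/andP; split; last exact: sqrtr_ge0.
  by apply: contra w0 => /eqP c0; rewrite -cdot_eq0 cdot_cnorm c0 expr0n.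
pose a : C := ((cnorm w)^-1)%:C.
have aa : Num.conj a = a by exact: conjc_real.
have a2 : a * a * cdot w w = 1.
  rewrite cdot_cnorm /a -!rmorphM /= -invfM -expr2 mulVf ?rmorph1 //.
  by rewrite expf_neq0 // gt_eqF.
have : ((cnorm (W *m (a *: w)))%:E <= opnorm W)%E.
  apply: ereal_sup_ubound; exists (a *: w) => //=.
  by rewrite cnorm_le1 cdotZr cdotZl aa mulrA a2.
move=> /le_trans/(_ H); rewrite lee_fin cnorm_le1 -scalemxAr cdotZr cdotZl aa mulrA.
rewrite -a2 ler_pM2l //; rewrite -expr2 exprn_gt0 // /a ltcR.
by rewrite invr_gt0.
Qed.

(** A single expression [e] computes [b] on the whole row ball; the domain condition and the axioms
    of an NC function are read off from [e]. *)
Lemma ball_of_contractive (b : nc_ratfun R d) k (S : sys R d k) :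
  realized b S -> sys_contractive S -> ratfun_in_hinf_ball b.
Proof.
move=> bS Sc; pose e := sys_expr S.
have ed n (Z : mxtuple R d n) : row_ball Z -> exists W, nc_expr_eval e Z = Some W.
  by move=> Zb; apply: sys_expr_def; exact: contractive_accretive.
have rb0 : row_ball (origin R d).
  split=> // v v0; rewrite big1 ?subr0 ?mul1mx ?cdot_gt0 // => j _; by rewrite mul0mx.
have be : nc_reps b e.
  have [r vr brE] := nc_repsP b.
  have br : nc_reps b r by rewrite brE; split=> // n Z W W' _ -> [].
  apply: (nc_reps_of_equiv br).
    by have [W eW] := ed _ _ rb0; exists 1%N, (origin R d); rewrite eW.
  move=> n Z W W' n0 rW eW'.
  have [q q0 qP] := pencil_generic S Z.
  have Z1 : (fun j => 1 *: Z j) = Z by apply/funext => j; rewrite scale1r.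
  apply: (ratline_agree (ratline_ray r Z) (ratline_ray e Z) q0 _ (t := 1)); rewrite ?Z1 //.
  move=> t V V' /qP u rV eV'; have [v vs] := sol_exists u.
  rewrite (sys_expr_out eV' vs) -(tfm_out u vs); apply: bS => //; by exists r.
have bE n (Z : mxtuple R d n) : row_ball Z -> nc_expr_eval e Z = Some (nc_eval b Z).
  move=> Zb; have [W eW] := ed _ _ Zb; have n0 : (0 < n)%N by case: Zb.
  by rewrite (@nc_val_eval _ _ b _ Z W) //; exists e.
have nle : (hinf_norm (@nc_eval R d b) <= 1%:E)%E.
  apply: ge_ereal_sup => _ [n [Z [Zb ->]]]; apply: opnorm_le1 => w.
  have u := accretive_pencil (contractive_accretive Sc Zb).
  have [v vs] := sol_exists u.
  rewrite (sys_expr_out (bE _ _ Zb) vs).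
  by apply: contractive_out => //; exact: row_ball_contraction.
split=> //; split.
  move=> n Z Zb; split; first by case: Zb.
  by exists (nc_eval b Z), e => //; exact: bE.
split; last by apply: le_lt_trans nle _; rewrite ltry.
split=> [n m Z Y Zb Yb | n Z Q uQ Zb ZQb].
  have n0 : (0 < n)%N by case: Zb.
  apply: nc_val_eval; first by rewrite addn_gt0 n0.
  exists e => //; apply: nc_expr_eval_dsum; exact: bE.
apply: nc_val_eval; first by case: Zb.
by exists e => //; apply: nc_expr_eval_sim => //; exact: bE.
Qed.

Lemma realized_row_ball (b : nc_ratfun R d) k (S : sys R d k) n (Z : mxtuple R d n) :
  realized b S -> sys_contractive S -> row_ball Z ->
  exists2 v, sol S Z v & nc_eval b Z = out S v.
Proof.
move=> bS Sc Zb; have [[bd _] _] := ball_of_contractive bS Sc.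
have u := accretive_pencil (contractive_accretive Sc Zb).
have [v vs] := sol_exists u; exists v => //; rewrite -(tfm_out u vs).
have [n0 [W bW]] := bd _ _ Zb; rewrite (nc_val_eval n0 bW).
exact: (bS _ _ _ n0 bW u).
Qed.

End ContractiveSystems.

(** * Linear spans and orthogonal projections in finite dimension *)

Section LinearSpans.

Lemma linspan_ind (K : fieldType) (V : lmodType K) (S : set V) (P : V -> Prop) :
  P 0 -> (forall a u v, S u -> P v -> P (a *: u + v)) ->
  forall v, linspan S v -> P v.
Proof.
move=> P0 PS v [n [a [u [uS ->]]]].
elim: n a u uS => [|n IH] a u uS; first by rewrite big_ord0.
rewrite big_ord_recl; apply: PS => //.
by apply: (IH (fun k => a (lift ord0 k)) (fun k => u (lift ord0 k))).
Qed.

Lemma linspan0 (K : fieldType) (V : lmodType K) (S : set V) : linspan S 0.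
Proof. by exists 0%N, (fun=> 0), (fun=> 0); split=> [[]//|]; rewrite big_ord0. Qed.

Lemma linspan_cons (K : fieldType) (V : lmodType K) (S : set V) a u v :
  S u -> linspan S v -> linspan S (a *: u + v).
Proof.
move=> Su [n [b [w [wS ->]]]].
exists n.+1, (fun k => if unlift ord0 k is Some l then b l else a),
  (fun k => if unlift ord0 k is Some l then w l else u); split.
  by move=> k; case: (unlift ord0 k).
rewrite big_ord_recl unlift_none; congr (_ + _); apply: eq_bigr => k _.
by rewrite liftK.
Qed.

Lemma linspan_mem (K : fieldType) (V : lmodType K) (S : set V) u :
  S u -> linspan S u.
Proof.
by move=> Su; have := linspan_cons 1 Su (linspan0 S); rewrite scale1r addr0.
Qed.

Lemma linspanD (K : fieldType) (V : lmodType K) (S : set V) u v :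
  linspan S u -> linspan S v -> linspan S (u + v).
Proof.
move=> Su Sv; elim/linspan_ind: {u} Su; first by rewrite add0r.
by move=> a u w uS IH; rewrite -addrA; exact: linspan_cons.
Qed.

Lemma linspanZ (K : fieldType) (V : lmodType K) (S : set V) a v :
  linspan S v -> linspan S (a *: v).
Proof.
move=> Sv; elim/linspan_ind: {v} Sv; first by rewrite scaler0; exact: linspan0.
by move=> b u w uS IH; rewrite scalerDr scalerA; exact: linspan_cons.
Qed.

Lemma linspan_sum (K : fieldType) (V : lmodType K) (S : set V) (I : Type)
    (r : seq I) (F : I -> V) :
  (forall i, linspan S (F i)) -> linspan S (\sum_(i <- r) F i).
Proof.
move=> H; elim: r => [|i r IH]; rewrite ?big_nil ?big_cons; first exact: linspan0.
exact: linspanD.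
Qed.

Lemma linspan_sub (K : fieldType) (V : lmodType K) (S S' : set V) :
  (forall u, S u -> linspan S' u) -> forall v, linspan S v -> linspan S' v.
Proof.
move=> SS'; apply: linspan_ind; first exact: linspan0.
by move=> a u v /SS' uS' vS'; apply: linspanD => //; exact: linspanZ.
Qed.

Lemma linspan_linear (K : fieldType) (V W : lmodType K) (f : {linear V -> W})
    (S : set V) (S' : set W) :
  (forall u, S u -> linspan S' (f u)) -> forall v, linspan S v -> linspan S' (f v).
Proof.
move=> SS'; apply: linspan_ind; first by rewrite linear0; exact: linspan0.
move=> a u v /SS' uS' vS'; rewrite linearP; apply: linspanD => //; exact: linspanZ.
Qed.

(** [vspan] is a choice, so some subspace must be shown to have the right underlying set. One of
    maximal dimension inside the linear span does: a further vector of the span would raise the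
    dimension. *)
Lemma memv_vspan (K : fieldType) (V : vectType K) (S : set V) v :
  v \in vspan S <-> linspan S v.
Proof.
suff [U US] : exists U : {vspace V}, [set` U] = linspan S.
  have -> : (v \in vspan S) = [set` vspan S] v :> Prop by [].
  have ex : exists U', [set U' : {vspace V} | [set` U'] = linspan S] U' by exists U.
  have E : [set` vspan S] = linspan S := xgetPex 0%VS ex.
  by rewrite E.
pose P n := `[< exists2 U : {vspace V}, {subset U <= linspan S} & \dim U = n >].
have P0 : exists n, P n.
  exists 0%N; apply/asboolP; exists 0%VS; last exact: dimv0.
  by move=> u; rewrite memv0 => /eqP ->; apply/mem_set; exact: linspan0.
have Pb n : P n -> (n <= \dim {:V})%N.
  by move=> /asboolP [U _ <-]; apply: dimvS; exact: subvf.
case: (ex_maxnP P0 Pb) => n /asboolP [U US dU] nmax; exists U.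
apply/seteqP; split=> [u uU|u uS]; first by apply/set_mem/US.
have : (\dim (U + <[u]>) <= \dim U)%N.
  rewrite dU; apply: nmax; apply/asboolP; exists (U + <[u]>)%VS => //.
  move=> y /memv_addP [y1 y1U [y2 /vlineP [a ->] ->]]; apply/mem_set.
  by apply: linspanD; [exact/set_mem/US | exact: linspanZ].
move=> dle; have /eqP E : (U == U + <[u]>)%VS by rewrite eqEdim addvSl dle.
change (is_true (u \in U)); rewrite E.
by apply: (subvP (addvSr U <[u]>)); exact: memv_line.
Qed.

Lemma linfun_linear (K : fieldType) (V W : vectType K) (f : V -> W) :
  linear f -> linfun f =1 f.
Proof.
move=> lf v.
pose F : {linear V -> W} := HB.pack f (GRing.isLinear.Build _ _ _ _ f lf).
exact: (lfunE F).
Qed.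

Section Orthogonal.
Variable R : realType.
Local Notation C := R[i].

(** Normal equations: with a basis of [U] as the columns of [M], the Gram matrix of [M] is
    invertible. *)
Lemma orth_proj_spec N (U : {vspace 'cV[C]_N}) x :
  orth_proj U x \in U /\ forall u, u \in U -> cdot u (x - orth_proj U x) = 0.
Proof.
suff [p pP] : exists p, p \in U /\ forall u, u \in U -> cdot u (x - p) = 0.
  by rewrite /orth_proj; case: xgetP => [p' _ //|/(_ p)].
pose m := \dim U; pose M : 'M[C]_(N, m) := \matrix_(i, k) (vbasis U)`_k i 0.
have ME (a : 'cV[C]_m) : M *m a = \sum_k a k 0 *: (vbasis U)`_k.
  apply/matrixP => i z; rewrite mxE summxE (ord1 z); apply: eq_bigr => k _.
  by rewrite !mxE mulrC.
have MU a : M *m a \in U.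
  rewrite ME; apply: memv_suml => k _; apply: memvZ; apply: vbasis_mem.
  by apply: mem_nth; rewrite size_tuple.
have UM u : u \in U -> exists a, u = M *m a.
  move=> uU; exists (\col_k coord (vbasis U) k u); rewrite ME {1}(coord_vbasis uU).
  by apply: eq_bigr => k _; rewrite mxE.
have uG : M^t* *m M \in unitmx.
  apply: unitmx_inj => a Ga; have : cdot (M *m a) (M *m a) == 0.
    by rewrite cdot_mull mulmxA Ga cdot0r.
  rewrite cdot_eq0 ME => /eqP; move/freeP: (basis_free (vbasisP U)) => fr /fr a0.
  by apply/matrixP => k z; rewrite (ord1 z) a0 mxE.
exists (M *m (invmx (M^t* *m M) *m (M^t* *m x))); split=> // u /UM [a ->].
by rewrite cdot_mull mulmxBr !mulmxA mulmxV // mul1mx subrr cdot0r.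
Qed.

Lemma cdot_orth_proj N (U : {vspace 'cV[C]_N}) x v :
  v \in U -> cdot (orth_proj U x) v = cdot x v.
Proof.
have [_ /(_ v)] := orth_proj_spec U x => H /H E.
have := congr1 Num.conj E; rewrite -cdotC rmorph0 cdotBl => /eqP.
by rewrite subr_eq0 => /eqP.
Qed.

Lemma linspan_full N (S : set 'cV[C]_N) :
  (forall v, (forall s, S s -> cdot s v = 0) -> v = 0) -> forall v, linspan S v.
Proof.
move=> H v; apply/memv_vspan; have [pU po] := orth_proj_spec (vspan S) v.
suff /subr0_eq -> : v - orth_proj (vspan S) v = 0 by [].
apply: H => s Ss; apply: po; apply/memv_vspan; exact: linspan_mem.
Qed.

End Orthogonal.
End LinearSpans.

(** * The Clark colligation *)

Section FMSystems.
Variables (R : realType) (d : nat).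
Local Notation C := R[i].

Definition fm_sys (M : vectType C) (U : fm_colligation d M) : sys R d (\dim {:M}) :=
  Sys (fmA_mx U) (fmB_mx U) (fmC_mx U) (fmD U).

Section Coords.
Variables (M : vectType C) (U : fm_colligation d M).

Definition crd (v : M) : 'cV[C]_(\dim {:M}) := \col_k coord (vbasis {:M}) k v.

Lemma crd_sum v : v = \sum_k crd v k 0 *: (vbasis {:M})`_k.
Proof.
rewrite {1}(coord_vbasis (memvf v)); apply: eq_bigr => k _; by rewrite mxE.
Qed.

Lemma fmA_crd j v : fmA_mx U j *m crd v = crd (fmA U j v).
Proof.
apply/matrixP => k z; rewrite [RHS]mxE mxE [in RHS](crd_sum v) !linear_sum.
by apply: eq_bigr => l _; rewrite !linearZ /= !mxE mulrC.
Qed.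

Lemma fmC_crd v : fmC_mx U *m crd v = (fmC U v)%:M.
Proof.
apply/matrixP => k z; rewrite !(ord1 k, ord1 z) mxE [RHS]mxE eqxx mulr1n.
rewrite [in RHS](crd_sum v) linear_sum.
by apply: eq_bigr => l _; rewrite linearZ /= !mxE mulrC.
Qed.

Lemma fm_moment w j : fmC_mx U *m mxword (fmA_mx U) w *m fmB_mx U j =
  (fmC U (word_act (fmA U) w (fmB U j)))%:M.
Proof.
rewrite -mulmxA -fmC_crd; congr (_ *m _).
elim: w => [|i w IH] /=; first by rewrite mul1mx.
by rewrite -mulmxA IH fmA_crd.
Qed.

End Coords.

Lemma fm_realizesP (M : vectType C) (U : fm_colligation d M) b :
  fm_realizes U b <-> realized b (fm_sys U).
Proof.
split=> H n Z.
  move=> W n0 bW u; rewrite -(nc_val_eval n0 bW); apply: H => //.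
  by split=> //; exists W.
move=> [n0 [W bW]] [_ u]; rewrite (nc_val_eval n0 bW); exact: H bW u.
Qed.

End FMSystems.

Section Clark.
Variables (R : realType) (d N : nat) (T : mxtuple R d N) (x : 'cV[R[i]]_N).
Local Notation C := R[i].

Definition clark_sys (b0 : C) : sys R d N :=
  Sys (fun j => (T j)^t* *m (1%:M - (1 - b0) *: (x *m x^t*)))
      (fun j => (1 - b0) *: ((T j)^t* *m x)) ((1 - b0) *: x^t*) b0.

Lemma clark_mulE b0 (v : 'cV[C]_N) :
  (1%:M - (1 - b0) *: (x *m x^t*)) *m v = v - ((1 - b0) * cdot x v) *: x.
Proof.
rewrite mulmxBl mul1mx -scalemxAl -mulmxA; congr (_ - _).
by rewrite -scalerA; congr (_ *: _); rewrite [x^t* *m v]mx11_scalar mul_mx_scalar.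
Qed.

(** With [h = |x|^2 + i t] one has [c = 2 / (h + 1)], and the identity reads
    [1 / c + 1 / conj c = |x|^2 + 1]. It is what makes the rank one update of the colligation
    unitary. *)
Lemma clark_valueP t b0 : b0 = clark_value x t ->
  let c := 1 - b0 in c != 0 /\ c * Num.conj c * (cdot x x + 1) = c + Num.conj c.
Proof.
move=> -> c; rewrite {}/c /clark_value; set h := (_ +i* t).
have hE : h = cdot x x + 'i * t%:C.
  by rewrite cdot_cnorm [h]complexE /=.
have s0 := cdot_ge0 x; set s := cdot x x in s0 hE *.
have sc : Num.conj s = s by apply/CrealP; exact: ger0_real.
have tc : Num.conj (t%:C : C) = t%:C by exact: conjc_real.
have ic : Num.conj ('i : C) = - 'i by apply/eqP; rewrite eq_complex /= oppr0 !eqxx.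
have h1 : h + 1 != 0.
  apply/eqP => /(congr1 (fun z => z + Num.conj z));
      rewrite hE !rmorphD !rmorphM /= sc tc ic rmorph1.
  have -> : s + 'i * t%:C + 1 + (s + - 'i * t%:C + 1) = 2 * s + 2 by ring.
  rewrite rmorph0 addr0 => E; have : 0 < 2 * s + 2 by rewrite ltr_wpDl ?mulr_ge0.
  by rewrite E ltxx.
have h1c : Num.conj h + 1 != 0 by rewrite -[1](rmorph1 Num.conj) -rmorphD fmorph_eq0.
have cE : 1 - (h - 1) / (h + 1) = 2 / (h + 1) by field.
have aux (F : numFieldType) (a a' : F) : a != 0 -> a' != 0 ->
    2 / a * (2 / a') * ((a + a') / 2) = 2 / a + 2 / a'.
  by move=> a0 a'0; field; rewrite a0 a'0.
rewrite cE; split; first by rewrite mulf_neq0 ?invr_eq0 // pnatr_eq0.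
have -> : Num.conj (2 / (h + 1)) = 2 / (Num.conj h + 1).
  by rewrite rmorphM fmorphV !rmorphD !rmorph1.
have -> : s + 1 = ((h + 1) + (Num.conj h + 1)) / 2.
  by rewrite hE !rmorphD !rmorphM /= sc tc ic; field.
by apply: aux.
Qed.

Section Energy.
Variables (t : R) (b0 : C) (b0E : b0 = clark_value x t).

(* [v, u |-> (h, c <x, v> + b0 u)] is unitary on [C^N + C] for
   [h = v + c (u - <x, v>) x]; [T^*] is then applied to [h]. *)
Lemma clark_energy (v : 'cV[C]_N) (u : C) :
  let h := v + ((1 - b0) * (u - cdot x v)) *: x in
  let S := clark_sys b0 in
  \sum_j cdot (sA S j *m v + u *: sB S j) (sA S j *m v + u *: sB S j)
      + `|(sC S *m v) 0 0 + sD S * u| ^+ 2 =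
  cdot v v + `|u| ^+ 2 - cdot h ((1%:M - \sum_j T j *m (T j)^t*) *m h).
Proof.
move=> h S.
have qE j : sA S j *m v + u *: sB S j = (T j)^t* *m h.
  rewrite /= -mulmxA clark_mulE scalerA scalemxAr -mulmxDr; congr (_ *m _).
  by rewrite /h -addrA -scaleNr -scalerDl; congr (_ + _ *: _); ring.
under eq_bigr => j _ do rewrite qE.
rewrite cdot_row_adj -scalemxAl mxE -/(cdot x v) /=.
suff E : cdot h h + `|(1 - b0) * cdot x v + b0 * u| ^+ 2 = cdot v v + `|u| ^+ 2.
  by rewrite -E; ring.
have [_ cE] := clark_valueP b0E; rewrite /= in cE.
clear qE S; rewrite /h; clear h; set c := 1 - b0 in cE *;
    have b0c : b0 = 1 - c by rewrite /c opprB addrCA subrr addr0.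
clearbody c; rewrite b0c !normCK cdotDr !cdotDl !cdotZr !cdotZl.
have -> : cdot v x = Num.conj (cdot x v) by rewrite -cdotC.
set p := cdot x v; rewrite !(rmorphD, rmorphM, rmorphN, rmorph1, rmorphB) /=.
set cc := Num.conj c in cE *; set pc := Num.conj p; set uc := Num.conj u.
have -> : c * (u - p) * (cc * (uc - pc) * cdot x x) =
  (u - p) * (uc - pc) * (c * cc * (cdot x x + 1)) - c * cc * (u - p) * (uc - pc) by ring.
by rewrite cE; ring.
Qed.

Lemma clark_contractive : row_contraction T -> sys_contractive (clark_sys b0).
Proof.
move=> Tc v u; rewrite clark_energy; rewrite lerBlDr lerDl; exact: Tc.
Qed.

End Energy.

Lemma mxadj_word_cons j w : mxadj_word T (j :: w) x = (T j)^t* *m mxadj_word T w x.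
Proof. by []. Qed.

Lemma cyclic_adj_H0 j y : cyclic_adj T x -> (T j)^t* *m y \in H0 T x.
Proof.
move=> cyc; apply/memv_vspan.
have : linspan [set mxadj_word T w x | w in [set: word d]] y by rewrite cyc.
pose f : {linear 'cV[C]_N -> 'cV[C]_N} := mulmx ((T j)^t*).
rewrite -[_ *m y]/(f y); apply: linspan_linear => _ [w _ <-].
by apply: linspan_mem; exists (j :: w).
Qed.

Section Colligation.
Variable b0 : C.
Hypothesis cyc : cyclic_adj T x.
Local Notation U := (colligation_of T x b0).

Lemma colligation_A j v : vsval (fmA U j v) = sA (clark_sys b0) j *m vsval v.
Proof.
rewrite /= linfun_linear; last first.
  move=> a u w; rewrite -linearP; congr (vsproj _ _).
  rewrite linearP /= scalemxAr -mulmxDr; congr (_ *m _).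
  rewrite cdotDr cdotZr scalerBr !scalerA addrACA -opprD -scalerDl.
  by congr (_ - _ *: _); ring.
rewrite vsprojK; last exact: cyclic_adj_H0.
by rewrite -mulmxA clark_mulE scalerA.
Qed.

Lemma colligation_B j : vsval (fmB U j) = sB (clark_sys b0) j.
Proof. by rewrite /= vsprojK // memvZ // cyclic_adj_H0. Qed.

Lemma colligation_C v : fmC U v = (sC (clark_sys b0) *m vsval v) 0 0.
Proof.
rewrite /= linfun_linear; last first.
  by move=> a u w; rewrite linearP /= cdotDr cdotZr /GRing.scale /=; ring.
by rewrite cdot_orth_proj ?subvsP // -scalemxAl mxE.
Qed.

Lemma colligation_word w j : vsval (word_act (fmA U) w (fmB U j)) =
  mxword (sA (clark_sys b0)) w *m sB (clark_sys b0) j.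
Proof.
elim: w => [|i w IH]; first by rewrite [LHS]colligation_B mul1mx.
by rewrite [LHS]colligation_A IH [in RHS]/= mulmxA.
Qed.

(** [H0] contains every [B_j] and is invariant under the [A_j] of the full space, so cutting down to
    it changes no moment. *)
Lemma colligation_moments : moment_eq (fm_sys U) (clark_sys b0).
Proof.
move=> w j; rewrite [LHS]fm_moment colligation_C colligation_word mulmxA.
exact/esym/mx11_scalar.
Qed.

End Colligation.
End Clark.

Section ClarkRealization.
Variables (R : realType) (d : nat) (b : nc_ratfun R d).

Lemma clark_realized N (T : mxtuple R d N) x t : clark_realization b T x t ->
  realized b (clark_sys T x (nc_at0 b)).
Proof.
case=> _ cyc _ _ [_ /fm_realizesP bU].
by apply: realized_moments bU _ _ => //; exact: colligation_moments.
Qed.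

Lemma clark_ball N (T : mxtuple R d N) x t : clark_realization b T x t ->
  ratfun_in_hinf_ball b.
Proof.
move=> ct; apply: (ball_of_contractive (clark_realized ct)).
by case: ct => Tc _ _ b0E _; exact: clark_contractive b0E Tc.
Qed.

End ClarkRealization.

(** * Evaluation at truncated shifts *)

Section TruncatedShift.
Variables (R : realType) (d n : nat).
Local Notation C := R[i].
Local Notation bw := (n.-bseq 'I_d).
Local Notation K := #|{: bw}|.

Definition wd (p : 'I_K) : word d := enum_val p : bw.

(** A word longer than [n] gets a default index, so [wi] is meaningful only under a length bound. *)
Definition wi (w : word d) : 'I_K := enum_rank (insub_bseq n w).

Lemma wdK p : wi (wd p) = p.
Proof.
rewrite /wi /wd -[RHS]enum_valK; congr enum_rank.
by rewrite /insub_bseq valKd.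
Qed.

Lemma wiK w : (size w <= n)%N -> wd (wi w) = w.
Proof. by move=> wn; rewrite /wi /wd enum_rankK /insub_bseq insubdK. Qed.

Lemma wd_inj : injective wd.
Proof. exact: can_inj wdK. Qed.

Lemma size_wd p : (size (wd p) <= n)%N.
Proof. exact: size_bseq. Qed.

Lemma sum_wd (w : word d) (F : 'I_K -> C) :
  \sum_p (wd p == w)%:R * F p = if (size w <= n)%N then F (wi w) else 0.
Proof.
case: ifP => wn.
  rewrite (bigD1 (wi w)) //= wiK // eqxx mul1r big1 ?addr0 // => p /negPf pw.
  case: eqP => [E|_]; last by rewrite mul0r.
  by rewrite -E wdK eqxx in pw.
rewrite big1 // => p _; case: eqP => [E|_]; last by rewrite mul0r.
by rewrite -E size_wd in wn.
Qed.

(* [e_q] goes to [r e_(q j)], which is cut off beyond length [n]; hence the product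
   along [w] sends the vacuum to a multiple of [e_(rev w)]. *)
Definition shift (r : C) (j : 'I_d) : 'M[C]_K :=
  \matrix_(p, q) ((wd p == rcons (wd q) j)%:R * r).

Lemma shift_mul r j m (M : 'M[C]_(K, m)) p q :
  (shift r j *m M) p q =
  if wd p is i :: s then (last i s == j)%:R * (r * M (wi (belast i s)) q) else 0.
Proof.
rewrite mxE; under eq_bigr => a _ do rewrite mxE.
case: (lastP (wd p)) (size_wd p) => [|s i] sn.
  by rewrite big1 // => a _; case: (wd a) => [|? ?]; rewrite !mul0r.
have -> : \sum_a (rcons s i == rcons (wd a) j)%:R * r * M a q =
   (i == j)%:R * \sum_a (wd a == s)%:R * (r * M a q).
  rewrite mulr_sumr; apply: eq_bigr => a _; rewrite eqseq_rcons eq_sym andbC.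
  by case: (i == j); rewrite ?mul1r ?mul0r // mulrA.
rewrite sum_wd ifT; last by rewrite size_rcons in sn; exact: ltnW.
by case: s {sn} => [|h s] //=; rewrite last_rcons belast_rcons.
Qed.

Lemma shift_mul_rcons r j m (M : 'M[C]_(K, m)) p q s i : wd p = rcons s i ->
  (shift r j *m M) p q = (i == j)%:R * (r * M (wi s) q).
Proof.
move=> E; rewrite shift_mul E; case: s E => [|h s] _ //=.
by rewrite last_rcons belast_rcons.
Qed.

(** A nonempty word has exactly one last letter, so each entry of [v] occurs at most once among the
    coordinates of the vectors [S_j^* v], weighted by [r]. Hence [sum_j |S_j^* v|^2 <= r^2 |v|^2],
    and [r < 1] gives strictness. *)
Lemma shift_row_ball (r : C) : 0 <= r -> r < 1 -> row_ball (shift r).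
Proof.
move=> r0 r1; split; first by apply/card_gt0P; exists (insub_bseq n [::]).
move=> v v0; suff H : \sum_j cdot ((shift r j)^t* *m v) ((shift r j)^t* *m v) <= r * r * cdot v v.
  rewrite -subr_gt0 in r1; have := cdot_row_adj (shift r) v.
  move/eqP; rewrite eq_sym subr_eq addrC -subr_eq => /eqP <-.
  rewrite subr_gt0; apply: le_lt_trans H _.
  rewrite -[ltRHS]mul1r ltr_pM2r ?cdot_gt0 //; rewrite subr_gt0 in r1.
  by rewrite mulr_ilt1.
have rc : Num.conj r = r by apply/CrealP; exact: ger0_real.
have rcb (c : bool) : Num.conj (c%:R * r) = c%:R * r.
  by case: c; rewrite ?mul1r ?mul0r ?rmorph0.
have sE j q : ((shift r j)^t* *m v) q 0 =
   r * (if (size (rcons (wd q) j) <= n)%N then v (wi (rcons (wd q) j)) 0 else 0).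
  rewrite -(sum_wd (rcons (wd q) j) (fun p => v p 0)) mxE mulr_sumr; apply: eq_bigr => p _;
      rewrite !mxE rcb.
  by rewrite -mulrA mulrCA.
rewrite [leLHS](_ : _ = r * r * \sum_j \sum_q \sum_p (wd p == rcons (wd q) j)%:R * `|v p 0| ^+ 2).
  apply: ler_wpM2l; first exact: mulr_ge0.
  rewrite exchange_big; under eq_bigr => q _ do rewrite exchange_big.
  rewrite exchange_big cdot_norm /=; apply: ler_sum => p _.
  under eq_bigr => q _ do rewrite -mulr_suml.
  rewrite -mulr_suml -[leRHS]mul1r ler_wpM2r ?exprn_ge0 //.
  case: (lastP (wd p)) (size_wd p) => [|s i] sn.
    rewrite big1 ?ler01 // => q _; rewrite big1 // => j _.
    by case: (wd q).
  rewrite (_ : \sum_q _ = \sum_q (wd q == s)%:R * 1); last first.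
    apply: eq_bigr => q _; rewrite mulr1 (bigD1 i) //= eqseq_rcons eqxx andbT eq_sym.
    rewrite big1 ?addr0 // => j /negPf ji; by rewrite eqseq_rcons eq_sym [i == j]eq_sym ji andbF.
  rewrite sum_wd; by case: ifP.
rewrite mulr_sumr; apply: eq_bigr => j _; rewrite cdot_norm mulr_sumr; apply: eq_bigr => q _.
rewrite sum_wd sE normrM exprMn (ger0_norm r0) -expr2; case: ifP => _ //.
by rewrite normr0 expr0n.
Qed.

End TruncatedShift.

(** * Taylor coefficients and Toeplitz matrices *)

Section Taylor.
Variables (R : realType) (d : nat).
Local Notation C := R[i].

(* [toep f p q] is [f s] if [p = q ++ s], and [0] if [q] is not a prefix of [p]. *)
Fixpoint toep (f : word d -> C) (p q : word d) : C :=
  match p, q with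
  | _, [::] => f p
  | i :: p', j :: q' => if i == j then toep f p' q' else 0
  | [::], _ :: _ => 0
  end.

Lemma toep_nil f p : toep f p [::] = f p.
Proof. by case: p. Qed.

Lemma toep_delta p q : toep (fun s => (s == [::])%:R) p q = (p == q)%:R.
Proof.
elim: p q => [|i p IH] [|j q] //=; rewrite IH eqseq_cons.
by case: eqP.
Qed.

Lemma toepD f g p q : toep (fun s => f s + g s) p q = toep f p q + toep g p q.
Proof.
elim: p q => [|i p IH] [|j q] //=; rewrite ?addr0 // IH.
by case: ifP; rewrite ?addr0.
Qed.

Lemma toepZ a f p q : toep (fun s => a * f s) p q = a * toep f p q.
Proof.
elim: p q => [|i p IH] [|j q] //=; rewrite ?mulr0 // IH.
by case: ifP; rewrite ?mulr0.
Qed.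

Lemma eq_toep f g : f =1 g -> forall p q, toep f p q = toep g p q.
Proof. by move=> fg; elim=> [|i p IH] [|j q] //=; rewrite ?IH. Qed.

Lemma toep_sum (I : finType) (f : I -> word d -> C) p q :
  toep (fun s => \sum_i f i s) p q = \sum_i toep (f i) p q.
Proof.
elim: p q => [|i p IH] [|j q] //=; first by rewrite big1.
by rewrite IH; case: ifP => // _; rewrite big1.
Qed.

(** The shift acts on the last letter, whereas [toep] recurses on the first; this reconciles them.
    The extra term belongs to [q = p], where the remaining suffix is the single letter [i]. *)
Lemma toep_rcons f f' (a : C) i :
  f [::] = 0 -> (forall s, f (rcons s i) = f' s + (s == [::])%:R * a) ->
  forall p q, toep f (rcons p i) q = toep f' p q + (p == q)%:R * a.
Proof.
move=> f0 fE; elim=> [|h p IH] [|j q] //=.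
- by rewrite -[[:: i]]/(rcons [::] i) fE.
- rewrite mul0r addr0; case: ifP => // _; by case: q.
- by rewrite -rcons_cons fE.
- rewrite IH eqseq_cons; case: ifP => //= _; by rewrite mul0r addr0.
Qed.

Section System.
Variables (k : nat) (S : sys R d k).

(** Letters are read in the order in which the shift appends them, so [nu] and [tay] at [s] are the
    coefficients of the monomial [Z^(rev s)]. The state has no constant term. *)
Definition nu (s : word d) : 'cV[C]_k :=
  if s is j :: s' then foldl (fun v i => sA S i *m v) (sB S j) s' else 0.

Definition tay (s : word d) : C :=
  if s is [::] then sD S else (sC S *m nu s) 0 0.

Lemma nu_rcons s j : nu (rcons s j) = sA S j *m nu s + (s == [::])%:R *: sB S j.
Proof.
case: s => [|i s] /=; first by rewrite mulmx0 add0r scale1r.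
by rewrite foldl_rcons scale0r addr0.
Qed.

Lemma nu_mxword j s : nu (j :: s) = mxword (sA S) (rev s) *m sB S j.
Proof.
elim/last_ind: s => [|s i IH] /=; first by rewrite mul1mx.
by rewrite foldl_rcons rev_rcons /= -mulmxA -IH.
Qed.

Section AtShift.
Variables (n : nat) (r : C).
Local Notation Z := (shift n r : mxtuple R d _).

(** Shifts lengthen words, so a homogeneous solution vanishes by induction on the length. The
    argument covers every [r], in particular [r = 1]. *)
Lemma shift_pencil : pencil S Z \in unitmx.
Proof.
apply: pencil_unit => v vE.
suff H (w : word d) : (size w <= n)%N -> forall l, v l (wi n w) 0 = 0.
  move=> l; apply/matrixP => p z; rewrite (ord1 z) mxE -[p](wdK p); apply: H.
  exact: size_wd.
elim/last_ind: w => [|w i IH] wn l; rewrite vE summxE big1 // => j _.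
  by rewrite shift_mul wiK.
rewrite (shift_mul_rcons _ _ _ _ (wiK wn)) summxE big1 ?mulr0 // => m _.
by rewrite mxE IH ?mulr0 //; rewrite size_rcons in wn; exact: ltnW.
Qed.

Lemma sol_shift v : sol S Z v -> forall l p q,
  v l p q = toep (fun s => r ^+ size s * nu s l 0) (wd p) (wd q).
Proof.
move=> vs.
suff H (w : word d) : (size w <= n)%N -> forall l q, v l (wi n w) q =
     toep (fun s => r ^+ size s * nu s l 0) w (wd q).
  by move=> l p q; rewrite -[in LHS](wdK p) H // size_wd.
elim/last_ind: w => [|w i IH] wn l q; rewrite vs summxE.
  rewrite big1 => [|j _]; last by rewrite shift_mul wiK.
  by case: (wd q) => [|? ?] //=; rewrite mxE mulr0.
rewrite (bigD1 i) //= [X in _ + X]big1 ?addr0 => [|j /negPf ji]; last first.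
  by rewrite (shift_mul_rcons _ _ _ _ (wiK wn)) eq_sym ji mul0r.
rewrite (shift_mul_rcons _ _ _ _ (wiK wn)) eqxx mul1r.
have wn' : (size w <= n)%N by rewrite size_rcons in wn; exact: ltnW.
rewrite (@toep_rcons _ (fun s => \sum_m (r * sA S i l m) * (r ^+ size s * nu s m 0)) (r * sB S i l
    0)).
- rewrite mxE mulrDr toep_sum; congr (_ + _).
    rewrite summxE mulr_sumr; apply: eq_bigr => m _.
    by rewrite mxE IH // toepZ mulrA.
  rewrite mxE -[wi n w == q](inj_eq (@wd_inj d n)) wiK //.
  by case: eqP => _; rewrite ?mulr1n ?mul1r ?mulr0n ?mul0r ?mulr0.
- by rewrite mxE mulr0.
- move=> s; rewrite nu_rcons size_rcons mxE [X in _ * (X + _)]mxE mulrDr; congr (_ + _).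
    rewrite mulr_sumr; apply: eq_bigr => m _; rewrite exprS; ring.
  rewrite mxE; case: s => [|? ?]; last by rewrite !mul0r mulr0.
  by rewrite expr1 mul1r mul1r.
Qed.

Lemma out_shift v : sol S Z v -> forall p q,
  out S v p q = toep (fun s => r ^+ size s * tay s) (wd p) (wd q).
Proof.
move=> vs p q; rewrite /out /rout mxE summxE.
rewrite (@eq_toep _ (fun s => (s == [::])%:R * sD S +
    \sum_l sC S 0 l * (r ^+ size s * nu s l 0))); last first.
  move=> [|j s].
    rewrite [tay _]/= eqxx !mul1r big1 ?addr0 // => l _; by rewrite mxE !mulr0.
  rewrite mul0r add0r [tay _]mxE mulr_sumr; apply: eq_bigr => l _; ring.
rewrite toepD toep_sum; congr (_ + _).
  rewrite (@eq_toep _ (fun s => sD S * (s == [::])%:R)); last by move=> s; rewrite mulrC.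
  rewrite toepZ toep_delta (inj_eq (@wd_inj d n)) mxE.
  by case: eqP; rewrite ?mulr1 ?mulr0.
by apply: eq_bigr => l _; rewrite mxE (sol_shift vs) toepZ.
Qed.

End AtShift.
End System.

Lemma moment_eq_tay k k' (S : sys R d k) (S' : sys R d k') :
  (forall s, s <> [::] -> tay S s = tay S' s) -> moment_eq S S'.
Proof.
move=> H w j; have := H (j :: rev w) _; rewrite /tay !nu_mxword revK !mulmxA => E.
by rewrite [LHS]mx11_scalar E // -mx11_scalar.
Qed.

(** At the shift with [r = 1], truncated at length [size s], the entry of the transfer function in
    row [s] and the column of the empty word is the Taylor coefficient itself. *)
Lemma tay_transfer k k' (S : sys R d k) (S' : sys R d k') :
  (forall n (Z : mxtuple R d n), (0 < n)%N -> pencil S Z \in unitmx ->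
     pencil S' Z \in unitmx -> tfm S Z = tfm S' Z) ->
  forall s, tay S s = tay S' s.
Proof.
move=> H s; pose n := size s; have u := shift_pencil S n 1; have u' := shift_pencil S' n 1.
have [v vs] := sol_exists u; have [v' v's] := sol_exists u'.
have n0 : (0 < #|{: n.-bseq 'I_d}|)%N by apply/card_gt0P; exists (insub_bseq n [::]).
have := H _ _ n0 u u'; rewrite (tfm_out u vs) (tfm_out u' v's) => /matrixP.
move=> /(_ (wi n s) (wi n [::])); rewrite !(out_shift vs, out_shift v's) !wiK //.
by rewrite !toep_nil !expr1n !mul1r.
Qed.

Lemma ball_shift_out (b : nc_ratfun R d) k (S : sys R d k) n r v :
  ratfun_in_hinf_ball b -> realized b S -> 0 <= r -> r < 1 ->
  sol S (shift n r) v -> nc_eval b (shift n r) = out S v /\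
  forall w, cdot (out S v *m w) (out S v *m w) <= cdot w w.
Proof.
move=> [[bd _] bn] bS r0 r1 vs.
have Zb := @shift_row_ball R d n r r0 r1.
have [n0 [W bW]] := bd _ _ Zb; have u := shift_pencil S n r.
have E : nc_eval b (shift n r) = out S v.
  by rewrite (nc_val_eval n0 bW) -(tfm_out u vs); exact: bS bW u.
split=> // w; rewrite -E; apply: opnorm_le1_cdot; apply: le_trans bn.
by apply: ereal_sup_ubound; exists _, (shift n r).
Qed.

(** A system without states has an invertible pencil at every point, so equality of moments becomes
    equality of values everywhere. *)
Lemma realized_const (b : nc_ratfun R d) k (S : sys R d k) a :
  realized b S -> sD S = a -> (forall s, s <> [::] -> tay S s = 0) ->
  nc_reps b (NCConst d a).
Proof.
move=> bS DE H; have [r vr brE] := nc_repsP b.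
have br : nc_reps b r by rewrite brE; split=> // n Z W W' _ -> [].
pose S1 : sys R d 0 := Sys (fun=> 0) (fun=> 0) 0 a.
have bS1 : realized b S1.
  have mE : moment_eq S S1.
    apply: moment_eq_tay => s s0; rewrite H //.
    by case: s s0 => // j s _; rewrite /tay mul0mx mxE.
  exact: (realized_moments bS mE DE).
rewrite brE; split.
  by exists 1%N, (origin R d).
move=> n Z W W' n0 rW [<-].
have u : pencil S1 Z \in unitmx by apply: pencil_unit => v _ [].
have [v vs] := sol_exists u.
have -> : W = tfm S1 Z by apply: bS1 => //; exists r.
by rewrite (tfm_out u vs) /out /rout big_ord0 addr0.
Qed.

(** The column of the empty word in the Toeplitz matrix has norm at most [1]. If its top entry
    [sD S] equals [1], all other entries vanish, and [b] is the constant [1]. *)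
Lemma ball_at0_neq1 (b : nc_ratfun R d) k (S : sys R d k) :
  ratfun_in_hinf_ball b -> realized b S -> ~ nc_reps b (NCConst d 1) -> sD S != 1.
Proof.
move=> bb bS b1; apply/eqP => D1; apply: b1; apply: (realized_const bS D1).
move=> s s0; pose n := size s; pose r : C := 2^-1.
have r0 : 0 <= r by rewrite invr_ge0.
have r1 : r < 1 by rewrite invf_lt1 // ltr1n.
have [v vs] := sol_exists (shift_pencil S n r).
have [_ /(_ (delta_mx (wi n [::]) 0))] := ball_shift_out bb bS r0 r1 vs.
set e := delta_mx _ _.
have -> : cdot e e = 1.
  rewrite cdotE (bigD1 (wi n [::])) //= big1 ?addr0 => [|q /negPf q0].
    by rewrite mxE !eqxx rmorph1 mul1r.
  by rewrite mxE q0 rmorph0 mul0r.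
have WE q : (out S v *m e) q 0 = r ^+ size (wd q) * tay S (wd q).
  rewrite -colE mxE (out_shift vs) wiK // toep_nil //.
rewrite cdot_norm (bigD1 (wi n [::])) //= (bigD1 (wi n s)) /=; last first.
  by apply/eqP => /(congr1 (@wd d n)); rewrite !wiK.
rewrite !WE !wiK // [tay S [::]]/= D1 expr0 mul1r normr1 expr1n gerDl.
set t := r ^+ _ * _ => H.
have H2 : 0 <= \sum_(q | (q != wi n [::]) && (q != wi n s)) `|(out S v *m e) q 0| ^+ 2.
  by apply: sumr_ge0 => q _; exact: exprn_ge0.
have : `|t| ^+ 2 == 0.
  by rewrite eq_le exprn_ge0 // andbT; apply: le_trans H; rewrite lerDl.
rewrite expf_eq0 /= normr_eq0 /t mulf_eq0 expf_eq0 invr_eq0 pnatr_eq0 andbF /=.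
by move/eqP.
Qed.

End Taylor.

(** * Controllable and observable colligations are minimal *)

Section Minimality.
Variables (R : realType) (d : nat).
Local Notation C := R[i].

Lemma fm_equiv_tay (M M' : vectType C) (U : fm_colligation d M) (U' : fm_colligation d M') :
  fm_equiv U U' -> forall s, tay (fm_sys U) s = tay (fm_sys U') s.
Proof.
move=> UU'; apply: tay_transfer => n Z n0 u u'; exact: (UU' n Z (conj n0 u) (conj n0 u')).
Qed.

Lemma tay_fm (M : vectType C) (U : fm_colligation d M) w j :
  tay (fm_sys U) (j :: rev w) = fmC U (word_act (fmA U) w (fmB U j)).
Proof. by rewrite /tay nu_mxword revK mulmxA [_ *m _]fm_moment mxE eqxx. Qed.

(** Reachable vectors of the two colligations are paired in the product of the state spaces. The
    span of the pairs projects onto [M], so if [M'] were smaller it would contain a nonzero pair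
    with second entry [0]. Equality of the Taylor coefficients makes its first entry unobservable,
    hence zero. *)
Lemma fm_minimal_of (M : vectType C) (U : fm_colligation d M) :
  (forall v : M, linspan [set y | exists w j, y = word_act (fmA U) w (fmB U j)] v) ->
  (forall v : M, (forall w, fmC U (word_act (fmA U) w v) = 0) -> v = 0) ->
  fm_minimal U.
Proof.
move=> ctrl obs M' U' UU'; rewrite leqNgt; apply/negP => dlt.
pose S := [set p : M * M' | exists w j, p = (word_act (fmA U) w (fmB U j),
                                             word_act (fmA U') w (fmB U' j))].
pose f1 := linfun (fun p : M * M' => p.1); pose f2 := linfun (fun p : M * M' => p.2).
have f1E p : f1 p = p.1 by rewrite /f1 linfun_linear.
have f2E p : f2 p = p.2 by rewrite /f2 linfun_linear.
have f1S : (f1 @: vspan S = fullv)%VS.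
  apply/eqP; rewrite eqEsubv subvf; apply/subvP => v _.
  have : forall v, linspan [set y | exists w j, y = word_act (fmA U) w (fmB U j)] v ->
      v \in (f1 @: vspan S)%VS.
    apply: linspan_ind => [|a u y [w [j ->]] yS]; first exact: mem0v.
    rewrite memvD // memvZ //; apply/memv_imgP.
    exists (word_act (fmA U) w (fmB U j), word_act (fmA U') w (fmB U' j)); last by rewrite f1E.
    by apply/memv_vspan/linspan_mem; exists w, j.
  by apply; exact: ctrl.
have dS : (\dim {:M} <= \dim (vspan S))%N by rewrite -f1S -(limg_ker_dim f1 (vspan S)) leq_addl.
have : (0 < \dim (vspan S :&: lker f2))%N.
  rewrite lt0n; apply/eqP => d0; have := limg_ker_dim f2 (vspan S).
  rewrite d0 add0n => E; move: dlt; rewrite ltnNge => /negP; apply.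
  by apply: (leq_trans dS); rewrite -E; exact: dimvS (subvf _).
rewrite lt0n dimv_eq0 -vpick0; set p := vpick _ => p0.
have := memv_pick (vspan S :&: lker f2); rewrite -/p memv_cap memv_ker f2E.
case/andP => /memv_vspan pS /eqP p2.
have H u : fmC U (word_act (fmA U) u p.1) = fmC U' (word_act (fmA U') u p.2).
  move: p pS {p0 p2}; apply: linspan_ind => [|a _ y [w [j ->]] yE].
    have w0 (L L' : vectType C) (V : fm_colligation d L) w : word_act (fmA V) w 0 = 0.
      by elim: w => //= i w ->; rewrite linear0.
    by rewrite !w0 // !linear0.
  have wP (L : vectType C) (V : fm_colligation d L) v1 v2 : word_act (fmA V) u (a *: v1 + v2) =
      a *: word_act (fmA V) u v1 + word_act (fmA V) u v2.
    by elim: (u) => //= i w' ->; rewrite linearP.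
  transitivity (fmC U (word_act (fmA U) u (a *: word_act (fmA U) w (fmB U j) + y.1))) => //.
  transitivity (fmC U' (word_act (fmA U') u (a *: word_act (fmA U') w (fmB U' j) + y.2))) => //.
  rewrite !wP !linearP; congr (_ *: _ + _); last exact: yE.
  have cat_act (L : vectType C) (V : fm_colligation d L) v :
      word_act (fmA V) u (word_act (fmA V) w v) =
    word_act (fmA V) (u ++ w) v by rewrite /word_act foldr_cat.
  by rewrite /= !cat_act -!tay_fm; exact: fm_equiv_tay.
have p1 : p.1 = 0.
  apply: obs => u; rewrite H p2.
  have -> : word_act (fmA U') u 0 = 0 by elim: u => //= i w ->; rewrite linear0.
  exact: linear0.
by move/eqP: p0; apply; rewrite [p]surjective_pairing p1 p2.
Qed.

End Minimality.

(** * Energy balance and inner functions *)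

(** The form may be degenerate, as the defect of a row contraction and the GNS form are. *)
Lemma cauchy_schwarz (F : numClosedFieldType) (V : lmodType F) (q : V -> V -> F) :
  (forall x a y z, q x (a *: y + z) = a * q x y + q x z) ->
  (forall x y, q y x = Num.conj (q x y)) -> (forall x, 0 <= q x x) ->
  forall x y, `|q x y| ^+ 2 <= q x x * q y y.
Proof.
move=> ql qc q0 x y.
have q_x0 z : q z 0 = 0.
  have := ql z (-1) 0 0; by rewrite scaler0 add0r mulN1r addNr.
have qZ x' a y' : q x' (a *: y') = a * q x' y' by rewrite -[a *: y']addr0 ql q_x0 addr0.
have qD x' y' z' : q x' (y' + z') = q x' y' + q x' z'.
  by rewrite -[y']scale1r ql mul1r scale1r.
have qZl x' a y' : q (a *: x') y' = Num.conj a * q x' y'.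
  by rewrite qc qZ rmorphM /= -qc.
have qDl x' y' z' : q (x' + y') z' = q x' z' + q y' z'.
  by rewrite qc qD rmorphD /= -!qc.
have rx z : Num.conj (q z z) = q z z by rewrite -qc.
have pos (a : F) : 0 <= q y y - (a * Num.conj (q x y) + Num.conj a * q x y) +
    Num.conj a * a * q x x.
  have := q0 (y - a *: x); rewrite -scaleNr qD !qDl !qZ !qZl [q y x]qc.
  by rewrite rmorphN; congr (_ <= _); ring.
have [xx0|xx0] := eqVneq (q x x) 0.
  rewrite xx0 mul0r normCK.
  have [->|xy0] := eqVneq (q x y) 0; first by rewrite mul0r.
  pose s := q x y * Num.conj (q x y).
  have s0 : 0 < s by rewrite /s -normCK exprn_gt0 // normr_gt0.
  have sc : Num.conj s = s by apply/CrealP; exact: gtr0_real.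
  (* If [q x x = 0] but [q x y != 0], subtracting [t * q x y] times [x] from [y] would bring its
     square down to [-1]. *)
  pose t := (q y y + 1) / (2 * s).
  have tc : Num.conj t = t.
    by apply/CrealP; rewrite ger0_real // divr_ge0 ?addr_ge0 ?q0 // mulr_ge0 // ltW.
  have := pos (t * q x y); rewrite xx0 mulr0 addr0 rmorphM /= tc.
  have -> : q y y - (t * q x y * Num.conj (q x y) + t * Num.conj (q x y) * q x y) =
      q y y - t * (2 * s).
    by rewrite /s; ring.
  have -> : t * (2 * s) = q y y + 1.
    by rewrite /t divfK // mulf_neq0 ?pnatr_eq0 // gt_eqF.
  by rewrite opprD addrA subrr sub0r oppr_ge0 ler10.
have xxp : 0 < q x x by rewrite lt_def xx0 q0.
have := pos (q x y / q x x); rewrite rmorphM fmorphV /= rx.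
have -> : q y y - (q x y / q x x * Num.conj (q x y) + Num.conj (q x y) / q x x * q x y) +
   Num.conj (q x y) / q x x * (q x y / q x x) * q x x = q y y - (q x y * Num.conj (q x y)) / q x x.
  by field.
by rewrite subr_ge0 ler_pdivrMr // -normCK mulrC.
Qed.

Section WordSums.
Variable d : nat.

Fixpoint wlist (n : nat) : seq (word d) :=
  if n is n'.+1 then [seq j :: w | j <- enum 'I_d, w <- wlist n'] else [:: [::]].

Definition wsum (V : nmodType) (n : nat) (f : word d -> V) : V :=
  \sum_(w <- wlist n) f w.

Lemma wsum0 (V : nmodType) (f : word d -> V) : wsum 0 f = f [::].
Proof. by rewrite /wsum big_seq1. Qed.

Lemma wsumS (V : nmodType) n (f : word d -> V) :
  wsum n.+1 f = \sum_j wsum n (fun w => f (j :: w)).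
Proof. by rewrite /wsum /= big_allpairs_dep big_enum. Qed.

Lemma mem_wlist n w : (w \in wlist n) = (size w == n).
Proof.
elim: n w => [|n IH] w; first by rewrite inE size_eq0.
apply/allpairsP/eqP => [[[j v] /= [_ + ->]]|]; first by rewrite IH => /eqP <-.
case: w => // j w [/eqP wn]; exists (j, w); split=> //=; first by rewrite mem_enum.
by rewrite IH.
Qed.

Lemma uniq_wlist n : uniq (wlist n).
Proof.
elim: n => // n IH /=; apply: allpairs_uniq => //; first exact: enum_uniq.
by move=> [j w] [j' w'] _ _ [-> ->].
Qed.

Lemma wsum_tuple (V : nmodType) n (f : word d -> V) :
  \sum_(w : n.-tuple 'I_d) f w = wsum n f.
Proof.
rewrite /wsum -(big_enum _ _ _ (fun w : n.-tuple 'I_d => f w)) /=.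
rewrite -(big_map (@tval n 'I_d) xpredT f); apply: perm_big; apply: uniq_perm.
- by rewrite map_inj_uniq ?enum_uniq //; exact: val_inj.
- exact: uniq_wlist.
move=> w; rewrite mem_wlist; apply/mapP/idP => [[t _ ->]|wn]; first by rewrite size_tuple.
by exists (Tuple wn); rewrite ?mem_enum.
Qed.

Lemma wsumD (V : nmodType) n (f g : word d -> V) :
  wsum n (fun w => f w + g w) = wsum n f + wsum n g.
Proof. exact: big_split. Qed.

Lemma eq_wsum (V : nmodType) n (f g : word d -> V) : f =1 g -> wsum n f = wsum n g.
Proof. by move=> fg; apply: eq_bigr. Qed.

Lemma wsum_exchange (V : nmodType) (I : finType) n (f : I -> word d -> V) :
  wsum n (fun w => \sum_i f i w) = \sum_i wsum n (f i).
Proof. exact: exchange_big. Qed.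

Lemma ler_wsum (K : numDomainType) n (f g : word d -> K) : (forall w, f w <= g w) ->
  wsum n f <= wsum n g.
Proof. by move=> fg; apply: ler_sum. Qed.

Lemma wsum_ge0 (K : numDomainType) n (f : word d -> K) : (forall w, 0 <= f w) ->
  0 <= wsum n f.
Proof. by move=> f0; apply: sumr_ge0. Qed.

Lemma wsum_term_le (K : numDomainType) (f : word d -> K) w : (forall w, 0 <= f w) ->
  f w <= wsum (size w) f.
Proof.
move=> f0; rewrite /wsum (bigD1_seq w) ?mem_wlist ?uniq_wlist //=.
by rewrite lerDl; apply: sumr_ge0.
Qed.

Lemma wsum_mulr (K : pzRingType) n a (f : word d -> K) :
  wsum n (fun w => a * f w) = a * wsum n f.
Proof. by rewrite /wsum mulr_sumr. Qed.

Definition wupto n : seq (word d) := flatten [seq wlist k | k <- iota 0 n].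

Lemma mem_wupto n w : (w \in wupto n) = (size w < n)%N.
Proof.
apply/flatten_mapP/idP => [[k]|wn].
  by rewrite mem_iota mem_wlist /= add0n => kn /eqP ->.
by exists (size w); rewrite ?mem_wlist // mem_iota.
Qed.

Lemma sum_wupto (V : nmodType) n (f : word d -> V) :
  \sum_(w <- wupto n) f w = \sum_(0 <= k < n) wsum k f.
Proof. by rewrite big_flatten big_map /index_iota subn0. Qed.

Lemma uniq_wupto n : uniq (wupto n).
Proof.
elim: n => // n IH; rewrite /wupto -addn1 iotaD map_cat flatten_cat cat_uniq IH /= cats0.
rewrite uniq_wlist andbT; apply/hasPn => w; rewrite mem_wlist add0n => /eqP wn.
by apply/negP; rewrite -/(wupto n) mem_wupto wn ltnn.
Qed.

End WordSums.

Section SquareSummable.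
Variables (R : realType) (d : nat).
Local Notation C := R[i].

Definition n2 (z : C) : R := (complex.Re z) ^+ 2 + (complex.Im z) ^+ 2.

Lemma n2E z : (n2 z)%:C = `|z| ^+ 2.
Proof. exact: add_Re2_Im2. Qed.

Lemma n2_norm z : (complex.Re `|z|) ^+ 2 = n2 z.
Proof.
by apply: complexI; rewrite n2E rmorphXn /=; congr (_ ^+ 2).
Qed.

Lemma n2_ge0 z : 0 <= n2 z.
Proof. by rewrite addr_ge0 ?sqr_ge0. Qed.

Lemma n2_0 : n2 0 = 0.
Proof. by rewrite /n2 /= !expr0n addr0. Qed.

Lemma n2_1 : n2 1 = 1.
Proof. by rewrite /n2 /= expr1n expr0n addr0. Qed.

Lemma n2M x y : n2 (x * y) = n2 x * n2 y.
Proof. by apply: complexI; rewrite rmorphM /= !n2E normrM exprMn. Qed.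

Lemma n2D x y : n2 (x + y) <= 2 * n2 x + 2 * n2 y.
Proof.
case: x y => [a b] [a' b']; rewrite /n2 /= -subr_ge0.
rewrite [leRHS](_ : _ = (a - a') ^+ 2 + (b - b') ^+ 2); last by ring.
by rewrite addr_ge0 ?sqr_ge0.
Qed.

Lemma Re_mul_n2 x y : `|complex.Re (x * y)| <= (n2 x + n2 y) / 2.
Proof.
case: x y => [a b] [a' b']; rewrite /n2 /= ler_norml; apply/andP; split; rewrite -subr_ge0.
  rewrite [leRHS](_ : _ = ((a + a') ^+ 2 + (b - b') ^+ 2) / 2); last by field.
  by rewrite divr_ge0 ?addr_ge0 ?sqr_ge0.
rewrite [leRHS](_ : _ = ((a - a') ^+ 2 + (b + b') ^+ 2) / 2); last by field.
by rewrite divr_ge0 ?addr_ge0 ?sqr_ge0.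
Qed.

Lemma Im_mul_n2 x y : `|complex.Im (x * y)| <= (n2 x + n2 y) / 2.
Proof.
case: x y => [a b] [a' b']; rewrite /n2 /= ler_norml; apply/andP; split; rewrite -subr_ge0.
  rewrite [leRHS](_ : _ = ((a + b') ^+ 2 + (b + a') ^+ 2) / 2); last by field.
  by rewrite divr_ge0 ?addr_ge0 ?sqr_ge0.
rewrite [leRHS](_ : _ = ((a - b') ^+ 2 + (b - a') ^+ 2) / 2); last by field.
by rewrite divr_ge0 ?addr_ge0 ?sqr_ge0.
Qed.

Lemma n2N x : n2 (- x) = n2 x.
Proof. by case: x => [a b]; rewrite /n2 /= !sqrrN. Qed.

Lemma n2_eq0 z : n2 z = 0 -> z = 0.
Proof.
move=> z0; have : `|z| ^+ 2 == 0 by rewrite -n2E z0.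
by rewrite expf_eq0 /= normr_eq0 => /eqP.
Qed.

Lemma cnorm_n2 N (v : 'cV[C]_N) : cnorm v ^+ 2 = \sum_i n2 (v i 0).
Proof.
apply: complexI; rewrite -cdot_cnorm cdot_norm rmorph_sum.
by apply: eq_bigr => i _; rewrite /= n2E.
Qed.

Lemma bounded_series_cvg (a : nat -> R) M : (forall n, 0 <= a n) ->
  (forall n, \sum_(0 <= k < n) a k <= M) -> cvgn (series a).
Proof.
move=> a0 aM; apply: nondecreasing_is_cvgn.
  by apply/nondecreasing_seqP => n; rewrite /series /= big_nat_recr //= lerDl.
by exists M => _ [n _ <-]; exact: aM.
Qed.

Lemma bounded_series_cvg0 (a : nat -> R) M : (forall n, 0 <= a n) ->
  (forall n, \sum_(0 <= k < n) a k <= M) -> a @ \oo --> (0 : R).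
Proof. by move=> a0 aM; apply: cvg_series_cvg_0; exact: bounded_series_cvg a0 aM. Qed.

Implicit Type u : nc_series R d.

Definition lev u (n : nat) : R := wsum n (fun w => n2 (u w)).

Lemma lev_ge0 u n : 0 <= lev u n.
Proof. by apply: wsum_ge0 => w; exact: n2_ge0. Qed.

Lemma h2_sqnorm_ge u n : ((\sum_(0 <= k < n) lev u k)%:E <= h2_sqnorm u)%E.
Proof.
apply: esum_ge; exists [set` wupto d n].
  by split=> //; exact: finite_seq.
rewrite -fsbig_seq ?uniq_wupto //= sumEFin lee_fin -sum_wupto.
by under [in leRHS]eq_bigr do rewrite n2_norm.
Qed.

Lemma h2_sqnorm_le u (M : R) : (forall n, \sum_(0 <= k < n) lev u k <= M) ->
  (h2_sqnorm u <= M%:E)%E.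
Proof.
move=> uM; apply: ge_ereal_sup => _ [X [+ _] <-].
move=> /finite_seqP [s0 ->]; pose s := undup s0.
have -> : [set` s0] = [set` s] by apply/seteqP; split=> w /=; rewrite mem_undup.
rewrite -fsbig_seq ?undup_uniq //= sumEFin lee_fin.
under eq_bigr do rewrite n2_norm.
pose n := (\max_(w <- s) size w).+1.
apply: le_trans (uM n); rewrite -sum_wupto [leRHS](bigID (mem s)) /=.
rewrite -[X in _ <= X + _]big_filter [X in _ <= X + _](perm_big s).
  by rewrite lerDl; apply: sumr_ge0 => w _; exact: n2_ge0.
apply: uniq_perm; rewrite ?filter_uniq ?uniq_wupto ?undup_uniq // => w.
rewrite mem_filter; case: (boolP (w \in s)) => //= ws.
by rewrite mem_wupto ltnS (leq_bigmax_seq w).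
Qed.

Lemma in_h2_bound u : in_h2 u ->
  exists2 M : R, h2_sqnorm u = M%:E & forall n, \sum_(0 <= k < n) lev u k <= M.
Proof.
rewrite /in_h2 => uoo; have u0 := h2_sqnorm_ge u 0; rewrite big_nil in u0.
have fu : h2_sqnorm u \is a fin_num.
  by rewrite ge0_fin_numE.
exists (fine (h2_sqnorm u)); first by rewrite fineK.
by move=> n; rewrite -lee_fin fineK //; exact: h2_sqnorm_ge.
Qed.

End SquareSummable.

Section ComplexLimits.
Variable R : realType.
Local Notation C := R[i].

Lemma cvg_complex (s : nat -> C) (a b : R) :
  (fun n => complex.Re (s n)) @ \oo --> a -> (fun n => complex.Im (s n)) @ \oo --> b ->
  (s : nat -> C^o) @ \oo --> (a +i* b : C^o).
Proof.
move=> sa sb; apply/cvgrPdist_lt => e e0.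
have eR : e = (complex.Re e)%:C by rewrite RRe_real // gtr0_real.
have e0' : 0 < complex.Re e by rewrite -ltcR -eR.
have e2 : 0 < complex.Re e / 2 by rewrite divr_gt0.
near=> n.
have ha : `|a - complex.Re (s n)| < complex.Re e / 2.
  by near: n; move/cvgrPdist_lt: sa; apply.
have hb : `|b - complex.Im (s n)| < complex.Re e / 2.
  by near: n; move/cvgrPdist_lt: sb; apply.
rewrite eR; case: (s n) ha hb => x y /= ha hb.
have -> : (a +i* b : C) - (x +i* y) = (a - x)%:C + 'i * (b - y)%:C.
  by rewrite [LHS]complexE.
apply: le_lt_trans (ler_normD _ _) _.
have ni : `|'i : C| = 1 by rewrite normc_def /= expr0n expr1n add0r sqrtr1.
have nr (z : R) : `|z%:C : C| = `|z|%:C by rewrite normc_def /= expr0n addr0 sqrtr_sqr.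
rewrite normrM ni mul1r !nr -rmorphD ltcR; lra.
Unshelve. all: by end_near. Qed.

Lemma complex_series_cvg (a : nat -> C) (M : nat -> R) :
  (forall n, `|complex.Re (a n)| <= M n) -> (forall n, `|complex.Im (a n)| <= M n) ->
  cvgn (series M) ->
  exists l : C, ((fun n => \sum_(0 <= k < n) a k) : nat -> C^o) @ \oo --> (l : C^o).
Proof.
move=> aM bM cM.
have key (f : C -> R) : (forall n, `|f (a n)| <= M n) -> cvgn (series (fun n => f (a n))).
  move=> fM; apply: normed_cvg; apply: (series_le_cvg _ _ _ cM) => n //=.
  exact: le_trans (fM n).
exists (limn (series (fun n => complex.Re (a n))) +i* limn (series (fun n => complex.Im (a n)))).
apply: cvg_complex.
  have -> : (fun n => complex.Re (\sum_(0 <= k < n) a k)) = series (fun n => complex.Re (a n)).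
    by apply/funext => n; rewrite /series /=; elim/big_rec2: _ => // i x y _ <-;
        case: (a i) y => ? ? [].
  exact: key.
have -> : (fun n => complex.Im (\sum_(0 <= k < n) a k)) = series (fun n => complex.Im (a n)).
  by apply/funext => n; rewrite /series /=; elim/big_rec2: _ => // i x y _ <-;
      case: (a i) y => ? ? [].
exact: key.
Qed.

(** Entrywise convergence determines [lim] once matrices form a separated space; separation is
    inherited from an entry in which two matrices differ. *)
Lemma mx_lim n (s : nat -> 'M[C^o]_n) (L : 'M[C^o]_n) :
  (forall i j, (fun k => s k i j) @ \oo --> L i j) -> lim (s @ \oo) = L.
Proof.
move=> H; apply: cvg_lim.
  rewrite ball_hausdorff => A B AB.
  have [i [j Aij]] : exists i j, A i j != B i j.
    apply: contrapT => h; move/eqP: AB; apply; apply/matrixP => i j.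
    by apply: contrapT => h'; apply: h; exists i, j; apply/eqP.
  have := @norm_hausdorff _ C^o; rewrite ball_hausdorff => /(_ _ _ Aij) [r rE].
  exists r; apply/eqP; rewrite -subset0 => X [[_ XA] [_ XB]].
  by move/eqP: rE; rewrite -subset0 => /(_ (X i j)); apply; split.
apply/cvg_ballP => e e0.
have HH : \forall k \near \oo, forall i j, ball (L i j) e (s k i j).
  apply: filter_forall => i; apply: filter_forall => j.
  by move/cvg_ballP: (H i j); apply.
by near=> k; split=> //; near: k.
Unshelve. all: by end_near. Qed.

End ComplexLimits.

Section StrictRowBall.
Variables (R : realType) (d : nat).
Local Notation C := R[i].

Lemma mulmx_bound n (M : 'M[C]_n) : exists2 K : C, 0 <= K &
  forall y : 'cV[C]_n, cdot (M *m y) (M *m y) <= K * cdot y y.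
Proof.
exists (\sum_i cdot ((row i M)^t*) ((row i M)^t*)).
  by apply: sumr_ge0 => i _; exact: cdot_ge0.
move=> y; rewrite cdot_norm mulr_suml; apply: ler_sum => i _.
have -> : (M *m y) i 0 = cdot ((row i M)^t*) y.
  by rewrite cdotE mxE; apply: eq_bigr => j _; rewrite !mxE conjCK.
apply: cauchy_schwarz; last exact: cdot_ge0.
  by move=> x a z t; rewrite cdotDr cdotZr.
exact: cdotC.
Qed.

Lemma adj_defect n (Z : mxtuple R d n) :
  (1%:M - \sum_j Z j *m (Z j)^t*)^t* = 1%:M - \sum_j Z j *m (Z j)^t*.
Proof.
rewrite linearB /= map_mxB trmx1 map_scalar_mx rmorph1; congr (_ - _).
rewrite linear_sum /= map_mx_sum; apply: eq_bigr => j _.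
by rewrite trmx_mul map_mxM trmxCK.
Qed.

Lemma defect_cauchy_schwarz n (Z : mxtuple R d n) (x y : 'cV[C]_n)
    (D := 1%:M - \sum_j Z j *m (Z j)^t*) : row_contraction Z ->
  `|cdot x (D *m y)| ^+ 2 <= cdot x (D *m x) * cdot y (D *m y).
Proof.
move=> Zc; pose q (x y : 'cV[C]_n) := cdot x (D *m y).
have ql u a v w : q u (a *: v + w) = a * q u v + q u w.
  by rewrite /q mulmxDr -scalemxAr cdotDr cdotZr.
have qc u v : q v u = Num.conj (q u v).
  by rewrite /q -cdotC cdot_mull adj_defect.
exact: (cauchy_schwarz ql qc Zc).
Qed.

(** A uniform gap without compactness. Cauchy-Schwarz for the form of [D = 1 - Z Z^*] at [y] and
    [D^-1 y] gives [|y|^4 <= <y, D y> <D^-1 y, y>], and the last factor is at most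
    [(K + 1) |y|^2]. *)
Lemma row_ball_rate n (Z : mxtuple R d n) : row_ball Z ->
  exists rho : C, [/\ 0 <= rho, rho < 1 & forall y : 'cV[C]_n,
    \sum_j cdot ((Z j)^t* *m y) ((Z j)^t* *m y) <= rho * cdot y y].
Proof.
move=> Zb; have Zc := row_ball_contraction Zb.
pose D := 1%:M - \sum_j Z j *m (Z j)^t*.
have uD : D \in unitmx.
  apply: unitmx_inj => u Du; apply/eqP/negPn/negP => u0.
  by case: Zb => _ /(_ u u0); rewrite -/D Du cdot0r ltxx.
have [K K0 KP] := mulmx_bound (invmx D).
pose L := K + 1.
have L0 : 0 < L by rewrite ltr_wpDl.
have LP y : cdot y y <= L * cdot y (D *m y).
  have [->|y0] := eqVneq y 0; first by rewrite mulmx0 !cdot0r mulr0.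
  have yy := cdot_gt0 y0.
  have := defect_cauchy_schwarz y (invmx D *m y) Zc; rewrite -/D mulKVmx //.
  have cr : Num.conj (cdot y y) = cdot y y by apply/CrealP; exact: gtr0_real.
  rewrite normCK cr => H.
  have {}H : cdot y y * cdot y y <= cdot y (D *m y) * (L * cdot y y).
    apply: le_trans H _; apply: ler_wpM2l; first exact: Zc.
    have zr : 0 <= cdot (invmx D *m y) y.
      by have := Zc (invmx D *m y); rewrite -/D mulKVmx.
    have h2 : cdot (invmx D *m y) y + cdot y (invmx D *m y) <= L * cdot y y.
      apply: le_trans (cdot_amgm _ _) _; rewrite /L mulrDl mul1r lerD2r; exact: KP.
    apply: le_trans h2; rewrite lerDl.
    by rewrite cdotC conjC_ge0.
  by rewrite -(ler_pM2r yy) [L * _]mulrC -mulrA.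
exists (1 - L^-1); split.
- by rewrite subr_ge0 invf_le1 // /L lerDr.
- by rewrite ltrBlDr ltrDl invr_gt0.
move=> y; rewrite cdot_row_adj -/D mulrBl mul1r lerD2l lerN2.
by rewrite mulrC ler_pdivrMr // mulrC LP.
Qed.

Lemma wsum_adj_rate n (Z : mxtuple R d n) rho : 0 <= rho ->
  (forall y : 'cV[C]_n, \sum_j cdot ((Z j)^t* *m y) ((Z j)^t* *m y) <= rho * cdot y y) ->
  forall k (y : 'cV[C]_n),
  wsum k (fun w => cdot ((mxword Z w)^t* *m y) ((mxword Z w)^t* *m y)) <= rho ^+ k * cdot y y.
Proof.
move=> r0 Zr; elim=> [|k IH] y.
  by rewrite wsum0 /= trmx1 map_scalar_mx rmorph1 mul1mx mul1r.
rewrite wsumS exprSr -mulrA.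
apply: (@le_trans _ _ (\sum_j rho ^+ k * cdot ((Z j)^t* *m y) ((Z j)^t* *m y))).
  apply: ler_sum => j _; apply: le_trans (IH ((Z j)^t* *m y)).
  apply: ler_wsum => w /=; rewrite trmx_mul map_mxM !mulmxA; exact: lexx.
by rewrite -mulr_sumr ler_wpM2l ?exprn_ge0.
Qed.

(** Geometric decay of the monomials of each degree; together with square-summable coefficients it
    makes the series of [h2_eval] converge. *)
Lemma wsum_entry_rate n (Z : mxtuple R d n) : row_ball Z ->
  exists rho : R, [/\ 0 <= rho, rho < 1 & forall k p q,
    wsum k (fun w => n2 (mxword Z w p q)) <= rho ^+ k].
Proof.
move=> /row_ball_rate [r [r0 r1 rP]].
have rE : r = (complex.Re r)%:C by rewrite RRe_real // ger0_real.
exists (complex.Re r); split; first by rewrite -ler0c -rE.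
  by rewrite -ltcR -rE.
move=> k p q; rewrite -lecR rmorphXn /= -rE rmorph_sum /=.
have := wsum_adj_rate r0 rP k (delta_mx p 0).
have -> : cdot (delta_mx p 0) (delta_mx p 0) = 1 :> C.
  rewrite cdot_norm (bigD1 p) //= big1 ?addr0 => [|i /negPf ip].
    by rewrite mxE !eqxx normr1 expr1n.
  by rewrite mxE ip normr0 expr0n.
rewrite mulr1; apply: le_trans; apply: ler_sum => w _; rewrite n2E cdot_norm.
rewrite (bigD1 q) //= -[leLHS]addr0 lerD //; last by apply: sumr_ge0 => i _; exact: exprn_ge0.
by rewrite -colE !mxE norm_conjC.
Qed.

End StrictRowBall.

(** * Trajectories of a system driven by a power series *)

Section Trajectories.
Variables (R : realType) (d k : nat) (S : sys R d k) (u : nc_series R d).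
Local Notation C := R[i].

(** The last letter is processed first, so that the leftmost factor of [mxword Z w] is the most
    recent step. *)
Fixpoint state (w : word d) : 'cV[C]_k :=
  if w is j :: w' then sA S j *m state w' + u w' *: sB S j else 0.

Definition output (w : word d) : C := (sC S *m state w) 0 0 + sD S * u w.

Definition state_energy (n : nat) : R := wsum n (fun w => cnorm (state w) ^+ 2).

Section Evaluation.
Variables (n : nat) (Z : mxtuple R d n).

Definition homog (f : word d -> C) (m : nat) : 'M[C]_n := wsum m (fun w => f w *: mxword Z w).

Lemma h2_evalE (f : nc_series R d) : h2_eval f Z =
  lim ((fun m => \sum_(0 <= i < m) homog f i : 'M[C^o]_n) @ \oo).
Proof.
rewrite /h2_eval; congr (lim (_ @ \oo)); apply/funext => m; apply: eq_bigr => i _.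
exact: (wsum_tuple _ (fun w => f w *: mxword Z w : 'M[C^o]_n)).
Qed.

Lemma homog_state0 l : homog (fun w => state w l 0) 0 = 0.
Proof. by rewrite /homog wsum0 /= mxE scale0r. Qed.

Lemma homog_stateS m l : homog (fun w => state w l 0) m.+1 =
  \sum_j Z j *m (\sum_i sA S j l i *: homog (fun w => state w i 0) m + sB S j l 0 *: homog u m).
Proof.
rewrite /homog wsumS; apply: eq_bigr => j _.
transitivity (Z j *m wsum m (fun w => (\sum_i sA S j l i * state w i 0 +
    sB S j l 0 * u w) *: mxword Z w)).
  rewrite /wsum mulmx_sumr; apply: eq_bigr => w _.
  by rewrite -scalemxAr; congr (_ *: _); rewrite !mxE [u w * _]mulrC.
congr (_ *m _); rewrite /wsum scaler_sumr.
under [X in _ = X + _]eq_bigr => i _ do rewrite scaler_sumr.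
rewrite exchange_big -big_split /=; apply: eq_bigr => w _.
under [X in _ = X + _]eq_bigr do rewrite scalerA.
by rewrite -scaler_suml scalerA -scalerDl.
Qed.

Lemma homog_output m : homog output m =
  \sum_l sC S 0 l *: homog (fun w => state w l 0) m + sD S *: homog u m.
Proof.
rewrite /homog /wsum scaler_sumr.
under [X in _ = X + _]eq_bigr => l _ do rewrite scaler_sumr.
rewrite exchange_big -big_split /=; apply: eq_bigr => w _.
under eq_bigr do rewrite scalerA.
by rewrite -scaler_suml scalerA -scalerDl /output mxE.
Qed.

(** Each term [f_w (Z^w)_pq] is bounded by half of [|f_w|^2 + |(Z^w)_pq|^2]; the first part is
    summable by assumption, the second geometrically. *)
Lemma homog_entry_cvg (f : word d -> C) (M rho : R) p q : 0 <= rho -> rho < 1 ->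
  (forall m, wsum m (fun w => n2 (mxword Z w p q)) <= rho ^+ m) ->
  (forall m, \sum_(0 <= i < m) lev f i <= M) ->
  exists l : C, ((fun m => (\sum_(0 <= i < m) homog f i) p q) : nat -> C^o) @ \oo --> (l : C^o).
Proof.
move=> r0 r1 Zr fM.
pose a m := homog f m p q.
have aE m : a m = wsum m (fun w => f w * mxword Z w p q).
  by rewrite /a /homog /wsum summxE; apply: eq_bigr => w _; rewrite mxE.
have bnd (g : C -> R) : {morph g : x y / x + y} -> g 0 = 0 ->
   (forall x y, `|g (x * y)| <= (n2 x + n2 y) / 2) ->
    forall m, `|g (a m)| <= (lev f m + rho ^+ m) / 2.
  move=> gD g0 gn m; rewrite aE /wsum (big_morph g gD g0); apply: le_trans (ler_norm_sum _ _ _) _.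
  apply: (@le_trans _ _ (\sum_(w <- wlist d m) (n2 (f w) + n2 (mxword Z w p q)) / 2)).
    by apply: ler_sum => w _; exact: gn.
  rewrite -mulr_suml big_split /= ler_pM2r ?invr_gt0 // lerD2l; exact: Zr.
have cv : cvgn (series (fun m => (lev f m + rho ^+ m) / 2)).
  apply: (@bounded_series_cvg _ _ ((M + (1 - rho)^-1) / 2)) => m.
    by rewrite divr_ge0 // addr_ge0 ?lev_ge0 ?exprn_ge0.
  rewrite -mulr_suml ler_pM2r ?invr_gt0 // big_split /= lerD //.
  have r1' : 0 < 1 - rho by rewrite subr_gt0.
  rewrite -(ler_pM2r r1') mulVf ?gt_eqF // mulrC big_mkord.
  by rewrite -[1 - rho]opprB mulNr -subrX1 opprB gerBl exprn_ge0.
have [l lP] := complex_series_cvg 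
  (bnd (@complex.Re R) (ltac:(by move=> [? ?] [? ?])) erefl (@Re_mul_n2 R))
  (bnd (@complex.Im R) (ltac:(by move=> [? ?] [? ?])) erefl (@Im_mul_n2 R)) cv.
exists l; have -> : (fun m => (\sum_(0 <= i < m) homog f i) p q) = (fun m =>
    \sum_(0 <= i < m) a i) by apply/funext => m; rewrite summxE.
exact: lP.
Qed.

End Evaluation.
End Trajectories.

Section InnerCoisometry.
Variables (R : realType) (d N : nat) (T : mxtuple R d N) (x : 'cV[R[i]]_N).
Variables (t : R) (b0 : R[i]).
Local Notation C := R[i].
Hypothesis b0E : b0 = clark_value x t.
Hypothesis Tc : row_contraction T.
Local Notation S := (clark_sys T x b0).
Local Notation D := (1%:M - \sum_j T j *m (T j)^t*).

Section Energy.
Variable u : nc_series R d.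
Local Notation v := (state S u).
Local Notation g := (output S u).
Local Notation energy := (state_energy S u).

(** The vector [h] of [clark_energy] along the trajectory, at which the defect of [T] is
    measured. *)
Definition ctrl_vec (w : word d) : 'cV[C]_N := v w + ((1 - b0) * (u w - cdot x (v w))) *: x.

Definition deficiency (w : word d) : R := complex.Re (cdot (ctrl_vec w) (D *m ctrl_vec w)).

Lemma deficiencyE w : (deficiency w)%:C = cdot (ctrl_vec w) (D *m ctrl_vec w).
Proof. by rewrite RRe_real // ger0_real //; exact: Tc. Qed.

Lemma deficiency_ge0 w : 0 <= deficiency w.
Proof. by rewrite -ler0c deficiencyE; exact: Tc. Qed.

Lemma energy_step w : \sum_j cnorm (v (j :: w)) ^+ 2 + n2 (g w) + deficiency w =
  cnorm (v w) ^+ 2 + n2 (u w).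
Proof.
apply: complexI; have E := clark_energy T b0E (v w) (u w); cbv zeta in E.
move: E; rewrite -/(ctrl_vec w) -deficiencyE => /eqP; rewrite eq_sym subr_eq => /eqP E.
have CD (a a' : R) : (a + a')%:C = a%:C + a'%:C :> C by rewrite rmorphD.
rewrite (CD _ (deficiency w)) (CD _ (n2 (g w))) (CD _ (n2 (u w))) rmorph_sum.
rewrite !n2E -cdot_cnorm E; congr (_ + _ + _).
by apply: eq_bigr => j _; rewrite cdot_cnorm.
Qed.

Lemma energy_levelS n : energy n.+1 + lev g n + wsum n deficiency = energy n + lev u n.
Proof.
rewrite /state_energy wsumS -wsum_exchange /lev -!wsumD; apply: eq_wsum => w.
exact: energy_step.
Qed.

Lemma energy_sum n : energy n + \sum_(0 <= i < n) lev g i +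
   \sum_(0 <= i < n) wsum i deficiency = \sum_(0 <= i < n) lev u i.
Proof.
elim: n => [|n IH].
  by rewrite !big_nil !addr0 /state_energy wsum0 /= cnorm_n2 big1 // => i _; rewrite mxE n2_0.
rewrite !big_nat_recr //= -IH; have := energy_levelS n; lra.
Qed.

Lemma energy_ge0 n : 0 <= energy n.
Proof. by apply: wsum_ge0 => w; exact: sqr_ge0. Qed.

Lemma sum_deficiency_ge0 n : 0 <= \sum_(0 <= i < n) wsum i deficiency.
Proof. by apply: sumr_ge0 => i _; apply: wsum_ge0 => w; exact: deficiency_ge0. Qed.

Lemma output_sum_le n : \sum_(0 <= i < n) lev g i <= \sum_(0 <= i < n) lev u i.
Proof.
by have := energy_sum n; have := energy_ge0 n; have := sum_deficiency_ge0 n; lra.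
Qed.

(** Undoes the rank one update: on a state, [T_j^*] is one step of the trajectory corrected by a
    multiple of [B_j]. *)
Lemma state_adj j w : (T j)^t* *m v w =
  v (j :: w) + (cdot x (v w) - u w) *: sB S j.
Proof.
rewrite [v (j :: w)]/= -mulmxA clark_mulE mulmxBr -scalemxAr [sB S j]/= !scalerA.
rewrite -scaleNr -!addrA -scalerDl -scalerDl.
have -> : - ((1 - b0) * cdot x (v w)) + (u w * (1 - b0) + (cdot x (v w) - u w) * (1 - b0)) = 0.
  by ring.
by rewrite scale0r addr0.
Qed.

Hypothesis uS : exists M : R, forall n, \sum_(0 <= i < n) lev u i <= M.

(** Weak decay of the state in the direction [y]. Such directions form a subspace that contains [x]
    and is invariant under the [T_j], hence all of [C^N] when the vectors [T^w x] span. *)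
Definition vanishing (y : 'cV[C]_N) : Prop :=
  (fun n => wsum n (fun w => n2 (cdot y (v w)))) @ \oo --> (0 : R).

Lemma vanishing_squeeze y (a : nat -> R) : a @ \oo --> (0 : R) ->
  (forall n, wsum n (fun w => n2 (cdot y (v w))) <= a n) -> vanishing y.
Proof.
move=> a0 ya; apply: (squeeze_cvgr _ (cvg_cst 0) a0).
apply: nearW => n; rewrite ya andbT; apply: wsum_ge0 => w; exact: n2_ge0.
Qed.

Lemma lev_u_cvg0 : lev u @ \oo --> (0 : R).
Proof.
have [M uM] := uS; apply: bounded_series_cvg0 uM => n; exact: lev_ge0.
Qed.

Lemma lev_g_cvg0 : lev g @ \oo --> (0 : R).
Proof.
have [M uM] := uS; apply: (@bounded_series_cvg0 _ _ M) => n; first exact: lev_ge0.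
exact: le_trans (output_sum_le n) (uM n).
Qed.

Lemma cvg0_comb (a b c : nat -> R) (l m p : R) :
  a @ \oo --> (0 : R) -> b @ \oo --> (0 : R) -> c @ \oo --> (0 : R) ->
  (fun n => l * a n + m * b n + p * c n) @ \oo --> (0 : R).
Proof.
move=> a0 b0' c0; rewrite -[X in _ --> X](_ : l * 0 + m * 0 + p * 0 = 0);
    last by rewrite !mulr0 !addr0.
by apply: cvgD; [apply: cvgD|]; apply: cvgM => //; exact: cvg_cst.
Qed.

Lemma vanishing_comb a y z : vanishing y -> vanishing z -> vanishing (a *: y + z).
Proof.
move=> y0 z0.
apply: (vanishing_squeeze (cvg0_comb (2 * n2 a) 2 0 y0 z0 z0)) => n.
rewrite mul0r addr0 -!wsum_mulr -wsumD; apply: ler_wsum => w.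
rewrite cdotDl cdotZl; apply: le_trans (n2D _ _) _.
rewrite n2M lerD2r -mulrA; suff -> : n2 (Num.conj a) = n2 a by [].
by apply: complexI; rewrite !n2E norm_conjC.
Qed.

(** The output is [c <x, v> + b0 u], and input and output are both square-summable; since [c != 0],
    the equation can be solved for [<x, v>]. *)
Lemma vanishing_x : vanishing x.
Proof.
have [c0 _] := clark_valueP b0E; set c := 1 - b0 in c0.
apply: (vanishing_squeeze (cvg0_comb (2 * n2 c^-1) (2 * n2 c^-1 * n2 b0) 0 lev_g_cvg0 lev_u_cvg0
    lev_u_cvg0)) => n.
rewrite mul0r addr0 -!wsum_mulr -wsumD; apply: ler_wsum => w.
have -> : cdot x (v w) = c^-1 * g w + (- (c^-1 * (b0 * u w))).
  rewrite /output /= -scalemxAl mxE -/(cdot x (v w)) mulrDr mulKf // addrK //.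
by apply: le_trans (n2D _ _) _; rewrite n2N !n2M !mulrA.
Qed.

(** [<T_j y, v_w> = <y, T_j^* v_w>] is the pairing of [y] with the state one degree higher, plus a
    multiple of [<x, v_w> - u_w]. The constants [2] and [4] come from applying [n2D] twice. *)
Lemma vanishing_T j y : vanishing y -> vanishing (T j *m y).
Proof.
move=> y0; pose B := n2 (cdot y (sB S j)).
have y1 : (fun n => wsum n.+1 (fun w => n2 (cdot y (v w)))) @ \oo --> (0 : R).
  by move: y0; rewrite /vanishing -cvg_shiftS.
apply: (vanishing_squeeze (cvg0_comb 2 (4 * B) (4 * B) y1 vanishing_x lev_u_cvg0)) => n.
rewrite wsumS -(wsum_exchange n (fun j w => n2 (cdot y (v (j :: w))))) -!wsum_mulr -!wsumD.
apply: ler_wsum => w.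
have -> : cdot (T j *m y) (v w) = cdot y (v (j :: w)) + (cdot x (v w) - u w) * cdot y (sB S j).
  by rewrite cdot_mull state_adj; move: (sB S j) => B'; rewrite cdotDr cdotZr.
apply: le_trans (n2D _ _) _; rewrite n2M -/B -addrA lerD //.
  rewrite ler_pM2l // (bigD1 j) //= lerDl; apply: sumr_ge0 => i _; exact: n2_ge0.
have := n2D (cdot x (v w)) (- u w); rewrite n2N => H.
have B0 : 0 <= B by exact: n2_ge0.
have := ler_wpM2l B0 H; lra.
Qed.

Lemma energy_cvg0 : (forall y, (forall w, cdot (word_act (fun j z =>
    T j *m z) w x) y = 0) -> y = 0) ->
  energy @ \oo --> (0 : R).
Proof.
move=> cyc.
have allv y : vanishing y.
  have : linspan [set word_act (fun j z => T j *m z) w x | w in [set: word d]] y.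
    by apply: linspan_full => z zP; apply: cyc => w; apply: zP; exists w.
  move: y; apply: linspan_ind => [|a z y [w _ <-] yv].
    apply: (vanishing_squeeze (cvg_cst 0)) => n.
    by rewrite /wsum big1 // => w _; rewrite cdot0l n2_0.
  apply: vanishing_comb; last exact: yv.
  by elim: w => [|j w IH] /=; [exact: vanishing_x | exact: vanishing_T].
have -> : energy = fun n => \sum_i wsum n (fun w => n2 (cdot (delta_mx i 0) (v w))).
  apply/funext => n; rewrite -wsum_exchange; apply: eq_wsum => w; rewrite cnorm_n2.
  apply: eq_bigr => i _; congr (n2 _); rewrite cdotE (bigD1 i) //= big1 ?addr0.
    by rewrite mxE !eqxx conjC1 mul1r.
  by move=> l /negPf li; rewrite mxE li /= conjC0 mul0r.
have sum0 (I : Type) (r : seq I) (f : I -> nat -> R) : (forall i, f i @ \oo --> (0 : R)) ->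
    (fun n => \sum_(i <- r) f i n) @ \oo --> (0 : R).
  move=> f0; elim: r => [|i r IH].
    by under eq_fun do rewrite big_nil; exact: cvg_cst.
  under eq_fun do rewrite big_cons.
  by have H := cvgD (f0 i) IH; rewrite addr0 in H; exact: H.
by apply: sum0 => i; exact: allv.
Qed.

End Energy.
End InnerCoisometry.

Section InnerIffCoisometry.
Variables (R : realType) (d N : nat) (T : mxtuple R d N) (x : 'cV[R[i]]_N).
Local Notation C := R[i].

Lemma hdot_lim0 (K : hilbert R) (S : set K) : closed_span S = setT ->
  forall f : K, (forall s, S s -> hdot f s = 0) -> f = 0.
Proof.
move=> Sd f fS.
have h0 : hdot f 0 = 0.
  by have := hdot_linear f (-1) 0 0; rewrite scaler0 add0r mulN1r addNr.
have fl s : linspan S s -> hdot f s = 0.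
  move: s; apply: linspan_ind => // a s y Ss fy.
  by rewrite hdot_linear fS // fy mulr0 addr0.
apply/eqP; rewrite -normr_eq0; apply/negPn/negP => f0.
have f0' : 0 < `|f| by rewrite lt_def f0 normr_ge0.
have : closed_span S f by rewrite Sd.
move=> /(_ (ball f `|f|) (nbhsx_ballx _ _ f0')) [s [ls bs]].
have := cauchy_schwarz (@hdot_linear R K) (@hdot_conj R K) _ f (f - s).
rewrite (_ : hdot f (f - s) = hdot f f); last first.
  by rewrite -scaleN1r addrC hdot_linear fl // mulr0 add0r.
rewrite !hdot_norm => /(_ _)/wrap[|H].
  by move=> z; rewrite hdot_norm exprn_ge0.
move: bs; rewrite -ball_normE /ball_ /= => bs.
have : `| `|f| ^+ 2 | ^+ 2 < `|f| ^+ 2 * `|f| ^+ 2.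
  apply: le_lt_trans H _; rewrite ltr_pM2l ?exprn_gt0 // ltr_pXn2r // nnegrE //.
by rewrite ger0_norm ?exprn_ge0 // -expr2 ltxx.
Qed.

(** Since [V_j^*] restricts to [T_j^*], pairing with [iota y] turns [V^w x] into [T^w x]. Thus a
    vector orthogonal to all [T^w x] is orthogonal to the dense orbit of [x] under [V]. *)
Lemma cyclic_min_dilation_ortho : cyclic_min_dilation T x ->
  forall y, (forall w, cdot (word_act (fun j z => T j *m z) w x) y = 0) -> y = 0.
Proof.
move=> [K [iota [V [[Viso iiso Vadj _] cyc]]]] y yx.
have key w y' : hdot (iota y') (op_word V w (iota x)) =
    cdot y' (word_act (fun j z => T j *m z) w x).
  elim: w y' => [|j w IH] y' /=; first exact: iiso.
  have [Vs adj Vsi] := Vadj j.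
  by rewrite -adj Vsi IH cdot_mull trmxCK.
have : iota y = 0.
  apply: (hdot_lim0 cyc) => _ [w _ <-]; rewrite key cdotC yx; exact: conjC0.
move=> iy; apply/eqP; rewrite -cdot_eq0 -iiso iy.
by have := hdot_linear (0 : K) (-1) 0 0; rewrite scaler0 add0r mulN1r addNr => ->.
Qed.

End InnerIffCoisometry.

(** * Inner functions and row co-isometries *)

Section InnerCriterion.
Variables (R : realType) (d : nat).
Local Notation C := R[i].

Lemma cvg_bigsum (K : numFieldType) (V : normedModType K) (I : Type) (r : seq I)
    (f : I -> nat -> V) (l : I -> V) :
  (forall i, f i @ \oo --> l i) -> (fun n => \sum_(i <- r) f i n) @ \oo --> \sum_(i <- r) l i.
Proof.
move=> fl; elim: r => [|i r IH].
  under eq_fun do rewrite big_nil; rewrite big_nil; exact: cvg_cst.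
under eq_fun do rewrite big_cons; rewrite big_cons.
exact: (cvgD (fl i) IH).
Qed.

Lemma cvg_lincomb (K : numFieldType) (I : Type) (r : seq I) (c : I -> K)
    (f : I -> nat -> K) (l : I -> K) :
  (forall i, (f i : nat -> K^o) @ \oo --> (l i : K^o)) ->
  ((fun n => \sum_(i <- r) c i * f i n) : nat -> K^o) @ \oo -->
    (\sum_(i <- r) c i * l i : K^o).
Proof.
move=> fl; apply: (@cvg_bigsum K K^o) => i.
by apply: cvgM; [exact: cvg_cst|exact: fl].
Qed.

Lemma homog_entry_cvg0 n (Z : mxtuple R d n) (f : word d -> C) (a : nat -> R) p q :
  row_ball Z -> (forall m, lev f m <= a m) -> a @ \oo --> (0 : R) ->
  ((fun m => homog Z f m p q) : nat -> C^o) @ \oo --> (0 : C^o).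
Proof.
move=> Zb fa a0; have [rho [r0 r1 Zr]] := wsum_entry_rate Zb.
have aE m : homog Z f m p q = wsum m (fun w => f w * mxword Z w p q).
  by rewrite /homog /wsum summxE; apply: eq_bigr => w _; rewrite mxE.
have b0 : (fun m => (a m + rho ^+ m) / 2) @ \oo --> (0 : R).
  have e0 : (fun m => rho ^+ m) @ \oo --> (0 : R) by apply: cvg_expr; rewrite ger0_norm.
  have H := cvgM (cvgD a0 e0) (cvg_cst (2^-1 : R)); rewrite addr0 mul0r in H; exact: H.
have bnd (g : C -> R) : {morph g : x y / x + y} -> g 0 = 0 ->
    (forall x y, `|g (x * y)| <= (n2 x + n2 y) / 2) ->
    (fun m => g (homog Z f m p q)) @ \oo --> (0 : R).
  move=> gD g0 gn.
  have le m : `|g (homog Z f m p q)| <= (a m + rho ^+ m) / 2.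
    rewrite aE /wsum (big_morph g gD g0); apply: le_trans (ler_norm_sum _ _ _) _.
    apply: (@le_trans _ _ (\sum_(w <- wlist d m) (n2 (f w) + n2 (mxword Z w p q)) / 2)).
      by apply: ler_sum => w _; exact: gn.
    by rewrite -mulr_suml big_split /= ler_pM2r ?invr_gt0 // lerD //; [exact: fa|exact: Zr].
  apply: (squeeze_cvgr _ (_ : (fun m => - ((a m + rho ^+ m) / 2)) @ \oo --> 0) b0).
    by apply: nearW => m; rewrite -ler_norml.
  by have H := cvgN b0; rewrite oppr0 in H; exact: H.
rewrite (_ : (0 : C^o) = (0 : R) +i* (0 : R)) //.
apply: cvg_complex; apply: bnd => //.
- by move=> [? ?] [? ?].
- exact: Re_mul_n2.
- by move=> [? ?] [? ?].
- exact: Im_mul_n2.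
Qed.

Section Multiplication.
Variables (k : nat) (S : sys R d k) (u : nc_series R d) (n : nat) (Z : mxtuple R d n).
Variable F : 'I_k -> 'M[C]_n.
Hypothesis FS : sol S Z F.

Let s m := \sum_(0 <= i < m) homog Z u i.
Let sg m l := \sum_(0 <= i < m) homog Z (fun w => state S u w l 0) i.
Let dl m l := sg m l - F l *m s m.

Lemma state_sumS m l : sg m.+1 l =
  \sum_j Z j *m (\sum_i sA S j l i *: sg m i + sB S j l 0 *: s m).
Proof.
elim: m => [|m IH].
  rewrite /sg big_nat1 homog_state0 /s big_nil big1 // => j _.
  by rewrite scaler0 addr0 big1 ?mulmx0 // => i _; rewrite big_nil scaler0.
rewrite {1}/sg big_nat_recr //= -/(sg m.+1 l) IH homog_stateS -big_split /=.
apply: eq_bigr => j _; rewrite -mulmxDr; congr (_ *m _).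
rewrite addrACA -scalerDr /s big_nat_recr //=; congr (_ + _).
by rewrite -big_split; apply: eq_bigr => i _; rewrite /sg big_nat_recr //= scalerDr.
Qed.

(** The truncated sums satisfy the state equation with a delay of one degree. Their mismatch with
    [F l *m s m] is therefore driven by the homogeneous part of degree [m] alone, which decays with
    the state energy. *)
Lemma state_error m : pencil S Z *m vcol (dl m) =
  - vcol (fun l => homog Z (fun w => state S u w l 0) m).
Proof.
rewrite /pencil mulmxBl mul1mx pencil_part_vcol; apply/eqP.
rewrite subr_eq addrC -subr_eq opprK; apply/eqP; rewrite vcolD; apply: eq_vcol => l.
have sE : sg m l + homog Z (fun w => state S u w l 0) m = sg m.+1 l.
  by rewrite /sg big_nat_recr.
rewrite /dl addrAC sE state_sumS [F l]FS mulmx_suml -sumrB.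
apply: eq_bigr => j _; rewrite -mulmxA -mulmxBr; congr (_ *m _).
rewrite mulmxDl mul_scalar_mx opprD addrACA subrr addr0 mulmx_suml -sumrB.
by apply: eq_bigr => i _; rewrite scalerBr -scalemxAl.
Qed.

Lemma output_sum m : \sum_(0 <= i < m) homog Z (output S u) i =
  out S F *m s m + \sum_l sC S 0 l *: dl m l.
Proof.
under eq_bigr do rewrite homog_output.
rewrite big_split /= exchange_big /=.
under eq_bigr => l _ do rewrite -scaler_sumr -/(sg m l).
rewrite -scaler_sumr -/(s m) /out /rout mulmxDl mul_scalar_mx mulmx_suml addrC -addrA.
congr (_ + _); rewrite -big_split; apply: eq_bigr => l _ /=.
by rewrite -scalemxAl -scalerDr /dl addrC subrK.
Qed.

Lemma h2_eval_output M : row_ball Z -> pencil S Z \in unitmx ->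
  (forall m, \sum_(0 <= i < m) lev u i <= M) -> state_energy S u @ \oo --> (0 : R) ->
  h2_eval (output S u) Z = out S F *m h2_eval u Z.
Proof.
move=> Zb uP uM e0; have [rho [r0 r1 Zr]] := wsum_entry_rate Zb.
have /choice [L LP] : forall pq : 'I_n * 'I_n, exists l : C,
    ((fun m => s m pq.1 pq.2) : nat -> C^o) @ \oo --> (l : C^o).
  by move=> [p q]; exact: (homog_entry_cvg r0 r1 (fun m => Zr m p q) uM).
have -> : h2_eval u Z = \matrix_(p, q) L (p, q).
  rewrite h2_evalE; apply: mx_lim => p q; rewrite mxE; exact: (LP (p, q)).
have V0 p q : ((fun m => vcol (fun l => homog Z (fun w =>
    state S u w l 0) m) p q) : nat -> C^o) @ \oo --> (0 : C^o).
  case: (mxtens_indexP p) => i l; case: (mxtens_indexP q) => j z.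
  under eq_fun do rewrite vcolE.
  apply: homog_entry_cvg0 Zb _ e0 => m; apply: ler_wsum => w; rewrite cnorm_n2.
  by rewrite (bigD1 l) //= lerDl; apply: sumr_ge0 => h _; exact: n2_ge0.
have D0 l p q : ((fun m => dl m l p q) : nat -> C^o) @ \oo --> (0 : C^o).
  have E m : dl m l p q = \sum_a (- invmx (pencil S Z) (mxtens_index (p, l)) a) *
      vcol (fun l => homog Z (fun w => state S u w l 0) m) a (mxtens_index (q, ord0)).
    rewrite -(vcolE (dl m) p l q ord0) -[vcol (dl m)](mulKmx uP) state_error mxE.
    by apply: eq_bigr => a _; rewrite [(- vcol _) _ _]mxE mulrN mulNr.
  under eq_fun do rewrite E.
  pose f a m := vcol (fun l => homog Z (fun w => state S u w l 0) m) a (mxtens_index (q, ord0)).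
  have H := @cvg_lincomb C _ (index_enum _)
    (fun a => - invmx (pencil S Z) (mxtens_index (p, l)) a) f (fun=> 0)
    (fun a => V0 a (mxtens_index (q, ord0))).
  have H0 : \sum_a - invmx (pencil S Z) (mxtens_index (p, l)) a * 0 = 0.
    by rewrite big1 // => a _; rewrite mulr0.
  rewrite H0 in H; exact: H.
rewrite h2_evalE; apply: mx_lim => p q.
have -> : (fun m => (\sum_(0 <= i < m) homog Z (output S u) i) p q) =
    (fun m => \sum_a out S F p a * s m a q + \sum_l sC S 0 l * dl m l p q).
  apply/funext => m; rewrite output_sum mxE [X in _ + X]summxE; congr (_ + _).
    by rewrite mxE.
  by apply: eq_bigr => l _; rewrite mxE.
have -> : (out S F *m \matrix_(p, q) L (p, q)) p q = \sum_a out S F p a * L (a, q).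
  by rewrite mxE; apply: eq_bigr => a _; rewrite [X in _ * X]mxE.
have H1 := @cvg_lincomb C _ (index_enum _) (fun a => out S F p a) (fun a m => s m a q)
  (fun a => L (a, q)) (fun a => LP (a, q)).
have H2 := @cvg_lincomb C _ (index_enum _) (fun l => sC S 0 l) (fun l m => dl m l p q)
  (fun=> 0) (fun l => D0 l p q).
have H0 : \sum_l sC S 0 l * 0 = 0 by rewrite big1 // => l _; rewrite mulr0.
rewrite H0 in H2; have H := cvgD H1 H2; rewrite addr0 in H.
exact: H.
Qed.

End Multiplication.

Lemma coisometry_inner (b : nc_ratfun R d) N (T : mxtuple R d N) (x : 'cV[C]_N) t :
  clark_realization b T x t -> row_coisometry T -> inner b.
Proof.
move=> cr Tco; have bS := clark_realized cr; have [bh _] := clark_ball cr.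
case: cr => Tc cyc cV b0E _; split=> // u uh2.
have Sc := clark_contractive b0E Tc.
set S := clark_sys T x (nc_at0 b) in bS Sc.
have [M uE uM] := in_h2_bound uh2.
have e0 : state_energy S u @ \oo --> (0 : R).
  apply: (energy_cvg0 b0E Tc) => //; first by exists M.
  exact: cyclic_min_dilation_ortho.
have gle : (h2_sqnorm (output S u) <= M%:E)%E.
  apply: h2_sqnorm_le => n; apply: le_trans (uM n); exact: (output_sum_le b0E Tc).
have gh : in_h2 (output S u) by apply: le_lt_trans gle _; rewrite ltry.
exists (output S u); split => //.
  have [G GE GM] := in_h2_bound gh.
  rewrite uE GE; congr (_%:E); apply/eqP; rewrite eq_le.
  rewrite -2!lee_fin -{1}GE gle /= -uE; apply: h2_sqnorm_le => n.
  (* With zero defect, the energy balance up to a late degree [m] loses only the state energy, which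
     is below [e]. *)
  apply/ler_addgt0Pr => e e_gt0; near \oo => m.
  have nm : (n <= m)%N by near: m; exact: nbhs_infty_ge.
  have em : state_energy S u m < e.
    have : `|0 - state_energy S u m| < e by near: m; move/cvgrPdist_lt: e0; apply.
    by rewrite sub0r normrN ger0_norm // energy_ge0.
  have := energy_sum b0E Tc u m; rewrite [X in _ + X = _]big1 ?addr0 => [E|i _]; last first.
    rewrite /wsum big1 // => w _; rewrite /deficiency Tco subrr mul0mx cdot0r //.
  apply: (@le_trans _ _ (\sum_(0 <= i < m) lev u i)).
    rewrite (big_cat_nat _ nm) //= lerDl; apply: sumr_ge0 => i _; exact: lev_ge0.
  by rewrite -E addrC lerD ?GM // ltW.
move=> n Z Zb.
have [F FS ->] := realized_row_ball bS Sc Zb.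
apply: (h2_eval_output FS Zb _ uM e0).
exact: accretive_pencil (contractive_accretive Sc Zb).
Unshelve. all: by end_near. Qed.

Lemma wd_rcons n (q : 'I_#|{: n.-bseq 'I_d}|) :
  wd q = [::] \/ exists s i, wd q = rcons s i.
Proof. by case/lastP: (wd q) => [|s i]; [left|right; exists s, i]. Qed.

Lemma shift_word0 n (r : C) w q : mxword (shift n r : mxtuple R d _) w q (wi n [::]) =
     (wd q == rev w)%:R * r ^+ size w.
Proof.
elim: w q => [|j w IH] q /=.
  by rewrite mxE -(inj_eq (@wd_inj d n)) wiK // mulr1.
case: (wd_rcons q) => [E|[s [i E]]].
  by rewrite shift_mul E rev_cons; case: (rev w) => [|? ?]; rewrite mul0r.
have sn : (size s <= n)%N by have := size_wd q; rewrite E size_rcons; exact: ltnW.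
rewrite (shift_mul_rcons _ _ _ _ E) IH ?wiK // E rev_cons eqseq_rcons exprS.
by case: (s == rev w); case: (i == j); rewrite ?mul0r ?mulr0 ?mul1r.
Qed.

Lemma homog_shift (f : word d -> C) n r p m :
  homog (shift n r) f m p (wi n [::]) =
  if size (wd p) == m then f (rev (wd p)) * r ^+ m else 0.
Proof.
rewrite /homog /wsum summxE; under eq_bigr => w _ do rewrite mxE shift_word0.
case: ifP => [/eqP sm|sm].
  rewrite (bigD1_seq (rev (wd p))) ?uniq_wlist ?mem_wlist ?size_rev ?sm //=.
  rewrite revK eqxx mul1r big1_seq ?addr0 // => w /andP[wp _].
  case: eqP => [E|_]; last by rewrite mul0r mulr0.
  by rewrite E revK eqxx in wp.
rewrite big1_seq // => w /andP[_]; rewrite mem_wlist => /eqP wm.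
case: eqP => [E|_]; last by rewrite mul0r mulr0.
by move: sm; rewrite E size_rev wm eqxx.
Qed.

Lemma shift_word_eq0 n (r : C) w q a : (size (wd q) < size w)%N ->
  mxword (shift n r : mxtuple R d _) w q a = 0.
Proof.
elim: w q => [//|j w IH] q /= qw; case: (wd_rcons q) => [E|[s [i E]]].
  by rewrite shift_mul E.
have sn : (size s <= n)%N by have := size_wd q; rewrite E size_rcons; exact: ltnW.
rewrite (shift_mul_rcons _ _ _ _ E) IH ?wiK ?mulr0 //.
by move: qw; rewrite E size_rcons.
Qed.

(** At a shift the series is a finite sum whose column at the empty word lists the weighted
    coefficients of [f]. Values on the row ball therefore determine a power series. *)
Lemma h2_eval_shift (f : nc_series R d) n (r : C) p :
  h2_eval f (shift n r) p (wi n [::]) = f (rev (wd p)) * r ^+ size (wd p).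
Proof.
have stop m : (n < m)%N -> homog (shift n r) f m = 0.
  move=> nm; rewrite /homog /wsum big1_seq // => w /andP[_]; rewrite mem_wlist => /eqP wm.
  apply/matrixP => q a; rewrite [LHS]mxE [RHS]mxE shift_word_eq0 ?mulr0 // wm.
  exact: leq_ltn_trans (size_wd q) nm.
have -> : h2_eval f (shift n r) = \sum_(0 <= i < n.+1) homog (shift n r) f i.
  rewrite h2_evalE; apply: mx_lim => q a; apply: cvg_near_cst.
  exists n.+1 => // m /= nm; rewrite (big_cat_nat _ nm) //=.
  have -> : \sum_(n.+1 <= i < m) homog (shift n r) f i = 0.
    by rewrite big_nat_cond big1 // => i /andP[/andP[ni _] _]; exact: stop.
  by rewrite addr0.
rewrite summxE (bigD1_seq (size (wd p))) ?iota_uniq ?mem_index_iota ?ltnS ?size_wd //=.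
rewrite homog_shift eqxx big1 ?addr0 // => i ip.
by rewrite homog_shift eq_sym (negPf ip).
Qed.

Definition vacuum (w : word d) : C := (w == [::])%:R.

Lemma lev_vacuum n : lev vacuum n = (n == 0)%:R.
Proof.
case: n => [|n]; first by rewrite /lev wsum0 /vacuum eqxx n2_1.
by rewrite /lev wsumS big1 // => j _; rewrite /wsum big1 // => w _; rewrite n2_0.
Qed.

Lemma sum_lev_vacuum n : \sum_(0 <= i < n) lev vacuum i = (n != 0)%:R.
Proof.
case: n => [|n]; first by rewrite big_nil.
by rewrite big_nat_recl // lev_vacuum big1 ?addr0 // => i _; rewrite lev_vacuum.
Qed.

Lemma h2_eval_vacuum n (Z : mxtuple R d n) : h2_eval vacuum Z = 1%:M.
Proof.
have stop m : (0 < m)%N -> homog Z vacuum m = 0.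
  case: m => // m _; rewrite /homog wsumS big1 // => j _; rewrite /wsum big1 // => w _.
  exact: scale0r.
rewrite h2_evalE; apply: mx_lim => q a; apply: cvg_near_cst.
exists 1%N => // m /= m1; rewrite (big_cat_nat _ m1) //= big_nat1.
have -> : \sum_(1 <= i < m) homog Z vacuum i = 0.
  by rewrite big_nat_cond big1 // => i /andP[/andP[ni _] _]; exact: stop.
by rewrite addr0 /homog wsum0 scale1r.
Qed.

Lemma output_vacuum k (S : sys R d k) w : output S vacuum w = tay S (rev w).
Proof.
have sE : state S vacuum w = nu S (rev w).
  elim: w => [//|j w IH]; rewrite [LHS]/= IH rev_cons nu_rcons /vacuum.
  by rewrite -[rev w == _]size_eq0 size_rev size_eq0.
rewrite /output sE; case: w {sE} => [|j w]; first by rewrite mulmx0 mxE add0r mulr1.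
by rewrite /vacuum mulr0 addr0 rev_cons /tay; case: (rev w).
Qed.

Lemma inner_coisometry (b : nc_ratfun R d) N (T : mxtuple R d N) (x : 'cV[C]_N) t :
  clark_realization b T x t -> inner b -> row_coisometry T.
Proof.
move=> cr [bh isom]; have bS := clark_realized cr.
case: cr => Tc cyc cV b0E _.
have Sc := clark_contractive b0E Tc.
have [c0 _] := clark_valueP b0E.
set b0 := nc_at0 b in b0E bS Sc c0; set S := clark_sys T x b0 in bS Sc.
have vle : (h2_sqnorm vacuum <= 1%:E)%E.
  by apply: h2_sqnorm_le => n; rewrite sum_lev_vacuum; case: (n != 0)%N.
have vh : in_h2 vacuum by apply: le_lt_trans vle _; rewrite ltry.
have [g [gh gE gev]] := isom _ vh.
have g1 : (1%:E <= h2_sqnorm g)%E.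
  by rewrite gE; have := h2_sqnorm_ge vacuum 1; rewrite sum_lev_vacuum.
(* [g] is known only through its values on the row ball; the shift with [r = 1/2] recovers its
   coefficients. *)
have gS : g = output S vacuum.
  apply/funext => w; rewrite output_vacuum; pose n := size w; pose r : C := 2^-1.
  have r0 : 0 <= r by rewrite invr_ge0.
  have r1 : r < 1 by rewrite invf_lt1 // ltr1n.
  have Zb := @shift_row_ball R d n r r0 r1.
  have [F FS FE] := realized_row_ball bS Sc Zb.
  have := gev _ _ Zb; rewrite h2_eval_vacuum mulmx1 FE => /matrixP/(_ (wi n (rev w)) (wi n [::])).
  rewrite h2_eval_shift (out_shift FS) !wiK ?size_rev // toep_nil revK size_rev mulrC.
  by apply: mulfI; rewrite expf_neq0 // invr_eq0 pnatr_eq0.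
(* The input has norm [1] and so has [g]; a positive deficiency anywhere would make the balance fall
   short of [1]. *)
have def0 w : deficiency T x b0 vacuum w = 0.
  apply/eqP; rewrite eq_le (deficiency_ge0 x b0 Tc vacuum w) andbT.
  have h2 : (h2_sqnorm g <= (1 - deficiency T x b0 vacuum w)%:E)%E.
    apply: h2_sqnorm_le => n; rewrite gS.
    apply: (@le_trans _ _ (\sum_(0 <= i < maxn n (size w).+1) lev (output S vacuum) i)).
      rewrite [leRHS](big_cat_nat _ (leq_maxl n (size w).+1)) //= lerDl.
      by apply: sumr_ge0 => i _; exact: lev_ge0.
    have := energy_sum b0E Tc vacuum (maxn n (size w).+1).
    rewrite sum_lev_vacuum (_ : maxn _ _ != 0%N); last by rewrite -lt0n leq_max orbT.
    have e0 := energy_ge0 T x b0 vacuum (maxn n (size w).+1).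
    have : deficiency T x b0 vacuum w <= \sum_(0 <= i < maxn n (size w).+1) wsum i (deficiency T x
        b0 vacuum).
      rewrite (bigD1_seq (size w)) ?iota_uniq ?mem_index_iota ?leq_max ?leqnn ?orbT //=.
      apply: le_trans (wsum_term_le w (deficiency_ge0 x b0 Tc vacuum)) _.
      by rewrite lerDl; apply: sumr_ge0 => i _; apply: wsum_ge0 => w'; exact: deficiency_ge0.
    rewrite -/S in e0 * => dle /=; lra.
  have := le_trans g1 h2; rewrite lee_fin; lra.
pose D := 1%:M - \sum_j T j *m (T j)^t*.
have Dh w : D *m ctrl_vec T x b0 vacuum w = 0.
  have := deficiencyE x b0 Tc vacuum w; rewrite def0 -/D => E.
  have := defect_cauchy_schwarz (D *m ctrl_vec T x b0 vacuum w) (ctrl_vec T x b0 vacuum w) Tc.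
  rewrite -/D -E mulr0 => H.
  apply/eqP; rewrite -cdot_eq0 -normr_eq0 -[_ == 0]andTb -(expf_eq0 _ 2).
  by rewrite eq_le H exprn_ge0.
(* At the empty word [ctrl_vec] is [(1 - b0) *: x], with a nonzero factor. *)
have Dx : D *m x = 0.
  have := Dh [::]; rewrite /ctrl_vec /= cdot0r subr0 mulr1 add0r -scalemxAr => /eqP.
  by rewrite scaler_eq0 (negPf c0) /= => /eqP.
have Dv w : D *m state S vacuum w = 0.
  by have := Dh w; rewrite /ctrl_vec mulmxDr -scalemxAr Dx scaler0 addr0.
have Bv j : sB S j = state S vacuum [:: j].
  by rewrite [RHS]/= mulmx0 add0r /vacuum eqxx scale1r.
(* By [state_adj] the span of [x] and all states is invariant under the [T_j^*], so it contains the
   orbit of [x], while [D] annihilates it. *)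
have Dw w : D *m mxadj_word T w x = 0.
  suff : linspan ([set x] `|` range (state S vacuum)) (mxadj_word T w x).
    move: (mxadj_word T w x); apply: linspan_ind; first exact: mulmx0.
    move=> a y z yS Dz; rewrite mulmxDr -scalemxAr Dz addr0.
    by case: yS => [->|[w' _ <-]]; rewrite ?Dx ?Dv scaler0.
  elim: w => [|j w IH]; first by apply: linspan_mem; left.
  rewrite mxadj_word_cons; move: (mxadj_word T w x) IH.
  pose f : {linear 'cV[C]_N -> 'cV[C]_N} := mulmx ((T j)^t*).
  have Hf y : ([set x] `|` range (state S vacuum)) y ->
      linspan ([set x] `|` range (state S vacuum)) (f y).
    case=> [->|[w' _ <-]].
      have -> : f x = (1 - b0)^-1 *: state S vacuum [:: j].
        by rewrite -Bv /= scalerA mulVf // scale1r.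
      by apply: linspanZ; apply: linspan_mem; right; exists [:: j].
    have -> : f (state S vacuum w') = (cdot x (state S vacuum w') -
        vacuum w') *: state S vacuum [:: j] + state S vacuum (j :: w').
      by rewrite -Bv addrC; exact: (state_adj T x b0 vacuum j w').
    by apply: linspan_cons; [right; exists [:: j]|apply: linspan_mem; right; exists (j :: w')].
  exact: (linspan_linear Hf).
have Dy (y : 'cV[C]_N) : D *m y = 0.
  have : linspan [set mxadj_word T w x | w in [set: word d]] y by rewrite cyc.
  move: y; apply: linspan_ind; first exact: mulmx0.
  by move=> a y z [w _ <-] Dz; rewrite mulmxDr -scalemxAr Dz addr0 Dw scaler0.
have : D = 0.
  apply/matrixP => i j; have /matrixP/(_ i 0) := Dy (delta_mx j 0).
  by rewrite -colE !mxE.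
by move/eqP; rewrite subr_eq0 => /eqP.
Qed.

End InnerCriterion.

(** * Square-summable sequences and the GNS construction *)

Lemma form_triangle (F : numClosedFieldType) (V : lmodType F) (q : V -> V -> F) (nrm : V -> F) :
  (forall x a y z, q x (a *: y + z) = a * q x y + q x z) ->
  (forall x y, q y x = Num.conj (q x y)) ->
  (forall x, 0 <= nrm x) -> (forall x, q x x = nrm x ^+ 2) ->
  forall x y, nrm (x + y) <= nrm x + nrm y.
Proof.
move=> ql qc n0 nE x y.
have q0 z : 0 <= q z z by rewrite nE exprn_ge0.
have qD x' y' z' : q x' (y' + z') = q x' y' + q x' z'.
  by rewrite -[y']scale1r ql mul1r scale1r.
have qDl x' y' z' : q (x' + y') z' = q x' z' + q y' z'.
  by rewrite qc qD rmorphD /= -!qc.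
rewrite -(@ler_pXn2r _ 2) ?nnegrE ?addr_ge0 // -nE qD !qDl [q y x]qc.
have xy : `|q x y| <= nrm x * nrm y.
  rewrite -(@ler_pXn2r _ 2) ?nnegrE ?mulr_ge0 // exprMn -!nE.
  exact: cauchy_schwarz.
have re : q x y + Num.conj (q x y) <= (nrm x * nrm y) *+ 2.
  apply: le_trans (real_ler_norm _) _.
    by apply/CrealP; rewrite rmorphD /= conjCK addrC.
  apply: le_trans (ler_normD _ _) _.
  by rewrite norm_conjC mulr2n lerD.
have -> : q x x + Num.conj (q x y) + (q x y + q y y) =
    q x x + q y y + (q x y + Num.conj (q x y)) by ring.
have -> : (nrm x + nrm y) ^+ 2 = q x x + q y y + (nrm x * nrm y) *+ 2 by rewrite !nE; ring.
by rewrite lerD2l.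
Qed.

Lemma conj_mulC (F : numClosedFieldType) (x y : F) :
  Num.conj x * y = Num.conj (Num.conj y * x).
Proof. by rewrite rmorphM /= conjCK mulrC. Qed.

Lemma conj_mul_norm (F : numClosedFieldType) (x y : F) :
  x * Num.conj (x * y) = `|x| ^+ 2 * Num.conj y.
Proof. by rewrite rmorphM /= mulrA -normCK. Qed.

Section Ell2.
Variable R : realType.
Local Notation C := R[i].

Definition sqsummable (f : nat -> C) : Prop :=
  exists M : R, forall n, \sum_(0 <= k < n) n2 (f k) <= M.

Definition ipn (f g : nat -> C) (n : nat) : C^o := \sum_(0 <= k < n) Num.conj (f k) * g k.

Definition ip (f g : nat -> C) : C := lim (ipn f g @ \oo).

Definition sqn (f : nat -> C) : R := limn (series (fun k => n2 (f k))).

Lemma n2_conj (z : C) : n2 (Num.conj z) = n2 z.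
Proof. by apply: complexI; rewrite !n2E norm_conjC. Qed.

Lemma sqsummable_sum f g a : sqsummable f -> sqsummable g -> sqsummable (a \*: f + g).
Proof.
move=> [M fM] [N gN]; exists (2 * (n2 a * M) + 2 * N) => n.
apply: (@le_trans _ _ (\sum_(0 <= k < n) (2 * (n2 a * n2 (f k)) + 2 * n2 (g k)))).
  by apply: ler_sum => k _; rewrite -n2M; exact: n2D.
rewrite big_split /= -!mulr_sumr lerD // ler_pM2l //.
by rewrite ler_wpM2l ?n2_ge0.
Qed.

Lemma sqsum_cvg f : sqsummable f -> (fun n => \sum_(0 <= k < n) n2 (f k)) @ \oo --> sqn f.
Proof. by move=> [M fM]; apply: (bounded_series_cvg _ fM) => k; exact: n2_ge0. Qed.

Lemma sqn_ge f n : sqsummable f -> \sum_(0 <= k < n) n2 (f k) <= sqn f.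
Proof.
move=> fs; apply: (nondecreasing_cvgn_le _ (sqsum_cvg fs) n).
by apply/nondecreasing_seqP => k; rewrite big_nat_recr //= lerDl n2_ge0.
Qed.

Lemma sqn_le f M : (forall n, \sum_(0 <= k < n) n2 (f k) <= M) -> sqn f <= M.
Proof.
move=> fM; have fs : sqsummable f by exists M.
by apply: limr_le; [exact: sqsum_cvg|apply: nearW => n; exact: fM].
Qed.

Lemma ip_cvg f g : sqsummable f -> sqsummable g -> ipn f g @ \oo --> (ip f g : C^o).
Proof.
move=> fs gs.
have cM : cvgn (series (fun k => (n2 (f k) + n2 (g k)) / 2)).
  have -> : (fun k => (n2 (f k) + n2 (g k)) / 2) = (fun k => 2^-1 *: (n2 (f k) + n2 (g k))).
    by apply/funext => k; rewrite /GRing.scale /= mulrC.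
  apply: is_cvg_seriesZ; apply: is_cvg_seriesD; apply/cvg_ex.
    by exists (sqn f); exact: sqsum_cvg.
  by exists (sqn g); exact: sqsum_cvg.
have re k : `|complex.Re (Num.conj (f k) * g k)| <= (n2 (f k) + n2 (g k)) / 2.
  by rewrite -(n2_conj (f k)); exact: Re_mul_n2.
have im k : `|complex.Im (Num.conj (f k) * g k)| <= (n2 (f k) + n2 (g k)) / 2.
  by rewrite -(n2_conj (f k)); exact: Im_mul_n2.
have [l lP] := complex_series_cvg re im cM.
by rewrite /ip (cvg_lim (@norm_hausdorff _ C^o) lP).
Qed.

Lemma ip_unique f g (l : C) : ipn f g @ \oo --> (l : C^o) -> ip f g = l.
Proof. exact: (cvg_lim (@norm_hausdorff _ C^o)). Qed.

Lemma ip_self f : sqsummable f -> ip f f = (sqn f)%:C.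
Proof.
move=> fs; apply: ip_unique.
have -> : ipn f f = (fun n => (\sum_(0 <= k < n) n2 (f k))%:C).
  apply/funext => n; rewrite rmorph_sum; apply: eq_bigr => k _.
  by rewrite mulrC -normCK -n2E.
by apply: (@cvg_complex R _ (sqn f) 0) => /=; [exact: sqsum_cvg|exact: cvg_cst].
Qed.

Lemma ip_linear f g h a : sqsummable f -> sqsummable g -> sqsummable h ->
  ip f (a \*: g + h) = a * ip f g + ip f h.
Proof.
move=> fs gs hs; apply: ip_unique.
have H := cvgD (cvgM (cvg_cst (a : C^o)) (ip_cvg fs gs)) (ip_cvg fs hs).
have -> : ipn f (a \*: g + h) = (fun n => a * ipn f g n + ipn f h n).
  apply/funext => n; rewrite /ipn mulr_sumr -big_split; apply: eq_bigr => k _ /=.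
  by rewrite [X in _ * X = _](_ : _ = a * g k + h k) // mulrDr mulrCA.
exact: H.
Qed.

Lemma ip_conj f g : sqsummable f -> sqsummable g -> ip g f = Num.conj (ip f g).
Proof.
move=> fs gs; apply: ip_unique.
have -> : ipn g f = (fun n => Num.conj (ipn f g n : C)).
  apply/funext => n; rewrite /ipn rmorph_sum; apply: eq_bigr => k _.
  exact: conj_mulC.
apply/cvgrPdist_lt => e e0; near=> n.
have : `|ip f g - ipn f g n| < e by near: n; move/cvgrPdist_lt: (ip_cvg fs gs); apply.
by rewrite -[X in X < _]norm_conjC rmorphB.
Unshelve. all: by end_near. Qed.

Variable S : pred nat.

(** Support is confined to [S] because Gram-Schmidt produces null vectors for dependent data; those
    coordinates must be absent for the embedding to have dense range. *)
Definition ell2_pred : {pred (nat -> C)} :=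
  fun f => `[< (forall n, ~~ S n -> f n = 0) /\ sqsummable f >].

Lemma ell2_submod : submod_closed ell2_pred.
Proof.
split.
  apply/asboolP; split=> //; exists 0 => n; rewrite big1 // => k _; exact: n2_0.
move=> a f g /asboolP [f0 fs] /asboolP [g0 gs]; apply/asboolP; split.
  by move=> n nS; rewrite [LHS](_ : _ = a * f n + g n) // f0 // g0 // mulr0 addr0.
exact: (sqsummable_sum a fs gs).
Qed.

HB.instance Definition _ := GRing.isSubmodClosed.Build C (nat -> C) ell2_pred ell2_submod.

Record ell2 := Ell2 { ell2_val :> nat -> C; ell2_valP : ell2_val \in ell2_pred }.

HB.instance Definition _ := [isSub for ell2_val].
HB.instance Definition _ := [Choice of ell2 by <:].
HB.instance Definition _ := [SubChoice_isSubLmodule of ell2 by <:].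

Lemma ell2_summable (f : ell2) : sqsummable f.
Proof. by have /asboolP[_ ?] := ell2_valP f. Qed.

Lemma ell2_off (f : ell2) n : ~~ S n -> f n = 0.
Proof. by have /asboolP[+ _] := ell2_valP f; exact. Qed.

Lemma ell2E a (f g : ell2) : (a *: f + g : ell2) = a \*: (f : nat -> C) + g :> (nat -> C).
Proof. by []. Qed.

Definition ell2_norm (f : ell2) : C := (Num.sqrt (sqn f))%:C.

Lemma sqn_ge0 (f : ell2) : 0 <= sqn f.
Proof. by have := sqn_ge 0 (ell2_summable f); rewrite big_nil. Qed.

Lemma ell2_norm_ge0 f : 0 <= ell2_norm f.
Proof. by rewrite lecR sqrtr_ge0. Qed.

Lemma ell2_norm_ip (f : ell2) : ip f f = ell2_norm f ^+ 2.
Proof. by rewrite (ip_self (ell2_summable f)) -rmorphXn sqr_sqrtr ?sqn_ge0. Qed.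

Lemma ell2_ip_linear (f : ell2) a (g h : ell2) : ip f (a *: g + h) = a * ip f g + ip f h.
Proof. by rewrite ell2E; apply: ip_linear; exact: ell2_summable. Qed.

Lemma ell2_ip_conj (f g : ell2) : ip g f = Num.conj (ip f g).
Proof. by apply: ip_conj; exact: ell2_summable. Qed.

Lemma ell2_normD f g : ell2_norm (f + g) <= ell2_norm f + ell2_norm g.
Proof.
exact: (@form_triangle _ ell2 (fun f g : ell2 => ip f g) ell2_norm ell2_ip_linear ell2_ip_conj
  ell2_norm_ge0 ell2_norm_ip).
Qed.

Lemma ell2_normZ a f : ell2_norm (a *: f) = `|a| * ell2_norm f.
Proof.
apply: (@pexpIrn _ 2); rewrite ?nnegrE ?mulr_ge0 ?ell2_norm_ge0 // exprMn -!ell2_norm_ip.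
have ip0 (h : ell2) : ip h (0 : ell2) = 0.
  by have := ell2_ip_linear h (-1) 0 0; rewrite scaler0 add0r mulN1r addNr.
have ipZ (h h' : ell2) : ip h (a *: h' : ell2) = a * ip h h'.
  by have := ell2_ip_linear h a h' 0; rewrite addr0 ip0 addr0.
rewrite ipZ (ell2_ip_conj f (a *: f)) ipZ conj_mul_norm.
by congr (_ * _); rewrite -(ell2_ip_conj f f).
Qed.

Lemma ell2_coord_le (f : ell2) n : n2 (f n) <= sqn f.
Proof.
apply: le_trans (sqn_ge n.+1 (ell2_summable f)).
by rewrite big_nat_recr //= lerDr; apply: sumr_ge0 => k _; exact: n2_ge0.
Qed.

Lemma ell2_norm0 (f : ell2) : ell2_norm f = 0 -> f = 0.
Proof.
move=> /(congr1 (fun z => z ^+ 2)); rewrite -ell2_norm_ip (ip_self (ell2_summable f)) expr0n /=.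
move=> /complexI f0; apply: val_inj; apply/funext => n; apply: n2_eq0.
by apply/eqP; rewrite eq_le n2_ge0 andbT -f0 ell2_coord_le.
Qed.

HB.instance Definition _ := Lmodule_isNormed.Build C ell2 ell2_normD ell2_normZ ell2_norm0.

Lemma ell2_normE (f : ell2) : `|f| = (Num.sqrt (sqn f))%:C.
Proof. by []. Qed.

Lemma ell2_norm_lt (f : ell2) (e : R) : 0 < e -> (`|f| < e%:C) = (sqn f < e ^+ 2).
Proof.
move=> e0; rewrite ell2_normE ltcR -[in LHS](ger0_norm (ltW e0)) -sqrtr_sqr.
by rewrite ltr_sqrt // exprn_gt0.
Qed.

Lemma ReB (x y : C) : complex.Re (x - y) = complex.Re x - complex.Re y.
Proof. by case: x y => ? ? []. Qed.

Lemma ImB (x y : C) : complex.Im (x - y) = complex.Im x - complex.Im y.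
Proof. by case: x y => ? ? []. Qed.

Lemma Re_n2 (z : C) (e : R) : 0 < e -> n2 z < e ^+ 2 -> `|complex.Re z| < e.
Proof.
move=> e0 ze; rewrite -(@ltr_pXn2r _ 2) ?nnegrE ?(ltW e0) // real_normK ?num_real //.
by apply: le_lt_trans ze; rewrite lerDl sqr_ge0.
Qed.

Lemma Im_n2 (z : C) (e : R) : 0 < e -> n2 z < e ^+ 2 -> `|complex.Im z| < e.
Proof.
move=> e0 ze; rewrite -(@ltr_pXn2r _ 2) ?nnegrE ?(ltW e0) // real_normK ?num_real //.
by apply: le_lt_trans ze; rewrite lerDr sqr_ge0.
Qed.

Lemma n2_cvg (s : nat -> C) (z : C) : (fun n => complex.Re (s n)) @ \oo --> complex.Re z ->
  (fun n => complex.Im (s n)) @ \oo --> complex.Im z -> (fun n => n2 (s n)) @ \oo --> n2 z.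
Proof.
move=> sr si; have H := cvgD (cvgM sr sr) (cvgM si si).
by rewrite /n2 !expr2; under eq_fun do rewrite !expr2; exact: H.
Qed.

Lemma limr_le_near (u : nat -> R) (l M : R) : u @ \oo --> l ->
  (\forall n \near \oo, u n <= M) -> l <= M.
Proof. by move=> ul uM; rewrite -(cvg_lim _ ul) //; apply: limr_le => //; apply/cvg_ex;
    exists l. Qed.

(** Centres [s n] of small sets of the filter have convergent coordinates. Bounds on finite partial
    sums pass to the coordinatewise limit and then to the full norm. *)
Lemma ell2_complete (F : set_system ell2) : ProperFilter F -> cauchy F -> cvg F.
Proof.
move=> FF /cauchyP Fc.
pose e n : R := n.+1%:R^-1.
have e_gt0 n : 0 < e n by rewrite invr_gt0.
have e_le m n : (n <= m)%N -> e m <= e n by move=> nm; rewrite lef_pV2 ?posrE // ler_nat ltnS.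
have /choice [s sF] : forall n, exists x, F (ball x (e n)%:C).
  by move=> n; apply: Fc; rewrite ltcR.
have pick (r : R) : 0 < r -> exists n, 3 * e n < r.
  move=> r0; have r3 : 0 < r / 3 by rewrite divr_gt0.
  have [n _ /(_ n (leqnn n)) H] := near_infty_natSinv_lt (PosNum r3).
  by exists n; rewrite mulrC -ltr_pdivlMr.
have sC m n : (n <= m)%N -> `|s m - s n| < (2 * e n)%:C.
  move=> nm; have [y [ym yn]] := filter_ex (filterI (sF m) (sF n)).
  move: ym yn; rewrite -!ball_normE /ball_ /= => ym yn.
  have -> : s m - s n = (s m - y) - (s n - y) by rewrite opprB addrA subrK.
  apply: le_lt_trans (ler_normB _ _) _.
  rewrite (_ : (2 * e n)%:C = (e n)%:C + (e n)%:C); last first.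
    by rewrite mulrDl mul1r; exact: rmorphD.
  apply: ltrD; last exact: yn.
  by apply: lt_le_trans ym _; rewrite lecR; exact: e_le.
have sum_le (x y : ell2) (r : R) : 0 < r -> `|x - y| < r%:C ->
    forall N, \sum_(0 <= k < N) n2 (x k - y k) <= r ^+ 2.
  move=> r0; rewrite ell2_norm_lt // => xy N; apply: le_trans (ltW xy).
  exact: (sqn_ge N (ell2_summable (x - y))).
have coord_lt (x y : ell2) (r : R) k : 0 < r -> `|x - y| < r%:C -> n2 (x k - y k) < r ^+ 2.
  move=> r0; rewrite ell2_norm_lt // => xy; apply: le_lt_trans xy.
  exact: (ell2_coord_le (x - y) k).
have coord (g : C -> R) : (forall x y, g (x - y) = g x - g y) ->
    (forall z r, 0 < r -> n2 z < r ^+ 2 -> `|g z| < r) ->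
    forall k, cvgn (fun n => g (s n k)).
  move=> gB gn k; apply/cauchy_cvgP/cauchy_exP => r r0.
  have [n nr] := pick r r0; exists (g (s n k)); exists n => // m /= nm.
  rewrite -ball_normE /ball_ /= distrC -gB; apply: lt_trans nr.
  have en := e_gt0 n; apply: (@lt_trans _ _ (2 * e n)); last by lra.
  have e2 : 0 < 2 * e n by rewrite mulr_gt0.
  by apply: gn => //; apply: coord_lt => //; exact: sC.
have sr k := coord _ ReB Re_n2 k.
have si k := coord _ ImB Im_n2 k.
pose f : nat -> C := fun k => limn (fun n => complex.Re (s n k)) +i* limn (fun n =>
    complex.Im (s n k)).
have near_f n N : \sum_(0 <= k < N) n2 (f k - s n k) <= (2 * e n) ^+ 2.
  have kc k : (fun m => n2 (s m k - s n k)) @ \oo --> n2 (f k - s n k).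
    have Hr := cvgB (sr k) (cvg_cst (complex.Re (s n k))).
    have Hi := cvgB (si k) (cvg_cst (complex.Im (s n k))).
    apply: n2_cvg; first by rewrite ReB; under eq_fun do rewrite ReB; exact: Hr.
    by rewrite ImB; under eq_fun do rewrite ImB; exact: Hi.
  have H := @cvg_bigsum R R^o _ (index_iota 0 N) _ _ kc.
  apply: (limr_le_near H); exists n => // m /= nm; apply: sum_le; last exact: sC.
  by rewrite mulr_gt0.
have fP : f \in ell2_pred.
  apply/asboolP; split=> [n nS|].
    rewrite /f; under eq_fun do rewrite (ell2_off _ nS).
    by under [in X in _ +i* X]eq_fun do rewrite (ell2_off _ nS); rewrite !lim_cst.
  have -> : f = 1 \*: (fun k => f k - s 0 k) + s 0.
    by apply/funext => k; rewrite [RHS](_ : _ = 1 * (f k - s 0 k) + s 0 k) // mul1r subrK.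
  by apply: sqsummable_sum; [exists ((2 * e 0) ^+ 2); exact: near_f|exact: ell2_summable].
apply/cvg_ex; exists (Ell2 fP); apply/cvgrPdist_lt => eps eps0.
have epsE : eps = (complex.Re eps)%:C by rewrite RRe_real // gtr0_real.
rewrite epsE in eps0 *; rewrite ltcR in eps0.
have [n nr] := pick _ eps0; have en := e_gt0 n.
apply: filterS (sF n) => y; rewrite -ball_normE /ball_ /= => yn.
have -> : Ell2 fP - y = (Ell2 fP - s n) + (s n - y) by rewrite addrA subrK.
apply: le_lt_trans (ler_normD _ _) _.
have fn : `|Ell2 fP - s n| <= (2 * e n)%:C.
  rewrite ell2_normE lecR -[leRHS]ger0_norm ?mulr_ge0 ?(ltW en) // -sqrtr_sqr.
  by rewrite ler_sqrt ?sqr_ge0 //; apply: sqn_le => N; exact: (near_f n N).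
apply: lt_trans (_ : (3 * e n)%:C < _); last by rewrite ltcR.
rewrite (_ : (3 * e n)%:C = (2 * e n)%:C + (e n)%:C); last first.
  by rewrite -(rmorphD (real_complex R)); congr (_%:C); lra.
exact: ler_ltD.
Qed.

HB.instance Definition _ := Uniform_isComplete.Build ell2 ell2_complete.

Definition ell2_hilbert : hilbert R :=
  @Hilbert R ell2 (fun f g => ip f g) ell2_ip_linear ell2_ip_conj ell2_norm_ip.

End Ell2.

Lemma sum_tail0 (V : nmodType) (F : nat -> V) n m : (n <= m)%N ->
  (forall i, (n <= i)%N -> F i = 0) -> \sum_(0 <= i < m) F i = \sum_(0 <= i < n) F i.
Proof.
move=> nm F0; rewrite (big_cat_nat _ nm) //= [X in _ + X](_ : _ = 0) ?addr0 //.
by rewrite big_nat_cond big1 // => i /andP[/andP[ni _] _]; exact: F0.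
Qed.

(** * Completion of a countably generated semi-inner product space *)

Section Gns.
Variables (R : realType).
Local Notation C := R[i].
Variables (E : lmodType C) (v : nat -> E) (q : E -> E -> C).
Hypothesis v_span : forall p, linspan (range v) p.
Hypothesis ql : forall x a y z, q x (a *: y + z) = a * q x y + q x z.
Hypothesis qc : forall x y, q y x = Num.conj (q x y).
Hypothesis q_ge0 : forall x, 0 <= q x x.

Lemma q0r x : q x 0 = 0.
Proof. by have := ql x (-1) 0 0; rewrite scaler0 add0r mulN1r addNr. Qed.

Lemma qZr x a y : q x (a *: y) = a * q x y.
Proof. by rewrite -[a *: y]addr0 ql q0r addr0. Qed.

Lemma qDr x y z : q x (y + z) = q x y + q x z.
Proof. by rewrite -[y]scale1r ql mul1r scale1r. Qed.

Lemma qBr x y z : q x (y - z) = q x y - q x z.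
Proof. by rewrite -scaleN1r qDr qZr mulN1r. Qed.

Lemma q_sumr x (I : Type) (r : seq I) (f : I -> E) :
  q x (\sum_(i <- r) f i) = \sum_(i <- r) q x (f i).
Proof. by apply: (big_morph (q x)); [exact: qDr|exact: q0r]. Qed.

Lemma conj_mul (F : numClosedFieldType) (a b : F) :
  Num.conj (a * b) = Num.conj a * Num.conj b.
Proof. exact: rmorphM. Qed.

Lemma qZl x a y : q (a *: x) y = Num.conj a * q x y.
Proof. by rewrite qc qZr conj_mul -qc. Qed.

Lemma q_null x y : q x x = 0 -> q x y = 0.
Proof.
move=> x0; have := cauchy_schwarz ql qc q_ge0 x y; rewrite x0 mul0r => H.
by apply/eqP; rewrite -normr_eq0 -sqrf_eq0 eq_le H exprn_ge0.
Qed.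

Lemma q_nullr x y : q y y = 0 -> q x y = 0.
Proof. by move=> y0; rewrite qc q_null // conjC0. Qed.

Definition residual (s : seq E) (n : nat) : E := v n - \sum_(e <- s) q e (v n) *: e.

(* A null residual is sent to [0], since [0^-1 = 0]. *)
Fixpoint gram_schmidt (n : nat) : seq E :=
  if n is m.+1 then
    let r := residual (gram_schmidt m) m in
    rcons (gram_schmidt m) ((sqrtC (q r r))^-1 *: r)
  else [::].

Definition eps n : E := nth 0 (gram_schmidt n.+1) n.

Lemma gram_schmidtE n : gram_schmidt n = mkseq eps n.
Proof.
elim: n => [//|n IH]; rewrite mkseqS -IH /eps /= nth_rcons.
by rewrite (_ : size (gram_schmidt n) = n) ?ltnn ?eqxx // IH size_mkseq.
Qed.

Let res n : E := v n - \sum_(0 <= i < n) q (eps i) (v n) *: eps i.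

Lemma epsE n : eps n = (sqrtC (q (res n) (res n)))^-1 *: res n.
Proof.
have rE : residual (gram_schmidt n) n = res n.
  by rewrite /residual gram_schmidtE /mkseq big_map /res /index_iota subn0.
rewrite {1}/eps /= nth_rcons (_ : size (gram_schmidt n) = n) ?ltnn ?eqxx ?rE //.
by rewrite gram_schmidtE size_mkseq.
Qed.

Lemma inv_sqrtC_sqr (F : numClosedFieldType) (a : F) : 0 <= a -> a != 0 ->
  Num.conj (sqrtC a)^-1 * ((sqrtC a)^-1 * a) = 1.
Proof.
move=> a0 an; rewrite mulrA mulrC -[X in X * _](sqrtCK a).
have s0 : 0 <= sqrtC a by rewrite sqrtC_ge0.
rewrite fmorphV /= (CrealP (ger0_real s0)); field; by rewrite sqrtC_eq0.
Qed.

Lemma eps_self n : q (eps n) (eps n) = (q (res n) (res n) != 0)%:R.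
Proof.
rewrite epsE qZl qZr; case: eqVneq => [->|r0]; first by rewrite !mulr0.
exact: inv_sqrtC_sqr.
Qed.

Lemma eps_mul n p : q (eps n) (eps n) * q (eps n) p = q (eps n) p.
Proof.
rewrite eps_self; case: eqP => [r0|_]; last by rewrite mul1r.
by rewrite q_null ?mulr0 // eps_self r0 eqxx.
Qed.

Lemma eps_lt n i : (i < n)%N -> q (eps i) (eps n) = 0.
Proof.
elim/ltn_ind: n i => n IH i ni.
have orth a b : (a < n)%N -> (b < n)%N -> a != b -> q (eps a) (eps b) = 0.
  move=> an bn; rewrite neq_ltn => /orP[ab|ba]; first exact: IH.
  by rewrite qc IH // conjC0.
suff r0 : q (eps i) (res n) = 0 by rewrite [eps n]epsE qZr r0 mulr0.
rewrite /res qBr q_sumr (bigD1_seq i) ?mem_index_iota ?iota_uniq //=.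
rewrite qZr mulrC eps_mul big_seq_cond big1 ?addr0 ?subrr // => j /andP[].
rewrite mem_index_iota => /andP[_ jn] ji.
by rewrite qZr orth ?mulr0 // eq_sym.
Qed.

Lemma eps_orth i j : q (eps i) (eps j) = (i == j)%:R * q (eps i) (eps i).
Proof.
case: (ltngtP i j) => [ij|ji|->]; rewrite ?mul0r ?mul1r //; first exact: eps_lt.
by rewrite qc eps_lt // conjC0.
Qed.

Definition proj n p : E := \sum_(0 <= i < n) q (eps i) p *: eps i.

(** Modulo null vectors [p] is its finite expansion, and its later coordinates vanish, so that inner
    products with [p] are finite sums. *)
Definition expanded n p : Prop :=
  q (p - proj n p) (p - proj n p) = 0 /\ forall i, (n <= i)%N -> q (eps i) p = 0.

Lemma q_proj n p i : q (eps i) (proj n p) = (i < n)%:R * q (eps i) p.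
Proof.
rewrite q_sumr; under eq_bigr do rewrite qZr eps_orth.
have [ni|ni] := ltnP i n; last first.
  rewrite mul0r big_nat_cond big1 // => j /andP[/andP[_ jn] _].
  by rewrite (_ : (i == j) = false) ?mul0r ?mulr0 // gtn_eqF // (leq_trans jn).
rewrite (bigD1_seq i) ?mem_index_iota ?iota_uniq //= eqxx !mul1r mulrC eps_mul.
by rewrite big1 ?addr0 // => j ij; rewrite eq_sym (negPf ij) mul0r mulr0.
Qed.

Lemma expanded_q n p y : expanded n p -> q y p = q y (proj n p).
Proof. by move=> [p0 _]; have /eqP := q_nullr y p0; rewrite qBr subr_eq0 => /eqP. Qed.

Lemma expanded_v n : expanded n.+1 (v n).
Proof.
have null : q (v n - proj n.+1 (v n)) (v n - proj n.+1 (v n)) = 0.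
  rewrite /proj big_nat_recr //= opprD addrA -/(res n).
  have qv : q (eps n) (v n) = q (eps n) (res n).
    rewrite /res qBr -/(proj n (v n)) q_proj ltnn mul0r subr0 //.
  have [r0|r0] := eqVneq (q (res n) (res n)) 0.
    rewrite qv [q _ (res n)]q_nullr // scale0r subr0 //.
  rewrite qv epsE qZl scalerA.
  have -> : Num.conj (sqrtC (q (res n) (res n)))^-1 * q (res n) (res n) / sqrtC (q (res n) (res
      n)) = 1.
    by rewrite -mulrA [X in _ * X]mulrC inv_sqrtC_sqr.
  by rewrite scale1r subrr q0r.
split=> // i ni; have /eqP := q_nullr (eps i) null; rewrite qBr subr_eq0 => /eqP ->.
by rewrite q_proj ltnNge ni mul0r.
Qed.

Lemma expanded_widen n m p : (n <= m)%N -> expanded n p -> expanded m p.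
Proof.
move=> nm [pn p0]; split=> [|i mi]; last by apply: p0; exact: leq_trans mi.
suff -> : proj m p = proj n p by [].
by apply: (sum_tail0 nm) => i ni; rewrite p0 ?scale0r.
Qed.

Lemma expanded_ex p : exists n, expanded n p.
Proof.
elim/linspan_ind: p / (v_span p) => [|a _ y [k _ <-] [n yn]].
  exists 0; split=> [|i _]; last exact: q0r.
  by rewrite /proj big_nil subr0 q0r.
pose m := maxn n k.+1; exists m.
have [y0 y1] := expanded_widen (leq_maxl n k.+1) yn.
have [z0 z1] := expanded_widen (leq_maxr n k.+1) (expanded_v k).
split=> [|i mi]; last by rewrite ql y1 // z1 // mulr0 addr0.
have -> : a *: v k + y - proj m (a *: v k + y) = a *: (v k - proj m (v k)) + (y - proj m y).
  rewrite scalerBr addrACA -opprD; congr (_ - _).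
  rewrite /proj scaler_sumr -big_split; apply: eq_bigr => i _.
  by rewrite ql scalerDl scalerA.
by rewrite ql !(q_nullr _ z0) !(q_nullr _ y0) mulr0 addr0.
Qed.

Definition mask : pred nat := fun n => q (eps n) (eps n) != 0.
Local Notation K := (ell2_hilbert R mask).

Definition coords (p : E) : nat -> C := fun i => q (eps i) p.

Lemma coords_ell2 p : coords p \in @ell2_pred R mask.
Proof.
apply/asboolP; split=> [n|].
  by rewrite negbK => /eqP; exact: q_null.
have [n [_ p0]] := expanded_ex p.
exists (\sum_(0 <= k < n) n2 (coords p k)) => m.
apply: (@le_trans _ _ (\sum_(0 <= k < maxn n m) n2 (coords p k))).
  rewrite [leRHS](big_cat_nat _ (leq_maxr n m)) //= lerDl.
  by apply: sumr_ge0 => k _; exact: n2_ge0.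
rewrite (sum_tail0 (leq_maxl n m)) // => k nk.
by rewrite /coords p0 // n2_0.
Qed.

Definition embed (p : E) : K := Ell2 (coords_ell2 p).

Lemma embed_linear : linear embed.
Proof. by move=> a p r; apply: val_inj; apply/funext => i; exact: ql. Qed.

HB.instance Definition _ := GRing.isLinear.Build C E K *:%R embed embed_linear.

Lemma ip_finite (f g : nat -> C) n : (forall i, (n <= i)%N -> g i = 0) ->
  ip f g = \sum_(0 <= k < n) Num.conj (f k) * g k.
Proof.
move=> g0; apply: (cvg_lim (@norm_hausdorff _ C^o)); apply: cvg_near_cst.
exists n => // m /= nm; apply: (sum_tail0 nm) => i ni.
by rewrite g0 ?mulr0.
Qed.

Lemma embed_hdot p r : hdot (embed p) (embed r) = q p r.
Proof.
have [n rn] := expanded_ex r; have [_ r0] := rn.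
rewrite [LHS](@ip_finite (coords p) (coords r) n r0) (expanded_q p rn) q_sumr.
by apply: eq_bigr => i _; rewrite qZr mulrC -qc.
Qed.

Lemma embed_dense : closed_span (range embed) = setT.
Proof.
apply/seteqP; split=> // f _ A /nbhs_ballP [e e0 eA].
have eE : e = (complex.Re e)%:C by rewrite RRe_real // gtr0_real.
rewrite eE /= ltcR in e0; set r := complex.Re e in eE e0.
have fs : sqsummable f by exact: ell2_summable.
have [n fn] : exists n, sqn f - r ^+ 2 < \sum_(0 <= k < n) n2 (f k).
  have [n _ /(_ n (leqnn n)) H] : \forall n \near \oo, `|sqn f -
      \sum_(0 <= k < n) n2 (f k)| < r ^+ 2.
    by move/cvgrPdist_lt: (sqsum_cvg fs); apply; rewrite exprn_gt0.
  by exists n; have := ltr_normlW H; lra.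
pose p : E := \sum_(0 <= i < n) (f : @ell2 R mask) i *: eps i.
have pE i : coords p i = (i < n)%:R * (f : @ell2 R mask) i.
  rewrite /coords /p q_sumr; under eq_bigr do rewrite qZr eps_orth.
  have fi : (f : @ell2 R mask) i * q (eps i) (eps i) = (f : @ell2 R mask) i.
    rewrite eps_self; case: eqP => [r0|_]; last by rewrite mulr1.
    by rewrite ell2_off ?mul0r // /mask eps_self r0 !eqxx.
  have [ni|ni] := ltnP i n; last first.
    rewrite mul0r big_nat_cond big1 // => j /andP[/andP[_ jn] _].
    by rewrite (_ : (i == j) = false) ?mul0r ?mulr0 // gtn_eqF // (leq_trans jn).
  rewrite (bigD1_seq i) ?mem_index_iota ?iota_uniq //= eqxx !mul1r fi.
  by rewrite big1 ?addr0 // => j ij; rewrite eq_sym (negPf ij) mul0r mulr0.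
exists (embed p); split; first by apply: linspan_mem; exists p.
apply: eA; rewrite -ball_normE /ball_ /= eE ell2_norm_lt //.
apply: le_lt_trans (_ : sqn f - \sum_(0 <= k < n) n2 ((f : @ell2 R mask) k) < _); last by lra.
apply: sqn_le => m; rewrite lerBrDl.
apply: le_trans (sqn_ge (maxn n m) fs); rewrite (big_cat_nat _ (leq_maxl n m)) //= lerD2l.
have tE k : (f - embed p : @ell2 R mask) k = (n <= k)%:R * (f : @ell2 R mask) k.
  rewrite [LHS](_ : _ = (f : @ell2 R mask) k - coords p k) // pE ltnNge.
  by case: (n <= k)%N; rewrite ?mul0r ?mul1r ?subr0 ?subrr.
rewrite (eq_bigr (fun k => n2 ((n <= k)%:R * (f : @ell2 R mask) k))); last first.
  by move=> k _; rewrite -tE.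
have [mn|/ltnW nm] := leqP m n.
  rewrite big_nat_cond big1; first by apply: sumr_ge0 => k _; exact: n2_ge0.
  by move=> k /andP[/andP[_ km] _]; rewrite leqNgt (leq_trans km mn) mul0r n2_0.
rewrite [leLHS](big_cat_nat _ nm) //= big_nat_cond big1 ?add0r.
  by apply: ler_sum_nat => k /andP[nk _]; rewrite nk mul1r.
by move=> k /andP[/andP[_ kn] _]; rewrite leqNgt kn mul0r n2_0.
Qed.

(** The representing sequence is [conj (L (eps i))]. Testing [L] on the partial sums of its own
    expansion gives Bessel's inequality, hence square summability. *)
Lemma riesz (L : E -> C) (M : R) : 0 <= M -> (forall a y z, L (a *: y + z) = a * L y + L z) ->
  (forall p, `|L p| ^+ 2 <= M%:C * q p p) ->
  exists2 g : K, (forall p, hdot g (embed p) = L p) & hdot g g <= M%:C.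
Proof.
move=> M0 Ll Lb.
have L0 : L 0 = 0 by have := Ll (-1) 0 0; rewrite scaler0 add0r mulN1r addNr.
have LZ a y : L (a *: y) = a * L y by rewrite -[a *: y]addr0 Ll L0 addr0.
have LD y z : L (y + z) = L y + L z by rewrite -[y]scale1r Ll mul1r scale1r.
have Lsum (f : nat -> E) n : L (\sum_(0 <= i < n) f i) = \sum_(0 <= i < n) L (f i).
  by apply: (big_morph L).
have Lnull p : q p p = 0 -> L p = 0.
  move=> p0; apply/eqP; rewrite -normr_eq0 -sqrf_eq0 eq_le exprn_ge0 // andbT.
  by apply: le_trans (Lb p) _; rewrite p0 mulr0.
pose g i := Num.conj (L (eps i)).
have bessel n : \sum_(0 <= k < n) n2 (g k) <= M.
  pose B := \sum_(0 <= k < n) n2 (g k).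
  have B0 : 0 <= B by apply: sumr_ge0 => k _; exact: n2_ge0.
  pose p := \sum_(0 <= i < n) g i *: eps i.
  have n2g i : g i * L (eps i) = (n2 (g i))%:C.
    by rewrite n2E norm_conjC normCK mulrC.
  have Lp : L p = B%:C.
    by rewrite Lsum rmorph_sum; apply: eq_bigr => i _; rewrite LZ n2g.
  have qp : q p p = B%:C.
    rewrite {2}/p q_sumr rmorph_sum; apply: eq_big_nat => i /andP[_ ni]; rewrite qZr.
    rewrite [RHS](_ : _ = g i * L (eps i)); last by rewrite n2g.
    congr (_ * _); rewrite qc -[RHS]conjCK; congr (Num.conj _).
    rewrite q_sumr; under eq_bigr do rewrite qZr eps_orth.
    rewrite (bigD1_seq i) ?mem_index_iota ?iota_uniq //= eqxx mul1r.
    rewrite big1 ?addr0 => [|j ij]; last by rewrite eq_sym (negPf ij) mul0r mulr0.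
    rewrite eps_self; case: eqP => [r0|_]; last by rewrite mulr1.
    by rewrite /g Lnull ?conjC0 ?mul0r // eps_self r0 eqxx.
  suff : B <= M by [].
  have : B * B <= M * B.
    by have := Lb p; rewrite Lp qp -n2E -(rmorphM (real_complex R)) lecR /n2 /= expr0n addr0 expr2.
  by have [->//|Bn] := eqVneq B 0; rewrite ler_pM2r // lt_def Bn B0.
have gP : g \in @ell2_pred R mask.
  apply/asboolP; split=> [n|]; last by exists M.
  by rewrite negbK => /eqP /Lnull; rewrite /g => ->; rewrite conjC0.
exists (Ell2 gP : K).
  move=> p; have [n pn] := expanded_ex p; have [p0 p1] := pn.
  rewrite [LHS](@ip_finite g (coords p) n p1).
  have -> : L p = L (proj n p).
    by have := Lnull _ p0; rewrite -scaleN1r LD LZ mulN1r => /eqP; rewrite subr_eq0 => /eqP.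
  rewrite Lsum; apply: eq_bigr => i _; rewrite LZ mulrC; congr (_ * _).
  exact: conjCK.
rewrite [X in X <= _](ip_self (ell2_summable (Ell2 gP))) lecR.
exact: sqn_le.
Qed.

End Gns.

(** * Row isometries from a semi-inner product *)

Section Dilation.
Variables (R : realType).
Local Notation C := R[i].

Lemma hdotC (K : hilbert R) (x y : K) : hdot y x = Num.conj (hdot x y).
Proof. exact: hdot_conj. Qed.

Lemma conj_lin (F : numClosedFieldType) (a b c : F) :
  Num.conj (a * b + c) = Num.conj a * Num.conj b + Num.conj c.
Proof. by rewrite rmorphD rmorphM. Qed.

Lemma hdot_linearl (K : hilbert R) (f g h : K) a :
  hdot (a *: f + g) h = Num.conj a * hdot f h + hdot g h.
Proof.
rewrite hdotC hdot_linear (hdotC h f) (hdotC h g).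
exact: conj_lin.
Qed.

Lemma hdot_cs (K : hilbert R) (x y : K) : `|hdot x y| <= `|x| * `|y|.
Proof.
rewrite -(@ler_pXn2r _ 2) ?nnegrE ?mulr_ge0 // exprMn -!hdot_norm.
apply: (cauchy_schwarz (@hdot_linear R K) (@hdotC K)) => z.
by rewrite hdot_norm exprn_ge0.
Qed.

Lemma dense_functional (K : hilbert R) (S : set K) (L : K -> C) (M : C) :
  closed_span S = setT -> 0 <= M -> (forall a y z, L (a *: y + z) = a * L y + L z) ->
  (forall u, `|L u| <= M * `|u|) -> (forall s, S s -> L s = 0) -> forall u, L u = 0.
Proof.
move=> Sd M0 Ll LM LS u.
have Lspan s : linspan S s -> L s = 0.
  move: s; apply: linspan_ind; first by have := Ll (-1) 0 0; rewrite scaler0 add0r mulN1r addNr.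
  by move=> a s y Ss Ly; rewrite Ll LS // Ly mulr0 addr0.
apply/eqP; rewrite -normr_eq0; apply/negPn/negP => u0.
have M1 : 0 < M + 1 by rewrite ltr_wpDl.
pose e := `|L u| / (M + 1).
have e0 : 0 < e by rewrite divr_gt0 // lt_def u0 normr_ge0.
have : closed_span S u by rewrite Sd.
move=> /(_ (ball u e) (nbhsx_ballx _ _ e0)) [s [ls]].
rewrite -ball_normE /ball_ /= => us.
have : `|L u| <= M * `|u - s|.
  suff -> : L u = L (u - s) by exact: LM.
  by rewrite -[u - s]addrC -scaleN1r Ll (Lspan _ ls) mulr0 add0r.
apply/negP; rewrite -real_ltNge ?ger0_real ?mulr_ge0 //.
apply: (@le_lt_trans _ _ (M * e)); first by rewrite ler_wpM2l // ltW.
have -> : `|L u| = (M + 1) * e by rewrite mulrC divfK // gt_eqF.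
by rewrite mulrDl mul1r ltrDl.
Qed.

Lemma dense_eq (K : hilbert R) (S : set K) (f g : K) : closed_span S = setT ->
  (forall s, S s -> hdot f s = hdot g s) -> f = g.
Proof.
move=> Sd fg; apply/eqP; rewrite -subr_eq0; apply/eqP; apply: (hdot_lim0 Sd) => s /fg fgs.
by rewrite addrC -scaleN1r hdot_linearl fgs rmorphN rmorph1 mulN1r addNr.
Qed.

(** The bound in the last clause is expressed by a vector [f] because adjoints are later obtained as
    representatives of functionals that depend on [f]. *)
Lemma gns_space (E : lmodType C) (v : nat -> E) (q : E -> E -> C) :
  (forall p, linspan (range v) p) ->
  (forall x a y z, q x (a *: y + z) = a * q x y + q x z) ->
  (forall x y, q y x = Num.conj (q x y)) -> (forall x, 0 <= q x x) ->
  exists (K : hilbert R) (J : {linear E -> K}),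
  [/\ forall p r, hdot (J p) (J r) = q p r, closed_span (range J) = setT &
    forall (L : E -> C) (f : K), (forall a y z, L (a *: y + z) = a * L y + L z) ->
      (forall p, `|L p| ^+ 2 <= hdot f f * q p p) ->
      exists g : K, (forall p, hdot g (J p) = L p) /\ hdot g g <= hdot f f].
Proof.
move=> v_span ql qc q_ge0.
exists (ell2_hilbert R (mask v q)), (embed v_span ql qc q_ge0); split.
- exact: embed_hdot.
- exact: embed_dense.
move=> L f Ll Lb; have ffE : hdot f f = (complex.Re (hdot f f))%:C.
  by rewrite RRe_real // hdot_norm ger0_real // exprn_ge0.
have [||g gL gf] := @riesz R E v q v_span ql qc q_ge0 L (complex.Re (hdot f f)) _ Ll.
- by rewrite -lecR -ffE hdot_norm exprn_ge0.
- by rewrite -ffE.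
by exists g; split=> //; rewrite ffE.
Qed.

(** Extending the [z j] from the range of [J] would require well-definedness modulo null vectors.
    Instead [Vs j f] represents [p |-> <f, J (z j p)>], and [V j f] represents
    [p |-> <f, Vs j (J p)>]; both functionals are bounded by [|f|]. *)
Theorem gns (E : lmodType C) (v : nat -> E) (q : E -> E -> C) (d : nat)
    (z : 'I_d -> {linear E -> E}) :
  (forall p, linspan (range v) p) ->
  (forall x a y z, q x (a *: y + z) = a * q x y + q x z) ->
  (forall x y, q y x = Num.conj (q x y)) -> (forall x, 0 <= q x x) ->
  (forall j k p r, q (z j p) (z k r) = (j == k)%:R * q p r) ->
  exists (K : hilbert R) (J : {linear E -> K}) (V Vs : 'I_d -> {linear K -> K}),
  [/\ forall p r, hdot (J p) (J r) = q p r, closed_span (range J) = setT, row_isometry V,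
     forall j, is_adjoint (V j) (Vs j) & forall j p, V j (J p) = J (z j p)].
Proof.
move=> v_span ql qc q_ge0 qz.
have [K [J [Jq Jd rz]]] := gns_space v_span ql qc q_ge0.
have hd_eq (f g : K) : (forall p, hdot f (J p) = hdot g (J p)) -> f = g.
  by move=> fg; apply: (dense_eq Jd) => _ [p _ <-]; exact: fg.
have hd_ge0 (f : K) : 0 <= hdot f f by rewrite hdot_norm exprn_ge0.
have cs := cauchy_schwarz (@hdot_linear R K) (@hdotC K) hd_ge0.
have norm_le (f g : K) : hdot f f <= hdot g g -> `|f| <= `|g|.
  by rewrite !hdot_norm ler_pXn2r ?nnegrE.
have /choice [Vs VsP] : forall jf : 'I_d * K, exists g : K,
    (forall p, hdot g (J p) = hdot jf.2 (J (z jf.1 p))) /\ hdot g g <= hdot jf.2 jf.2.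
  move=> [j f] /=; apply: rz => [a y r|p]; first by rewrite !linearP hdot_linear.
  by apply: le_trans (cs _ _) _; rewrite Jq qz eqxx mul1r.
have VsJ j f p : hdot (Vs (j, f)) (J p) = hdot f (J (z j p)) by case: (VsP (j, f)).
have Vs_le j f : hdot (Vs (j, f)) (Vs (j, f)) <= hdot f f by case: (VsP (j, f)).
have Vsl j : linear (fun f => Vs (j, f)).
  by move=> a f g; apply: hd_eq => p; rewrite hdot_linearl !VsJ hdot_linearl.
have /choice [V VP] : forall jf : 'I_d * K, exists g : K,
    (forall p, hdot g (J p) = hdot jf.2 (Vs (jf.1, J p))) /\ hdot g g <= hdot jf.2 jf.2.
  move=> [j f] /=; apply: rz => [a y r|p]; first by rewrite linearP Vsl hdot_linear.
  by apply: le_trans (cs _ _) _; rewrite ler_wpM2l // -Jq; exact: Vs_le.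
have VJ j f p : hdot (V (j, f)) (J p) = hdot f (Vs (j, J p)) by case: (VP (j, f)).
have Vl j : linear (fun f => V (j, f)).
  by move=> a f g; apply: hd_eq => p; rewrite hdot_linearl !VJ hdot_linearl.
have VJz j p : V (j, J p) = J (z j p).
  by apply: hd_eq => r; rewrite VJ hdotC VsJ -hdotC.
have adj j f g : hdot (Vs (j, f)) g = hdot f (V (j, g)).
  rewrite hdotC [RHS]hdotC; congr (Num.conj _).
  apply/eqP; rewrite -subr_eq0; apply/eqP; move: f.
  apply: (dense_functional (M := `|g| + `|V (j, g)|) Jd) => [|a f h|f|_ [p _ <-]].
  - by rewrite addr_ge0.
  - by rewrite Vsl !hdot_linear; ring.
  - apply: le_trans (ler_normB _ _) _; rewrite mulrDl; apply: lerD; last exact: hdot_cs.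
    by apply: le_trans (hdot_cs _ _) _; rewrite ler_wpM2l //; apply: norm_le.
  - by rewrite -VJ subrr.
have hZ (f g : K) a : hdot f (a *: g) = a * hdot f g := qZr (@hdot_linear R K) f a g.
have hZl (f g : K) a : hdot (a%:R *: f) g = a%:R * hdot f g.
  by rewrite hdotC hZ conj_mul -hdotC conjC_nat.
have VsJz j k p : Vs (j, J (z k p)) = (j == k)%:R *: J p.
  by apply: hd_eq => r; rewrite VsJ Jq qz hZl Jq eq_sym.
have VV j k f g : hdot (V (j, f)) (V (k, g)) = (j == k)%:R * hdot f g.
  rewrite -adj; suff -> : Vs (k, V (j, f)) = (j == k)%:R *: f by rewrite hZl.
  by apply: hd_eq => p; rewrite VsJ VJ VsJz hZ hZl.
pose Vf j : {linear K -> K} := HB.pack (fun f => V (j, f)) (GRing.isLinear.Build C K K *:%R _ (Vl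
    j)).
pose Vsf j : {linear K -> K} := HB.pack (fun f =>
    Vs (j, f)) (GRing.isLinear.Build C K K *:%R _ (Vsl j)).
by exists K, J, Vf, Vsf; split.
Qed.

End Dilation.

(** * The Herglotz kernel and its row isometry *)

Lemma conj_sum (F : numClosedFieldType) (I : Type) (r : seq I) (a b : I -> F) :
  Num.conj (\sum_(i <- r) a i * b i) = \sum_(i <- r) Num.conj (a i) * Num.conj (b i).
Proof. by rewrite rmorph_sum; apply: eq_bigr => i _; rewrite rmorphM. Qed.

Lemma conj_herglotz (F : numClosedFieldType) (a b : F) n :
  Num.conj (a + Num.conj b - n%:R) = b + Num.conj a - n%:R.
Proof. by rewrite rmorphB rmorphD /= conjC_nat conjCK; ring. Qed.

Section Herglotz.
Variables (R : realType) (d : nat).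
Local Notation C := R[i].

(* Realizes [(1 - b)^-1] if [S] realizes [b]. *)
Definition feedback k (S : sys R d k) : sys R d k :=
  let a := (1 - sD S)^-1 in
  Sys (fun j => sA S j + a *: (sB S j *m sC S)) (sB S) (a ^+ 2 *: sC S) a.

(** With [g] the output of the feedback system, [a *: v'] solves the state equation of [S] with
    input [g]. Invertibility of the pencil then forces it to be [v *m g]. *)
Lemma feedback_out k (S : sys R d k) n (Z : mxtuple R d n) v v' :
  sD S != 1 -> pencil S Z \in unitmx -> sol S Z v -> sol (feedback S) Z v' ->
  (1%:M - out S v) *m out (feedback S) v' = 1%:M.
Proof.
move=> D1 uP vS vF; have c0 : 1 - sD S != 0 by rewrite subr_eq0 eq_sym.
pose a := (1 - sD S)^-1.
set g := out (feedback S) v'.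
have gE : g = a *: (1%:M + a *: \sum_l sC S 0 l *: v' l).
  rewrite /g /out /rout /= -/a scalerDr scalemx1 scalerA -expr2; congr (_ + _).
  by rewrite scaler_sumr; apply: eq_bigr => l _; rewrite mxE scalerA.
have sysE l : a *: v' l = \sum_j Z j *m (\sum_i sA S j l i *: (a *: v' i) + sB S j l 0 *: g).
  rewrite {1}[v' l]vF scaler_sumr; apply: eq_bigr => j _; rewrite scalemxAr; congr (_ *m _).
  have -> : \sum_m sA (feedback S) j l m *: v' m =
      \sum_m sA S j l m *: v' m + (a * sB S j l 0) *: \sum_m sC S 0 m *: v' m.
    rewrite scaler_sumr -big_split; apply: eq_bigr => i _ /=.
    by rewrite !mxE big_ord1 scalerA -scalerDl mulrA.
  rewrite gE; under [in RHS]eq_bigr => i _ do rewrite scalerA mulrC -scalerA.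
  rewrite -scaler_sumr; move: (\sum_i _) (\sum_m _) => X Y.
  rewrite !scalerDr !scalerA scalemx1 scale_scalar_mx -addrA; congr (_ + _).
  by rewrite addrC /=; congr (_%:M + _ *: _); ring.
have vE l : a *: v' l = v l *m g.
  pose w l := a *: v' l - v l *m g.
  have : pencil S Z *m vcol w = 0.
    rewrite /pencil mulmxBl mul1mx pencil_part_vcol; apply/eqP; rewrite subr_eq0; apply/eqP.
    apply: eq_vcol => i; rewrite {1}/w sysE {1}[v i]vS mulmx_suml -sumrB; apply: eq_bigr => j _.
    rewrite -mulmxA -mulmxBr; congr (_ *m _).
    rewrite mulmxDl mul_scalar_mx opprD addrACA subrr addr0 mulmx_suml -sumrB.
    by apply: eq_bigr => h _; rewrite scalerBr -scalemxAl.
  move=> /(congr1 (mulmx (invmx (pencil S Z)))); rewrite mulKmx // mulmx0 => w0.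
  apply/eqP; rewrite -subr_eq0; apply/eqP/matrixP => p q.
  by have := vcolE w p l q ord0; rewrite w0 mxE => <-; rewrite [RHS]mxE.
rewrite mulmxBl mul1mx; suff -> : out S v *m g = g - 1%:M by rewrite subKr.
  rewrite /out /rout mulmxDl mul_scalar_mx mulmx_suml.
  have -> : \sum_i sC S 0 i *: v i *m g = a *: \sum_l sC S 0 l *: v' l.
    rewrite scaler_sumr; apply: eq_bigr => l _.
    by rewrite -scalemxAl -vE !scalerA mulrC.
  have : (1 - sD S) *: g = 1%:M + a *: \sum_l sC S 0 l *: v' l.
    by rewrite gE scalerA divff // scale1r.
  move=> E; have -> : a *: \sum_l sC S 0 l *: v' l = (1 - sD S) *: g - 1%:M.
    by rewrite E [1%:M + _]addrC addrK.
  by rewrite scalerBl scale1r addrA [sD S *: g + _]addrC subrK.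
Qed.

(* If [f] is the symbol of [G = (1 - b)^-1], this is the symbol of
   [2 Re G - 1 = Re ((1 + b) / (1 - b))]. *)
Definition herglotz (f : word d -> C) (u w : word d) : C :=
  toep f u w + Num.conj (toep f w u) - (u == w)%:R.

(** This invariance is what makes prefixing a letter a row isometry for the form of the kernel. *)
Lemma herglotz_cons f j i u w : herglotz f (j :: u) (i :: w) = (j == i)%:R * herglotz f u w.
Proof.
rewrite /herglotz /= eqseq_cons [i == j]eq_sym.
by case: (j == i); rewrite ?mul1r ?mul0r //= conjC0 addr0 subrr.
Qed.

Lemma herglotz_conj f u w : herglotz f w u = Num.conj (herglotz f u w).
Proof.
by rewrite /herglotz conj_herglotz eq_sym.
Qed.

Lemma herglotz_nil f s : s != [::] -> herglotz f s [::] = f s.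
Proof.
by case: s => // j s _; rewrite /herglotz /= conjC0 addr0 subr0.
Qed.

(** The truncated subtraction is harmless, since [toep] vanishes unless [q] is a prefix of [p]. *)
Lemma toep_weight (f : word d -> C) (r : C) p q :
  toep (fun s => r ^+ size s * f s) p q = r ^+ (size p - size q) * toep f p q.
Proof.
elim: p q => [|i p IH] [|j q] //=; first by rewrite mulr0.
by rewrite subSS; case: ifP => _; rewrite ?mulr0.
Qed.

Lemma cvg_ge0 (s : nat -> C^o) (l : C) : s @ \oo --> (l : C^o) ->
  (forall n, 0 <= (s n : C)) -> 0 <= l.
Proof.
move=> sl s0.
have sE n : complex.Im (s n) = 0 /\ 0 <= complex.Re (s n).
  by have := s0 n; rewrite lecE /= => /andP[/eqP -> ->].
have H e : 0 < e -> exists n, `|l - s n| < e%:C.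
  move=> e0; have [n _ /(_ n (leqnn n)) H] : \forall n \near \oo, `|l - s n| < e%:C.
    by move/cvgrPdist_lt: sl; apply; rewrite ltcR.
  by exists n.
have H2 e : 0 < e -> exists n, n2 (l - s n) < e ^+ 2.
  move=> e0; have [n ln] := H e e0; exists n; rewrite -ltcR n2E rmorphXn.
  by rewrite ltr_pXn2r ?nnegrE // lecR ltW.
rewrite lecE /=; apply/andP; split.
  apply/eqP/eqP; rewrite -normr_eq0 eq_le normr_ge0 andbT.
  apply/ler_addgt0Pr => e e0; have [n /(Im_n2 e0)] := H2 e e0.
  by rewrite ImB (proj1 (sE n)) subr0 add0r => /ltW.
apply/ler_addgt0Pr => e e0; have [n /(Re_n2 e0)] := H2 e e0; rewrite ReB.
by move/ltr_normlP => [+ _]; have := proj2 (sE n); lra.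
Qed.

Variables (b : nc_ratfun R d) (k : nat) (S : sys R d k).
Hypotheses (bb : ratfun_in_hinf_ball b) (bS : realized b S) (D1 : sD S != 1).
Local Notation f := (tay (feedback S)).

(** Put [eta = g y] with [g = (1 - b)^-1] at the shift. Then [b eta = eta - y], and contractivity
    [|eta - y|^2 <= |eta|^2] says [2 Re <y, eta> - |y|^2 >= 0], which is the form of the kernel at
    [y]. *)
Lemma herglotz_shift n (r : C) (y : 'cV[C]_#|{: n.-bseq 'I_d}|) : 0 <= r -> r < 1 ->
  0 <= \sum_p \sum_q Num.conj (y p 0) * y q 0 *
     herglotz (fun s => r ^+ size s * f s) (wd p) (wd q).
Proof.
move=> r0 r1; have uP := shift_pencil S n r.
have [v vS] := sol_exists uP; have [v' vF] := sol_exists (shift_pencil (feedback S) n r).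
have [_ le] := ball_shift_out bb bS r0 r1 vS.
have inv := feedback_out D1 uP vS vF.
set g := out (feedback S) v' in inv; have := le (g *m y).
have -> : out S v *m (g *m y) = g *m y - y.
  have : (1%:M - out S v) *m (g *m y) = y by rewrite mulmxA inv mul1mx.
  by rewrite mulmxBl mul1mx => {3}<-; rewrite subKr.
have gE p q : g p q = toep (fun s => r ^+ size s * f s) (wd p) (wd q) := out_shift vF p q.
move=> h; suff -> : \sum_p \sum_q Num.conj (y p 0) * y q 0 *
     herglotz (fun s => r ^+ size s * f s) (wd p) (wd q) =
     cdot y (g *m y) + Num.conj (cdot y (g *m y)) - cdot y y.
  rewrite -cdotC; move: h; rewrite cdotBl !cdotBr -subr_ge0.
  by congr (_ <= _); ring.
rewrite -cdotC !cdotE -big_split -sumrB /=.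
have E1 p : Num.conj (y p 0) * (g *m y) p 0 = \sum_q Num.conj (y p 0) * y q 0 * g p q.
  by rewrite mxE mulr_sumr; apply: eq_bigr => q _; rewrite -mulrA [g p q * _]mulrC.
have E2 : \sum_p Num.conj ((g *m y) p 0) * y p 0 =
    \sum_p \sum_q Num.conj (y p 0) * y q 0 * Num.conj (g q p).
  rewrite exchange_big; apply: eq_bigr => q _ /=; rewrite mxE conj_sum mulr_suml.
  by apply: eq_bigr => p _; rewrite -mulrA mulrC.
rewrite sumrB big_split E2 -big_split -sumrB; apply: eq_bigr => p _ /=.
rewrite E1 -big_split; have -> : Num.conj (y p 0) * y p 0 =
    \sum_q Num.conj (y p 0) * y q 0 * (wd p == wd q)%:R.
  rewrite (bigD1 p) //= eqxx mulr1 big1 ?addr0 // => q qp.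
  by rewrite (inj_eq (@wd_inj d n)) eq_sym (negPf qp) mulr0.
by rewrite -sumrB; apply: eq_bigr => q _ /=; rewrite /herglotz -!gE; ring.
Qed.

(** The shift with [r = 1] need not lie in the row ball, so [r] tends to [1] from below in the
    finite sum. *)
Lemma herglotz_fin n (y : 'cV[C]_#|{: n.-bseq 'I_d}|) :
  0 <= \sum_p \sum_q Num.conj (y p 0) * y q 0 * herglotz f (wd p) (wd q).
Proof.
pose r m : R := 1 - m.+1%:R^-1.
have r01 m : 0 <= r m < 1.
  by rewrite subr_ge0 invf_le1 // ler1n /= ltrBlDr ltrDl invr_gt0.
have rX e : ((fun m => ((r m)%:C) ^+ e) : nat -> C^o) @ \oo --> (1 : C^o).
  have r1 : (fun m => r m ^+ e) @ \oo --> (1 : R).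
    elim: e => [|e IH]; first by under eq_fun do rewrite expr0; exact: cvg_cst.
    have h := @cvg_harmonic R.
    have H := cvgM (cvgB (cvg_cst (1 : R)) h) IH; rewrite subr0 mulr1 in H.
    by under eq_fun do rewrite exprS; exact: H.
  under eq_fun do rewrite -rmorphXn.
  by apply: (@cvg_complex R _ 1 0) => /=; [exact: r1|exact: cvg_cst].
have hE m u w : herglotz (fun s => (r m)%:C ^+ size s * f s) u w =
    (r m)%:C ^+ (size u - size w) * toep f u w +
    (r m)%:C ^+ (size w - size u) * Num.conj (toep f w u) - (u == w)%:R.
  rewrite /herglotz !toep_weight; congr (_ + _ - _).
  rewrite conj_mul; congr (_ * _); apply/CrealP; rewrite ger0_real // exprn_ge0 // lecR.
  by case/andP: (r01 m).
have hc u w : ((fun m => herglotz (fun s => (r m)%:C ^+ size s * f s) u w) : nat -> C^o) @ \oo -->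
    (herglotz f u w : C^o).
  under eq_fun do rewrite hE.
  have H := cvgB (cvgD (cvgM (rX (size u - size w)%N) (cvg_cst (toep f u w : C^o)))
    (cvgM (rX (size w - size u)%N) (cvg_cst (Num.conj (toep f w u) : C^o))))
    (cvg_cst ((u == w)%:R : C^o)).
  by rewrite !mul1r in H; exact: H.
apply: (@cvg_ge0 (fun m => \sum_p \sum_q Num.conj (y p 0) * y q 0 *
     herglotz (fun s => (r m)%:C ^+ size s * f s) (wd p) (wd q))) => [|m]; last first.
  by case/andP: (r01 m) => r0 r1; apply: herglotz_shift; rewrite ?lecR ?ltcR.
by apply: (@cvg_bigsum _ C^o) => p; apply: cvg_lincomb => q; exact: hc.
Qed.

Lemma herglotz_psd (L : seq (word d)) (c : word d -> C) : uniq L ->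
  0 <= \sum_(u <- L) \sum_(w <- L) Num.conj (c u) * c w * herglotz f u w.
Proof.
move=> uL; pose n := \max_(w <- L) size w.
have wL w : w \in L -> wd (@wi d n w) = w.
  by move=> h; rewrite wiK // (leq_bigmax_seq w).
pose y : 'cV[C]_#|{: n.-bseq 'I_d}| := \col_p (if wd p \in L then c (wd p) else 0).
have sumL (F : word d -> C) : (forall w, w \notin L -> F w = 0) ->
    \sum_(p : 'I_#|{: n.-bseq 'I_d}|) F (wd p) = \sum_(u <- L) F u.
  move=> F0; rewrite (bigID (fun p => wd p \in L)) /= [X in _ + X]big1 ?addr0; last first.
    by move=> p; exact: F0.
  have LE : L = map (@wd d n) (map (@wi d n) L).
    by rewrite -map_comp -[LHS]map_id; apply/eq_in_map => w /wL.
  rewrite [in RHS]LE big_map big_uniq /=; last first.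
    by rewrite map_inj_in_uniq // => u w /wL + /wL + E; rewrite E => -> .
  apply: eq_bigl => p; apply/idP/idP => [pL|/mapP[w wL' ->]]; last by rewrite wL.
  by apply/mapP; exists (wd p); rewrite ?wdK.
have := herglotz_fin y; congr (_ <= _).
pose c' u := if u \in L then c u else 0.
have yE p : y p 0 = c' (wd p) by rewrite mxE.
have -> : \sum_(u <- L) \sum_(w <- L) Num.conj (c u) * c w * herglotz f u w =
    \sum_(u <- L) \sum_(w <- L) Num.conj (c' u) * c' w * herglotz f u w.
  apply: eq_big_seq => u uL'; apply: eq_big_seq => w wL'.
  by rewrite /c' uL' wL'.
rewrite -(sumL (fun u => \sum_(w <- L) Num.conj (c' u) * c' w * herglotz f u w)); last first.
  by move=> u /negPf uL'; rewrite big1 // => w _; rewrite /c' uL' conjC0 !mul0r.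
apply: eq_bigr => p _; rewrite -(sumL (fun w => Num.conj (c' (wd p)) * c' w * herglotz f (wd p)
    w)); last first.
  by move=> w /negPf wL'; rewrite {2}/c' wL' mulr0 mul0r.
by apply: eq_bigr => q _; rewrite !yE.
Qed.

End Herglotz.

(** * The free vector space on words and its form *)

Section LinearExtension.
Variables (F : fieldType) (V : lmodType F) (f : nat -> V).

(** [{poly F}] serves as the free vector space on [nat], with basis the monomials. *)
Definition lin_ext (p : {poly F}) : V := \sum_(i < size p) p`_i *: f i.

Lemma lin_ext_widen n (p : {poly F}) : (size p <= n)%N -> lin_ext p = \sum_(i < n) p`_i *: f i.
Proof.
move=> pn; rewrite /lin_ext (big_ord_widen n (fun i => p`_i *: f i) pn) big_mkcond.
apply: eq_bigr => i _; case: ltnP => // ip; by rewrite nth_default ?scale0r.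
Qed.

Lemma lin_ext_linear : linear lin_ext.
Proof.
move=> a p r; pose n := maxn (size (a *: p + r)) (maxn (size p) (size r)).
rewrite !(@lin_ext_widen n) ?leq_max ?leqnn ?orbT //.
rewrite scaler_sumr -big_split; apply: eq_bigr => i _ /=.
by rewrite coefD coefZ scalerDl scalerA.
Qed.

HB.instance Definition _ := GRing.isLinear.Build F {poly F} V *:%R lin_ext lin_ext_linear.

Lemma lin_extX n : lin_ext 'X^n = f n.
Proof.
rewrite /lin_ext size_polyXn big_ord_recr /= coefXn eqxx scale1r big1 ?add0r // => i _.
by rewrite coefXn ltn_eqF ?scale0r.
Qed.

End LinearExtension.

Section RowModel.
Variables (R : realType) (d : nat) (f : word d -> R[i]).
Local Notation C := R[i].
Hypothesis psd : forall (L : seq (word d)) (c : word d -> C), uniq L ->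
  0 <= \sum_(u <- L) \sum_(w <- L) Num.conj (c u) * c w * herglotz f u w.

Definition code (w : word d) : nat := pickle (w : seq 'I_d).
Definition decode (n : nat) : option (word d) := pickle_inv n.

Lemma codeK w : decode (code w) = Some w.
Proof. exact: pickleK_inv. Qed.

Lemma decodeK n w : decode n = Some w -> code w = n.
Proof.
by have := @pickle_invK (seq 'I_d : countType) n; rewrite /decode => + E; rewrite E.
Qed.

(** The kernel transported to codes of words; a number that codes no word becomes a null vector. *)
Definition knat (i j : nat) : C :=
  if decode i is Some u then if decode j is Some w then herglotz f u w else 0 else 0.

Lemma knat_conj i j : knat j i = Num.conj (knat i j).
Proof.
rewrite /knat; case: (decode i) (decode j) => [u|] [w|]; rewrite ?conjC0 //.
exact: herglotz_conj.
Qed.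

Local Notation E := {poly C}.
Local Notation lin g := (lin_ext (V := C^o) g).

Definition pform (p r : E) : C := lin (fun j => Num.conj (lin (fun i =>
    knat j i : C^o) p : C) : C^o) r.

Lemma pformE p r : pform p r =
  \sum_(j < size r) \sum_(i < size p) Num.conj p`_i * r`_j * knat i j.
Proof.
apply: eq_bigr => j _; rewrite /lin_ext [X in _ *: Num.conj X](_ : _ =
    \sum_(i < size p) p`_i * knat j i) //.
rewrite conj_sum; rewrite [LHS](_ : _ = r`_j * \sum_(i < size p) Num.conj p`_i * Num.conj (knat j
    i)) //.
rewrite mulr_sumr; apply: eq_bigr => i _; rewrite -knat_conj mulrCA mulrA //.
Qed.

Lemma pform_linear p a r s : pform p (a *: r + s) = a * pform p r + pform p s.
Proof. exact: lin_ext_linear. Qed.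

Lemma pform_conj p r : pform r p = Num.conj (pform p r).
Proof.
rewrite !pformE exchange_big rmorph_sum; apply: eq_bigr => j _ /=.
rewrite rmorph_sum; apply: eq_bigr => i _.
rewrite [RHS]conj_mul conj_mul conjCK -knat_conj; congr (_ * _).
exact: mulrC.
Qed.

Lemma pformX i j : pform 'X^i 'X^j = knat i j.
Proof. by rewrite /pform !lin_extX knat_conj conjCK. Qed.

Lemma pform_ge0 p : 0 <= pform p p.
Proof.
pose L : seq (word d) := pmap decode (iota 0 (size p)).
have uL : uniq L.
  exact: (pmap_uniq (@pickle_invK (seq 'I_d : countType)) (iota_uniq _ _)).
have := psd (fun w => p`_(code w)) uL; congr (_ <= _).
rewrite pformE [RHS]exchange_big /=.
have sumL (F : word d -> C) (G : nat -> C) :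
    (forall i, G i = if decode i is Some w then F w else 0) ->
    \sum_(w <- L) F w = \sum_(i < size p) G i.
  move=> FG; rewrite big_pmap -(big_mkord xpredT G) /index_iota subn0.
  by apply: eq_bigr => i _; rewrite FG; case: (decode i).
apply: (sumL _ (fun i => \sum_(j < size p) Num.conj p`_i * p`_j * knat i j)) => i;
    case iE : (decode i) => [u|]; last first.
  by rewrite big1 // => j _; rewrite /knat iE mulr0.
apply/esym/(sumL _ (fun j => Num.conj p`_i * p`_j * knat i j)) => j; rewrite /knat iE;
    case jE : (decode j) => [w|]; last by rewrite mulr0.
by rewrite (decodeK iE) (decodeK jE).
Qed.

Lemma pform0r p : pform p 0 = 0.
Proof. by have := pform_linear p (-1) 0 0; rewrite scaler0 add0r mulN1r addNr. Qed.

Lemma pform0l p : pform 0 p = 0.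
Proof. by rewrite pform_conj pform0r conjC0. Qed.

Definition pshift (j : 'I_d) : {linear E -> E} :=
  lin_ext (fun n => if decode n is Some u then 'X^(code (j :: u)) else 0 : E).

Lemma poly_span (p : E) : linspan (range (fun n => 'X^n : E)) p.
Proof.
rewrite -[p]coefK poly_def; apply: linspan_sum => i; apply: linspanZ; apply: linspan_mem.
by exists i.
Qed.

Lemma pform_shift j k p r : pform (pshift j p) (pshift k r) = (j == k)%:R * pform p r.
Proof.
have X a c : pform (pshift j 'X^a) (pshift k 'X^c) = (j == k)%:R * pform 'X^a 'X^c.
  rewrite /pshift /= !lin_extX pformX /knat.
  case: (decode a) (decode c) => [u|] [w|].
  - by rewrite pformX /knat !codeK herglotz_cons.
  - by rewrite mulr0 pform0r.
  - by rewrite mulr0 pform0l.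
  - by rewrite mulr0 pform0l.
have Xr a s : pform (pshift j 'X^a) (pshift k s) = (j == k)%:R * pform 'X^a s.
  elim/linspan_ind: s / (poly_span s) => [|e _ s [n _ <-] IH].
    by rewrite linear0 !pform0r mulr0.
  by rewrite linearP !pform_linear X IH; ring.
rewrite pform_conj [in RHS]pform_conj -(conjC_nat _ (j == k)) -conj_mul; congr (Num.conj _).
elim/linspan_ind: p / (poly_span p) => [|e _ s [n _ <-] IH].
  by rewrite linear0 !pform0r mulr0.
rewrite linearP !pform_linear IH pform_conj Xr conj_mul conjC_nat -pform_conj; ring.
Qed.

Lemma row_model : exists (K : hilbert R) (x : K) (V Vs : 'I_d -> {linear K -> K}),
  [/\ row_isometry V, forall j, is_adjoint (V j) (Vs j),
     closed_span (range (fun w => op_word V w x)) = setT &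
     forall u w, hdot (op_word V u x) (op_word V w x) = herglotz f u w].
Proof.
have [K [J [V [Vs [Jq Jd Viso Vadj VJ]]]]] :=
  gns poly_span pform_linear pform_conj pform_ge0 pform_shift.
pose x := J 'X^(code [::]).
have VX w : op_word V w x = J 'X^(code w).
  elim: w => [//|j w IH]; rewrite /op_word /= -/(op_word V w x) IH VJ /pshift /= lin_extX.
  by rewrite codeK.
exists K, x, V, Vs; split=> // [|u w]; last first.
  by rewrite !VX Jq pformX /knat !codeK.
apply/seteqP; split=> // y _.
have : closed_span (range J) y by rewrite Jd.
apply: closure_subset; apply: linspan_sub => _ [p _ <-].
elim/linspan_ind: p / (poly_span p) => [|a _ s [n _ <-] IH]; first by rewrite linear0;
    exact: linspan0.
rewrite linearP; apply: linspanD => //; apply: linspanZ.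
case nE : (decode n) => [w|].
  apply: linspan_mem; exists w => //; rewrite VX; congr (J 'X^_).
  exact: decodeK.
suff -> : J 'X^n = 0 by exact: linspan0.
apply/eqP; rewrite -normr_eq0 -sqrf_eq0 -hdot_norm Jq pformX /knat nE //.
Qed.

End RowModel.

(** * Orthonormal families and the compression to a finite-dimensional space *)

Section Orthonormal.
Variables (R : realType) (K : hilbert R).
Local Notation C := R[i].

Lemma hdotZr (y z : K) a : hdot y (a *: z) = a * hdot y z.
Proof. exact: (qZr (@hdot_linear R K)). Qed.

Lemma hdotBr (y z t : K) : hdot y (z - t) = hdot y z - hdot y t.
Proof. exact: (qBr (@hdot_linear R K)). Qed.

Lemma hdotBl (y z t : K) : hdot (z - t) y = hdot z y - hdot t y.
Proof. by rewrite addrC -scaleN1r hdot_linearl rmorphN rmorph1 mulN1r addrC. Qed.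

Lemma hdotZl (y z : K) a : hdot (a *: y) z = Num.conj a * hdot y z.
Proof. exact: (qZl (@hdot_linear R K) (@hdotC R K)). Qed.

Lemma hdot_sumr (I : Type) (r : seq I) (F : I -> K) y :
  hdot y (\sum_(i <- r) F i) = \sum_(i <- r) hdot y (F i).
Proof. exact: (q_sumr (@hdot_linear R K)). Qed.

Lemma hdot0r (y : K) : hdot y 0 = 0.
Proof. exact: (q0r (@hdot_linear R K)). Qed.

Lemma hdot_suml (I : Type) (r : seq I) (F : I -> K) y :
  hdot (\sum_(i <- r) F i) y = \sum_(i <- r) hdot (F i) y.
Proof.
apply: (big_morph (fun z => hdot z y)) => [z t|]; last by rewrite hdotC hdot0r conjC0.
by rewrite -[z]scale1r hdot_linearl scale1r rmorph1 mul1r.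
Qed.

(** If [m < N], the representatives [xi i] in [C^m] satisfy a linear relation. As the vectors [s u]
    are total, the [e i] satisfy it too, against orthonormality. *)
Lemma orthonormal_bound (I : Type) (s : I -> K) m (ell : I -> 'cV[C]_m -> C)
    N (e : 'I_N -> K) :
  (forall u a y z, ell u (a *: y + z) = a * ell u y + ell u z) ->
  closed_span (range s) = setT ->
  (forall i, exists xi, forall u, hdot (s u) (e i) = ell u xi) ->
  (forall i j, hdot (e i) (e j) = (i == j)%:R) -> (N <= m)%N.
Proof.
move=> el sd /choice [xi xiE] eo; rewrite leqNgt; apply/negP => mN.
pose X := \matrix_(i < N, l < m) xi i l 0.
have : kermx X != 0.
  rewrite kermx_eq0; apply/negP => /eqP Xf.
  by have := rank_leq_col X; rewrite Xf leqNgt mN.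
case/rowV0Pn => c /sub_kermxP cX c0.
have xi0 : \sum_i c 0 i *: xi i = 0.
  apply/matrixP => l z; rewrite (ord1 z) summxE [RHS]mxE.
  have /matrixP/(_ 0 l) := cX; rewrite [LHS]mxE [RHS]mxE => E; rewrite -[RHS]E.
  by apply: eq_bigr => i _; rewrite !mxE.
have ell0 u : ell u 0 = 0 by have := el u (-1) 0 0; rewrite scaler0 add0r mulN1r addNr.
have ell_sum u (r : seq 'I_N) : ell u (\sum_(i <- r) c 0 i *: xi i) =
    \sum_(i <- r) c 0 i * ell u (xi i).
  elim: r => [|i r IH]; first by rewrite !big_nil.
  by rewrite !big_cons el IH.
have y0 : \sum_i c 0 i *: e i = 0.
  apply: (hdot_lim0 sd) => _ [u _ <-]; rewrite hdotC hdot_sumr.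
  under eq_bigr do rewrite hdotZr xiE.
  by rewrite -ell_sum xi0 ell0 conjC0.
move/negP: c0; apply; apply/eqP/rowP => j; rewrite mxE.
have : hdot (e j) (\sum_i c 0 i *: e i) = 0 by rewrite y0 hdot0r.
rewrite hdot_sumr (bigD1 j) //= hdotZr eo eqxx mulr1 big1 ?addr0 // => i ij.
by rewrite hdotZr eo eq_sym (negPf ij) mulr0.
Qed.

(** The bound provides an orthonormal family of maximal length; the normalized residual of a vector
    outside its span would extend it. *)
Lemma orthonormal_basis (H : set K) m : H 0 ->
  (forall a y z, H y -> H z -> H (a *: y + z)) ->
  (forall N (e : 'I_N -> K), (forall i, H (e i)) ->
    (forall i j, hdot (e i) (e j) = (i == j)%:R) -> (N <= m)%N) ->
  exists N (e : 'I_N -> K), [/\ forall i, H (e i),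
    forall i j, hdot (e i) (e j) = (i == j)%:R &
    forall y, H y -> y = \sum_i hdot (e i) y *: e i].
Proof.
move=> H0 Hl bound.
pose P N := `[< exists e : 'I_N -> K, (forall i, H (e i)) /\
  (forall i j, hdot (e i) (e j) = (i == j)%:R) >].
have P0 : exists N, P N by exists 0%N; apply/asboolP; exists (fun=> 0); split=> [] [].
have Pm N : P N -> (N <= m)%N by case/asboolP => e [He eo]; exact: bound eo.
case: (ex_maxnP P0 Pm) => N /asboolP [e [He eo]] maxN.
exists N, e; split=> // y Hy; apply/eqP; rewrite -subr_eq0.
pose r := y - \sum_i hdot (e i) y *: e i.
rewrite -/r; apply/negPn/negP => r0.
have Hr : H r.
  rewrite /r -[- _]scaleN1r scaler_sumr addrC.
  elim/big_rec: _ => [|i z _ Hz]; first by rewrite add0r.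
  by rewrite scalerA -addrA; exact: Hl.
have er j : hdot (e j) r = 0.
  rewrite hdotBr hdot_sumr (bigD1 j) //= hdotZr eo eqxx mulr1 big1 ?addr0 ?subrr // => i ij.
  by rewrite hdotZr eo eq_sym (negPf ij) mulr0.
have nr : `|r| != 0 by rewrite normr_eq0.
pose e' (i : 'I_N.+1) := if unlift ord_max i is Some j then e j else `|r|^-1 *: r.
suff /maxN : P N.+1 by rewrite ltnn.
apply/asboolP; exists e'; split=> [i|i j].
  rewrite /e'; case: unliftP => [j _|_]; first exact: He.
  by rewrite -[_ *: r]addr0; exact: Hl.
have cn : Num.conj `|r|^-1 = `|r|^-1 by apply/CrealP; rewrite ger0_real // invr_ge0.
rewrite /e'; case: (unliftP ord_max i) => [i' ->|->]; case: (unliftP ord_max j) => [j' ->|->].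
- by rewrite eo (inj_eq lift_inj).
- by rewrite hdotZr er mulr0 eq_sym (negPf (neq_lift _ _)).
- by rewrite hdotC hdotZr er mulr0 conjC0 (negPf (neq_lift _ _)).
- by rewrite hdotZr hdotZl cn hdot_norm eqxx mulrA -expr2 -exprMn mulVf // expr1n.
Qed.

End Orthonormal.

Section Compression.
Variables (R : realType) (d : nat) (K : hilbert R) (x : K) (V Vs : 'I_d -> {linear K -> K}).
Local Notation C := R[i].
Variables (k : nat) (S : sys R d k).
Hypothesis Viso : row_isometry V.
Hypothesis Vadj : forall j, is_adjoint (V j) (Vs j).
Hypothesis Vcyc : closed_span (range (fun w => op_word V w x)) = setT.
Hypothesis Vx : forall u w, hdot (op_word V u x) (op_word V w x) = herglotz (tay S) u w.

Let H := linspan (range (fun w => op_word Vs w x)).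

Lemma adj_word u w : hdot (op_word V u x) (op_word Vs w x) = herglotz (tay S) (rev w ++ u) [::].
Proof.
elim: w u => [|j w IH] u; first exact: (Vx u [::]).
rewrite rev_cons cat_rcons -IH [op_word Vs _ _]/= -/(op_word Vs w x).
by rewrite hdotC [RHS]hdotC; congr (Num.conj _); exact: Vadj.
Qed.

Lemma nu_cat s u : s != [::] -> nu S (s ++ u) = mxword (sA S) (rev u) *m nu S s.
Proof.
move=> s0; elim/last_ind: u => [|u i IH]; first by rewrite cats0 mul1mx.
rewrite -rcons_cat nu_rcons IH rev_rcons /= mulmxA -size_eq0 size_cat addn_eq0 size_eq0.
by rewrite (negPf s0) scale0r addr0.
Qed.

(** The extra coordinate accounts for [x] itself: its pairing with [V^u x] at the empty word [u] is
    a kernel value, not a moment of [S]. *)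
Let ell (u : word d) (xi : 'cV[C]_(1 + k)) : C :=
  usubmx xi 0 0 * herglotz (tay S) u [::] + (sC S *m mxword (sA S) (rev u) *m dsubmx xi) 0 0.

Lemma ell_linear u a y z : ell u (a *: y + z) = a * ell u y + ell u z.
Proof.
have El : usubmx (a *: y + z : 'cV[C]_(1 + k)) = a *: usubmx y + usubmx z by rewrite linearP.
have Er : dsubmx (a *: y + z : 'cV[C]_(1 + k)) = a *: dsubmx y + dsubmx z by rewrite linearP.
have mD (A B : 'M[C]_1) : (A + B) 0 0 = A 0 0 + B 0 0 by rewrite mxE.
have mZ c (A : 'M[C]_1) : (c *: A) 0 0 = c * A 0 0 by rewrite mxE.
rewrite /ell El Er mulmxDr -scalemxAr !mD !mZ; ring.
Qed.

(* Hankel: the functionals [<V^u x, .>] on the span of the [V*^w x] factor through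
   [C + C^k]. *)
Lemma H_state y : H y -> exists xi, forall u, hdot (op_word V u x) y = ell u xi.
Proof.
move: y; apply: linspan_ind.
  exists 0 => u; rewrite hdot0r.
  by have := ell_linear u (-1) 0 0; rewrite scaler0 add0r mulN1r addNr => ->.
move=> a _ z [w _ <-] [xi xiE].
suff [eta etaE] : exists xi, forall u, hdot (op_word V u x) (op_word Vs w x) = ell u xi.
  by exists (a *: eta + xi) => u; rewrite hdot_linear etaE xiE ell_linear.
have [w0|w0] := eqVneq (rev w) [::].
  exists (col_mx 1%:M 0) => u; rewrite adj_word w0 /ell col_mxKu col_mxKd mulmx0 !mxE eqxx.
  by rewrite mul1r addr0.
exists (col_mx 0 (nu S (rev w))) => u; rewrite adj_word /ell col_mxKu col_mxKd.
rewrite herglotz_nil; last by rewrite -size_eq0 size_cat addn_eq0 size_eq0 (negPf w0).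
rewrite [X in X * _]mxE mul0r add0r -mulmxA -(nu_cat u w0) /tay.
by case: (rev w) w0.
Qed.

Lemma H_Vs j y : H y -> H (Vs j y).
Proof.
apply: linspan_linear => _ [w _ <-]; apply: linspan_mem; by exists (j :: w).
Qed.

(** Bessel's inequality for the orthogonal ranges of the [V_j]. On a subspace invariant under the
    [V_j^*] it makes the compression a row contraction. *)
Lemma row_bessel y : \sum_j hdot (Vs j y) (Vs j y) <= hdot y y.
Proof.
have h : 0 <= hdot (y - \sum_j V j (Vs j y)) (y - \sum_j V j (Vs j y)).
  by rewrite hdot_norm exprn_ge0.
have E1 : hdot y (\sum_j V j (Vs j y)) = \sum_j hdot (Vs j y) (Vs j y).
  by rewrite hdot_sumr; apply: eq_bigr => j _; rewrite Vadj.
have E2 : hdot (\sum_j V j (Vs j y)) y = \sum_j hdot (Vs j y) (Vs j y).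
  rewrite hdot_suml; apply: eq_bigr => j _.
  by rewrite hdotC -Vadj -hdotC.
have E3 : hdot (\sum_j V j (Vs j y)) (\sum_j V j (Vs j y)) = \sum_j hdot (Vs j y) (Vs j y).
  rewrite hdot_suml; apply: eq_bigr => j _; rewrite hdot_sumr (bigD1 j) //= big1.
    by rewrite Viso eqxx mul1r addr0.
  by move=> i ij; rewrite Viso eq_sym (negPf ij) mul0r.
by rewrite hdotBr !hdotBl E1 E2 E3 subrr subr0 subr_ge0 in h.
Qed.

Lemma compression : exists N (T : mxtuple R d N) (x0 : 'cV[C]_N),
  [/\ row_contraction T, cyclic_adj T x0, cyclic_min_dilation T x0,
      cdot x0 x0 = herglotz (tay S) [::] [::] &
      forall w j, cdot x0 (mxadj_word T w ((T j)^t* *m x0)) = tay S (j :: rev w)].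
Proof.
have [N [e [He eo eH]]] : exists N (e : 'I_N -> K), [/\ forall i, H (e i),
    forall i j, hdot (e i) (e j) = (i == j)%:R &
    forall y, H y -> y = \sum_i hdot (e i) y *: e i].
  apply: (@orthonormal_basis R K H (1 + k)); first exact: linspan0.
    by move=> a y z Hy Hz; apply: linspanD => //; exact: linspanZ.
  move=> N e He eo; apply: (orthonormal_bound ell_linear Vcyc) eo => i.
  exact: H_state (He i).
pose iotaf (h : 'cV[C]_N) : K := \sum_i h i 0 *: e i.
have iota_lin : linear iotaf.
  move=> a y z; rewrite /iotaf scaler_sumr -big_split; apply: eq_bigr => i _ /=.
  by rewrite !mxE scalerDl scalerA.
pose iota : {linear 'cV[C]_N -> K} := HB.pack iotaf (GRing.isLinear.Build C 'cV[C]_N K *:%R _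
    iota_lin).
have iotaE h : iota h = \sum_i h i 0 *: e i by [].
pose co (y : K) : 'cV[C]_N := \col_i hdot (e i) y.
have e_iota i h : hdot (e i) (iota h) = h i 0.
  rewrite iotaE hdot_sumr (bigD1 i) //= hdotZr eo eqxx mulr1 big1 ?addr0 // => j ij.
  by rewrite hdotZr eo eq_sym (negPf ij) mulr0.
have coK y : H y -> iota (co y) = y.
  by move=> Hy; rewrite [RHS]eH //; apply: eq_bigr => i _; rewrite mxE.
have iotaK h : co (iota h) = h by apply/colP => i; rewrite mxE e_iota.
have iotaH h : H (iota h).
  by apply: linspan_sum => i; apply: linspanZ; exact: He.
have iota_iso h h' : hdot (iota h) (iota h') = cdot h h'.
  rewrite {1}iotaE hdot_suml cdotE; apply: eq_bigr => i _.
  by rewrite hdotZl e_iota.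
(* The matrix is that of [Vs j] on [H] in the basis [e], so it is the adjoint of [T j] that equals
   the restriction. *)
pose T : mxtuple R d N := fun j => (\matrix_(a, b) hdot (e a) (Vs j (e b)))^t*.
have TK j : (T j)^t* = \matrix_(a, b) hdot (e a) (Vs j (e b)) by rewrite /T trmxCK.
have VsT j h : Vs j (iota h) = iota ((T j)^t* *m h).
  rewrite -[LHS]coK; last by apply: H_Vs; exact: iotaH.
  congr (iota _); apply/colP => i; rewrite TK !mxE iotaE linear_sum hdot_sumr.
  by apply: eq_bigr => j' _; rewrite linearZ hdotZr mxE mulrC.
have xH : H x by apply: linspan_mem; exists [::].
pose x0 := co x; have x0E : iota x0 = x by exact: coK.
have word_iota w h : op_word Vs w (iota h) = iota (mxadj_word T w h).
  elim: w => [//|j w IH]; rewrite [LHS]/= -/(op_word Vs w _) IH VsT //.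
have dil : min_row_isometric_dilation T iota V.
  split=> //; first by move=> j; exists (Vs j).
  apply/seteqP; split=> // y _; have : closed_span (range (fun w =>
      op_word V w x)) y by rewrite Vcyc.
  apply: closure_subset; apply: linspan_sub => _ [w _ <-]; apply: linspan_mem.
  by exists w, x0; rewrite x0E.
exists N, T, x0; split.
- move=> v; have h := row_bessel (iota v); have E := cdot_row_adj T v.
  have E2 : \sum_j hdot (Vs j (iota v)) (Vs j (iota v)) =
      \sum_j cdot ((T j)^t* *m v) ((T j)^t* *m v).
    by apply: eq_bigr => j _; rewrite VsT iota_iso.
  by rewrite E2 E iota_iso lerBlDr lerDl in h.
- apply/seteqP; split=> // h _; rewrite -[X in linspan _ X]iotaK.
  move: (iota h) (iotaH h); apply: linspan_ind => [|a _ z [w _ <-] IH].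
    suff -> : co 0 = 0 by exact: linspan0.
    by apply/colP => i; rewrite !mxE hdot0r.
  have -> : co (a *: op_word Vs w x + z) = a *: co (op_word Vs w x) + co z.
    by apply/colP => i; rewrite !mxE hdot_linear.
  apply: linspan_cons => //; exists w => //.
  by rewrite -[in RHS]x0E word_iota iotaK.
- exists K, iota, V; split=> //; by rewrite x0E.
- by rewrite -iota_iso x0E -(Vx [::] [::]).
- move=> w j; rewrite -iota_iso -word_iota -VsT x0E.
  have := adj_word [::] (rcons w j); rewrite cats0 rev_rcons herglotz_nil // => <-.
  by rewrite /op_word /word_act -cats1 foldr_cat.
Qed.

End Compression.

Lemma scale_moment (F : comNzRingType) n (c : F) (u : 'rV[F]_n) (M : 'M[F]_n) (y : 'cV[F]_n) :
  c *: u *m M *m (c *: y) = c ^+ 2 *: (u *m (M *m y)).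
Proof. by rewrite -scalemxAr -!scalemxAl scalerA -expr2 mulmxA. Qed.

Lemma scale_rank1 (F : comNzRingType) n (a c : F) (P : 'M[F]_n) (x : 'cV[F]_n) (u : 'rV[F]_n) :
  a * c = 1 ->
  P - a *: ((c *: (P *m x)) *m (c *: u)) = P *m (1%:M - c *: (x *m u)).
Proof.
move=> ac; rewrite mulmxBr mulmx1 -!scalemxAr -!scalemxAl mulmxA !scalerA.
by rewrite mulrA ac mul1r.
Qed.

(** * From the row isometry back to the Clark colligation *)

Section Converse.
Variables (R : realType) (d : nat).
Local Notation C := R[i].

(** With [a = (1 - sD S)^-1] this undoes the rank one change that [feedback] makes to the state
    matrices. *)
Definition perturb k (a : C) (S : sys R d k) : sys R d k :=
  Sys (fun j => sA S j - a *: (sB S j *m sC S)) (sB S) (sC S) (sD S).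

(** Expanding a factor [A_j - a B_j C] splits a moment at [B_j C] into a product of shorter ones, so
    perturbed moments are polynomials in the original ones. The prefix [u] collects the letters
    already expanded. *)
Lemma perturb_moments k k' (a : C) (S : sys R d k) (S' : sys R d k') :
  moment_eq S S' -> moment_eq (perturb a S) (perturb a S').
Proof.
move=> SS w i.
have rc k0 (A : mxtuple R d k0) u j : mxword A (rcons u j) = mxword A u *m A j.
  by elim: u => [|h u IH] /=; rewrite ?mulmx1 ?mul1mx // IH mulmxA.
suff H u : sC S *m mxword (sA S) u *m (mxword (sA (perturb a S)) w *m sB S i) =
    sC S' *m mxword (sA S') u *m (mxword (sA (perturb a S')) w *m sB S' i).
  by have := H [::]; rewrite /= !mulmx1 !mulmxA.
elim: w u => [|j w IH] u /=; first by rewrite !mul1mx; exact: SS.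
have E k0 (S0 : sys R d k0) X : sC S0 *m mxword (sA S0) u *m ((sA S0 j -
    a *: (sB S0 j *m sC S0)) *m X) =
    sC S0 *m mxword (sA S0) (rcons u j) *m X - a *: (sC S0 *m mxword (sA S0) u *m sB S0 j *m (sC
        S0 *m X)).
  by rewrite rc mulmxBl mulmxBr -scalemxAl -scalemxAr !mulmxA.
rewrite -![_ *m _ *m sB _ i]mulmxA !E IH SS.
by have := IH [::]; rewrite /= !mulmx1 => ->.
Qed.

Lemma mxadj_word_mx N (T : mxtuple R d N) w y :
  mxadj_word T w y = mxword (fun j => (T j)^t*) w *m y.
Proof. by elim: w => [|j w IH]; rewrite ?mul1mx // mxadj_word_cons IH mulmxA. Qed.

(** [S] and the Clark system arise by the same perturbation from two systems with equal moments:
    [feedback S] without its factor [a ^+ 2] on the output, and [T^*] with input and output rescaled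
    by [1 - sD S]. *)
Lemma clark_moments k (S : sys R d k) N (T : mxtuple R d N) x : sD S != 1 ->
  (forall w j, cdot x (mxadj_word T w ((T j)^t* *m x)) = tay (feedback S) (j :: rev w)) ->
  moment_eq S (clark_sys T x (sD S)).
Proof.
move=> D1 H; have c0 : 1 - sD S != 0 by rewrite subr_eq0 eq_sym.
pose a := (1 - sD S)^-1.
pose S1 := Sys (fun j => sA S j + a *: (sB S j *m sC S)) (sB S) (sC S) (sD S).
pose S2 := Sys (fun j => (T j)^t*) (fun j => (1 - sD S) *: ((T j)^t* *m x))
  ((1 - sD S) *: x^t*) (sD S).
have S12 : moment_eq S1 S2.
  move=> w j; apply/matrixP => p q; rewrite (ord1 p) (ord1 q).
  have -> : sC S2 *m mxword (sA S2) w *m sB S2 j =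
      (1 - sD S) ^+ 2 *: (x^t* *m mxadj_word T w ((T j)^t* *m x)).
    by rewrite mxadj_word_mx; exact: scale_moment.
  rewrite [RHS]mxE -/(cdot x _) H /tay nu_mxword revK.
  have -> : sC (feedback S) *m (mxword (sA (feedback S)) w *m sB (feedback S) j) =
      a ^+ 2 *: (sC S1 *m mxword (sA S1) w *m sB S1 j).
    by rewrite /feedback /= -scalemxAl mulmxA.
  have mZ e (A : 'M[C]_1) : (e *: A) 0 0 = e * A 0 0 by rewrite mxE.
  by rewrite mZ mulrA -exprMn divff // expr1n mul1r.
have := perturb_moments a S12.
have -> : perturb a S1 = S.
  rewrite /perturb /=; case: (S) => A B C' D'; congr Sys; apply/funext => j.
  by rewrite addrK.
suff -> : perturb a S2 = clark_sys T x (sD S) by [].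
rewrite /perturb /clark_sys /=; congr Sys; apply/funext => j.
by apply: scale_rank1; rewrite mulVf.
Qed.

Lemma clark_adj N (T : mxtuple R d N) x b0 j y :
  (T j)^t* *m y = sA (clark_sys T x b0) j *m y + cdot x y *: sB (clark_sys T x b0) j.
Proof.
rewrite /= mulmxBr mulmx1 mulmxBl -!scalemxAr -scalemxAl scalerA [cdot _ _ * _]mulrC -scalerA.
suff -> : (T j)^t* *m (x *m x^t*) *m y = cdot x y *: ((T j)^t* *m x) by rewrite subrK.
by rewrite -!mulmxA [x^t* *m y]mx11_scalar -/(cdot x y) mul_mx_scalar scalemxAr.
Qed.

(** By [T_j^* y = A_j y + <x, y> B_j] the reachable space is invariant under the [T_j^*] and so
    fills [H0]. On a vector whose outputs all vanish, [A_j] acts as [T_j^*], which makes the vector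
    orthogonal to every [T^w x]. *)
Lemma clark_minimal N (T : mxtuple R d N) x b0 : b0 != 1 ->
  cyclic_adj T x -> cyclic_min_dilation T x -> fm_minimal (colligation_of T x b0).
Proof.
move=> b01 cyc dil; have c0 : 1 - b0 != 0 by rewrite subr_eq0 eq_sym.
set S := clark_sys T x b0.
apply: fm_minimal_of => v.
  pose G := [set y | exists w j, y = mxword (sA S) w *m sB S j].
  have GT j y : linspan G y -> linspan G ((T j)^t* *m y).
    move=> Gy; rewrite (clark_adj T x b0) -/S; apply: linspanD.
      apply: (@linspan_linear _ _ _ (mulmx (sA S j))) Gy => _ [w [i ->]].
      by apply: linspan_mem; exists (j :: w), i; rewrite /= mulmxA.
    by apply: linspanZ; apply: linspan_mem; exists [::], j; rewrite mul1mx.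
  have Gw j w : linspan G (mxadj_word T (j :: w) x).
    elim: w j => [|i w IH] j; rewrite mxadj_word_cons; last by apply: GT; exact: IH.
    have -> : (T j)^t* *m mxadj_word T [::] x = (1 - b0)^-1 *: (mxword (sA S) [::] *m sB S j).
      by rewrite mul1mx scalerA mulVf // scale1r.
    by apply: linspanZ; apply: linspan_mem; exists [::], j.
  have : linspan G (vsval v).
    have /memv_vspan := subvsP v; apply: linspan_sub => _ [[|j w] // _ <-]; exact: Gw.
  rewrite -{2}[v]vsvalK; apply: linspan_linear => _ [w [j ->]].
  rewrite -(colligation_word b0 cyc) /= vsvalK; apply: linspan_mem; by exists w, j.
move=> vC; apply: val_inj => /=.
have zE w : vsval (word_act (fun j => fmA (colligation_of T x b0) j) w v) =
    mxadj_word T w (vsval v).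
  elim: w => [//|j w IH]; rewrite [LHS]/= (colligation_A b0 cyc) mxadj_word_cons -IH.
  have := vC w; rewrite colligation_C /= -scalemxAl mxE => /eqP; rewrite mulf_eq0 (negPf c0) /=.
  by move=> /eqP xz; rewrite (clark_adj T x b0) /cdot xz scale0r addr0.
have xw w : cdot x (mxadj_word T w (vsval v)) = 0.
  have := vC w; rewrite colligation_C /= -scalemxAl mxE zE => /eqP; rewrite mulf_eq0 (negPf c0) /=.
  by move/eqP.
apply: (cyclic_min_dilation_ortho dil) => w.
suff -> : cdot (word_act (fun j z => T j *m z) w x) (vsval v) =
    cdot x (mxadj_word T (rev w) (vsval v)) by [].
move: (vsval v); elim: w => [//|j w IH] y; rewrite [X in cdot X _]/= cdot_mull IH.
by rewrite rev_cons /mxadj_word /word_act -cats1 foldr_cat.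
Qed.

(** Solving [b0 = (h - 1) / (h + 1)] gives [h = 2 a - 1] with [a = (1 - b0)^-1]. By hypothesis its
    real part is [|x|^2]; its imaginary part is [t]. *)
Lemma clark_value_exists N (x : 'cV[C]_N) (b0 : C) : b0 != 1 ->
  cdot x x = (1 - b0)^-1 + Num.conj (1 - b0)^-1 - 1 -> exists t, b0 = clark_value x t.
Proof.
move=> b01; have c0 : 1 - b0 != 0 by rewrite subr_eq0 eq_sym.
pose a := (1 - b0)^-1; rewrite cdot_cnorm -/a => xE.
have a0 : a != 0 by rewrite invr_eq0.
exists (complex.Im (2 * a - 1)); rewrite /clark_value.
have -> : (cnorm x ^+ 2 +i* complex.Im (2 * a - 1)) = 2 * a - 1 :> C.
  have := congr1 (@complex.Re R) xE; rewrite /= => ->.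
  by move: (a) => [u v]; rewrite [RHS]complexE /=; congr (_ +i* _); simpc => /=; ring.
have -> : b0 = 1 - a^-1 by rewrite invrK subKr.
rewrite -addrA -opprD subrK; field; exact: a0.
Qed.

Lemma ball_clark (b : nc_ratfun R d) : nc_dom b (origin R d) ->
  ~ nc_reps b (NCConst d 1) -> ratfun_in_hinf_ball b ->
  exists N (T : mxtuple R d N) (x : 'cV[C]_N) t, clark_realization b T x t.
Proof.
move=> [_ [W0 W0b]] b1 bb; have [s sb sW] := W0b.
have [k [S [bS SD]]] := expr_origin_realized sb sW.
have D1 := ball_at0_neq1 bb bS b1.
have DE : nc_at0 b = sD S by rewrite /nc_at0 (nc_val_eval _ W0b) // SD.
have psd := herglotz_psd bb bS D1.
have [K [x [V [Vs [Viso Vadj Vcyc Vx]]]]] := row_model psd.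
have [N [T [x0 [Tc cyc dil xx xw]]]] := compression Viso Vadj Vcyc Vx.
have [t tE] : exists t, sD S = clark_value x0 t.
  by apply: clark_value_exists; rewrite // xx /herglotz /=.
exists N, T, x0, t; split=> //; first by rewrite DE.
split; first by rewrite DE; exact: clark_minimal.
apply/fm_realizesP; apply: (realized_moments bS) => //.
move=> w j; rewrite DE (colligation_moments _ cyc); exact: clark_moments.
Qed.

End Converse.

Theorem theorem4 (R : realType) (d : nat) (b : nc_ratfun R d)
    (d_gt0 : (0 < d)%N) (b_dom0 : nc_dom b (origin R d))
    (b_neq1 : ~ nc_reps b (NCConst d 1)) :
  (ratfun_in_hinf_ball b <->
   exists (N : nat) (T : mxtuple R d N) (x : 'cV[R[i]%C]_N) (t : R),
     clark_realization b T x t) /\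
  (forall (N : nat) (T : mxtuple R d N) (x : 'cV[R[i]%C]_N) (t : R),
     clark_realization b T x t -> (inner b <-> row_coisometry T)).
Proof.
split.
  split=> [bb|[N [T [x [t]]]]]; first exact: ball_clark.
  exact: clark_ball.
move=> N T x t cr; split; first exact: (inner_coisometry cr).
exact: (coisometry_inner cr).
Qed.
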